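(* For each $n$ let $W_n$ be one of the groups $S_n,B_n,D_n$, and let $d=d(n)$ be integers with $1\le d\le d_{\max}-1$ such that $N^{=}_{n,d}\to\infty$ as $n\to\infty$. Let $(X_{nj})_{j=1,\dots,k_n}$ be a row-wise i.i.d. triangular array with $X_{n1}$ distributed as $X_{\mathrm{des}}^{(d)}$ on $W_n$, and let $M_n=\max\{X_{n1},\dots,X_{nk_n}\}$. Let $\sigma_n=\sqrt{\mathrm{Var}(X_{\mathrm{des}}^{(d)})}$, $a_n=\sigma_n\alpha_{k_n}$ and $b_n=\sigma_n\beta_{k_n}+\mathbb E\bigl(X_{\mathrm{des}}^{(d)}\bigr)$. If $k_n=\exp\bigl(o\bigl((N^{=}_{n,d})^{1/7}\bigr)\bigr)$, then for all $x\in\mathbb R$, $$\mathbb P(M_n\le a_nx+b_n)\longrightarrow\exp(-\exp(-x))\qquad(n\to\infty).$$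
   Context: The normalizing sequences are $\alpha_k=\frac1{\sqrt{2\log k}}$ and $\beta_k=\frac1{\alpha_k}-\frac12\alpha_k\bigl(\log\log k+\log(4\pi)\bigr)$. Set $d_{\max}=n$ for $S_n$, $d_{\max}=2n$ for $B_n$, $d_{\max}=2n-2$ for $D_n$. Let $Z_1,\dots,Z_n$ be i.i.d., uniform on $(0,1)$ for $S_n$ and uniform on $(-1,1)$ for $B_n$, $D_n$. For $1\le d\le d_{\max}-1$ define $X_{\mathrm{des}}^{(d)}=\sum_{i=1}^{n-d}\mathbf 1\{Z_i>Z_{i+d}\}$ on $S_n$; $X_{\mathrm{des}}^{(d)}=\sum_{i=1}^{n-d}\mathbf 1\{Z_i>Z_{i+d}\}+\sum_{i=1}^{\lceil d/2\rceil-1}\mathbf 1\{-Z_i>Z_{d-i}\}+\mathbf 1\{Z_d<0\}$ on $B_n$; $X_{\mathrm{des}}^{(d)}=\sum_{i=1}^{n-d}\mathbf 1\{Z_i>Z_{i+d}\}+\sum_{i=1}^{\lceil d/2\rceil}\mathbf 1\{-Z_i>Z_{d+2-i}\}$ on $D_n$. Indicators involving an index outside $\{1,\dots,n\}$ are omitted, and empty sums are $0$. $N^{=}_{n,d}$ is the number of positive roots of height exactly $d$, i.e. the number of (non-omitted) indicator summands in $X_{\mathrm{des}}^{(d)}$.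
   Formalization: The formal theorem additionally assumes k_n → ∞, without which the claim is false: for S_n with d = 1 and k_n = 2 the limit is Φ(α_2 x + β_2)², not exp(−exp(−x)). *)

(* Defs.v *)
From HB Require Import structures.
From mathcomp Require Import all_boot all_order all_algebra.
From mathcomp Require Import all_classical all_reals all_analysis.

Set Implicit Arguments.
Unset Strict Implicit.
Unset Printing Implicit Defensive.
Import Order.TTheory GRing.Theory Num.Theory.
Import numFieldNormedType.Exports.
Local Open Scope classical_set_scope.
Local Open Scope ring_scope.

Inductive weyl_type := WeylS | WeylB | WeylD.

Definition dmax (t : weyl_type) (n : nat) : nat :=
  match t with
  | WeylS => n
  | WeylB => n.*2
  | WeylD => n.*2 - 2
  end.

(* [Xdes t n d z] is the number of d-descents computed from z 1, ..., z n; the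
   other values of z are never used.  [uphalf d] is the ceiling of d / 2. The
   filters implement the convention that indicators with an index outside
   {1, ..., n} are omitted; no filter is needed on the first sum, which is empty
   when n <= d thanks to the truncated subtraction. *)
Definition Xdes (R : realType) (t : weyl_type) (n d : nat) (z : nat -> R) : R :=
  let shift := \sum_(1 <= i < (n - d).+1) (z (i + d)%N < z i)%R%:R in
  match t with
  | WeylS => shift
  | WeylB => shift
      + \sum_(1 <= i < uphalf d | (i <= n)%N && (d - i <= n)%N)
          (z (d - i)%N < - z i)%R%:R
      + (if (d <= n)%N then (z d < 0)%R%:R else 0)
  | WeylD => shift
      + \sum_(1 <= i < (uphalf d).+1 | (i <= n)%N && (d + 2 - i <= n)%N)
          (z (d + 2 - i)%N < - z i)%R%:R
  end.

(* Number of positive roots of height d: one for each summand of [Xdes]. *)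
Definition Nroots (t : weyl_type) (n d : nat) : nat :=
  let shift := (\sum_(1 <= i < (n - d).+1) 1)%N in
  match t with
  | WeylS => shift
  | WeylB => (shift
      + \sum_(1 <= i < uphalf d | (i <= n) && (d - i <= n)) 1
      + (if d <= n then 1 else 0))%N
  | WeylD => (shift
      + \sum_(1 <= i < (uphalf d).+1 | (i <= n) && (d + 2 - i <= n)) 1)%N
  end.

(* The Z_i are uniform on (Zinf t, 1). *)
Definition Zinf (R : realType) (t : weyl_type) : R :=
  if t is WeylS then 0 else -1.

Lemma Zinf_lt1 (R : realType) (t : weyl_type) : Zinf R t < 1.
Proof. by case: t; rewrite /Zinf ?ltr01// gtrN. Qed.

(* [iid_with_law m X mu]: the random variables X 1, ..., X m are mutually
   independent (product rule over every subfamily) and all have law mu; nothing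
   is required of X j for the other indices j. *)
Definition iid_with_law (R : realType) (d : measure_display)
    (T : measurableType d) (P : probability T R) (m : nat)
    (X : nat -> {RV P >-> R}) (mu : set R -> \bar R) : Prop :=
  (forall (J : seq nat) (A : nat -> set R),
     uniq J -> (forall j, j \in J -> (1 <= j <= m)%N) ->
     (forall j, measurable (A j)) ->
     P [set w | forall j, j \in J -> A j (X j w)] =
       (\prod_(j <- J) P (X j @^-1` A j))%E) /\
  (forall j, (1 <= j <= m)%N ->
     forall A : set R, measurable A -> P (X j @^-1` A) = mu A).

Definition alpha (R : realType) (k : nat) : R :=
  (Num.sqrt (2 * ln k%:R))^-1.

Definition beta (R : realType) (k : nat) : R :=
  (alpha R k)^-1 - 2^-1 * alpha R k * (ln (ln k%:R) + ln (4 * pi)).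

(* Main.v *)
(* The d-descents form a disjoint union of monotone paths of indices (for B_n and
   D_n after replacing some Z_i by - Z_i), so X_des counts the descents of
   independent sequences of i.i.d. uniforms, up to one indicator. After
   replacing the uniforms by residues modulo a large m, a descent of (y, y') is
   U + y - y' with U = (y' - y) mod m divided by m, and U is uniform and
   independent of the past: the count telescopes to a sum of i.i.d. uniform
   increments plus a boundary term, hence it is the end of a martingale with
   bounded steps and deterministic conditional variances.
   Lindeberg's method with a smoothed Gaussian tail, whose error is controlled by
   an exponential supermartingale, gives P(X_des - E > sigma u) = (1 + o(1)) times
   the Gaussian tail as long as u ^ 7 = o(sigma), and sigma ^ 2 is of the order of
   the number of roots. With u = alpha x + beta, Mills' ratio yields
   k P(X_des > a x + b) -> exp (- x), and P(M <= a x + b) is a k-th power. *)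
Require Import Defs.
From HB Require Import structures.
From mathcomp Require Import all_boot all_order all_algebra.
From mathcomp Require Import all_classical all_reals all_analysis.
From mathcomp Require Import measurable_realfun.
From mathcomp Require Import ring lra zify.
Import Order.TTheory GRing.Theory Num.Theory.
Import numFieldNormedType.Exports.
Local Open Scope classical_set_scope.
Local Open Scope ring_scope.

Set Implicit Arguments.
Unset Strict Implicit.

(** The tail at the threshold is of order 1 / k, so every error must be small against 1 / k; a bound
    uniform in the level would be worthless. Two parameters are tuned for this. Let s be the
    standard deviation. Smoothing at scale [b] costs a relative error of order s^2 b^-3 u, and it
    blurs the level by a few multiples of [b], which is harmless only if small against s / u, the
    scale on which the tail changes by a factor. With b = s / u^2 and a cutoff of sqrt u multiples
    of [b], the blur is s / u^(3/2) and the error u^7 / s. As u is of the order of sqrt (ln k) and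
    s^2 of the order of the number of roots, this error vanishes under the growth condition with
    exponent 1/7. The number m of residues is at our disposal: it is taken so far beyond k n^2 that
    k times the probability that two variables share a cell tends to 0. *)

Section gaussian_tail.
Context {R : realType}.
Implicit Types x y : R.

(** * Gaussian density and tail: derivatives, limits, Mills' bounds *)

Definition gauss_density y : R := (Num.sqrt (2 * pi))^-1 * expR (- (y ^+ 2 / 2)).

Definition gauss_tail y : R :=
  1 - (\int[lebesgue_measure]_(t in `]-oo, y]) gauss_density t)%R.

Lemma gauss_density_normal_pdf : gauss_density = normal_pdf 0 1.
Proof.
apply/funext => y; rewrite normal_pdfE ?oner_eq0// /normal_peak /normal_fun.
rewrite /gauss_density expr1n mul1r subr0 mulNr.
by rewrite -[pi *+ 2]mulr_natl.
Qed.

Lemma gauss_density_gt0 y : 0 < gauss_density y.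
Proof. by rewrite mulr_gt0 ?expR_gt0// invr_gt0 sqrtr_gt0 mulr_gt0 ?pi_gt0. Qed.

Lemma continuous_gauss_density : continuous gauss_density.
Proof. by rewrite gauss_density_normal_pdf; apply: continuous_normal_pdf; rewrite oner_eq0. Qed.

Lemma integrable_gauss_density :
  lebesgue_measure.-integrable [set: R] (EFin \o gauss_density).
Proof. by rewrite gauss_density_normal_pdf; exact: integrable_normal_pdf. Qed.

Lemma is_derive_gauss_tail y : is_derive y 1 gauss_tail (- gauss_density y).
Proof.
(* The fundamental theorem is applied on a half-line containing [y] in its interior; the endpoint y
   + 1 is arbitrary. *)
have yy1 : y < y + 1 by rewrite ltrDl.
have ig : lebesgue_measure.-integrable [set` Interval -oo%O (BRight (y + 1))]
    (EFin \o gauss_density).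
  by apply: (integrableS measurableT _ _ integrable_gauss_density).
have [dF dE] := continuous_FTC1 yy1 ig (ltNyr y) (@continuous_gauss_density y).
have h : is_derive y 1
  (fun x => (\int[lebesgue_measure]_(t in `]-oo, x]) gauss_density t)%R)
  (gauss_density y).
  by rewrite -dE derive1E; apply/derivableP.
rewrite -(sub0r (gauss_density y)).
exact: (is_deriveB (is_derive_cst (1 : R) y 1) h).
Qed.

Let idR : measurableTypeR R -> R := idfun.

HB.instance Definition _ :=
  @isMeasurableFun.Build _ _ _ _ idR (@measurable_id _ _ setT).

(** The identity is a standard normal variable under [normal_prob 0 1]; range, monotonicity and
    limits of the tail are inherited from the general theory of distribution functions. *)
Lemma gauss_tail_ccdf y :
  (gauss_tail y)%:E = ccdf (idR : {RV (normal_prob 0 1 : probability _ R) >-> R}) y.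
Proof.
rewrite ccdf_1_cdf /gauss_tail EFinB; congr (_ - _)%E.
rewrite /cdf /distribution /pushforward/= preimage_id /normal_prob.
rewrite /Rintegral fineK; last first.
  apply: integrable_fin_num => //.
  by apply: integrableS integrable_gauss_density.
by rewrite gauss_density_normal_pdf set_itvNyc.
Qed.

Lemma gauss_tail_ge0 y : 0 <= gauss_tail y.
Proof. by rewrite -lee_fin gauss_tail_ccdf. Qed.

Lemma gauss_tail_le1 y : gauss_tail y <= 1.
Proof. by rewrite -lee_fin gauss_tail_ccdf; exact: probability_le1. Qed.

Lemma gauss_tail_nonincreasing x y : x <= y -> gauss_tail y <= gauss_tail x.
Proof. by move=> xy; rewrite -lee_fin !gauss_tail_ccdf; exact: ccdf_nonincreasing. Qed.

Lemma gauss_tail_cvgy : gauss_tail x @[x --> +oo] --> (0 : R).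
Proof.
have /fine_cvg := @cvg_ccdfy0 _ _ _ _ (idR : {RV (normal_prob 0 1 : probability _ R) >-> R}).
apply: cvg_trans; apply: near_eq_cvg; near=> x.
exact: (congr1 fine (esym (gauss_tail_ccdf x))).
Unshelve. all: by end_near. Qed.

Lemma gauss_tail_cvgNy : gauss_tail x @[x --> -oo] --> (1 : R).
Proof.
have /fine_cvg := @cvg_ccdfNy1 _ _ _ _ (idR : {RV (normal_prob 0 1 : probability _ R) >-> R}).
apply: cvg_trans; apply: near_eq_cvg; near=> x.
exact: (congr1 fine (esym (gauss_tail_ccdf x))).
Unshelve. all: by end_near. Qed.

Lemma is_derive_gauss_density y :
  is_derive y 1 gauss_density (- y * gauss_density y).
Proof.
have h : is_derive y 1 (fun x : R => - (x ^+ 2 / 2)) (- y).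
  have h0 := is_deriveM (is_derive_id y 1) (is_derive_id y 1).
  have h1 := is_deriveN (is_deriveM h0 (is_derive_cst (2^-1 : R) y 1)).
  by apply: (is_derive_eq h1); rewrite /GRing.scale/= !fctE; field.
have h2 := @is_derive1_comp _ _ _ y _ _ (is_derive_expR _) h.
have h3 := is_deriveZ ((Num.sqrt (2 * pi : R))^-1) h2.
apply: (is_derive_eq h3).
by rewrite /GRing.scale/= /gauss_density; ring.
Qed.

Lemma cvg_gauss_density_y : gauss_density x @[x --> +oo] --> (0 : R).
Proof.
have c0 : 0 <= (Num.sqrt (2 * pi : R))^-1 by rewrite invr_ge0 sqrtr_ge0.
have h : (Num.sqrt (2 * pi : R))^-1 * expR (- x) @[x --> +oo] --> (0 : R).
  rewrite -[X in _ --> X](mulr0 (Num.sqrt (2 * pi : R))^-1).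
  by apply: cvgMr; exact: cvgr_expR.
apply: (@squeeze_cvgr _ _ _ _ (fun=> 0) (fun x => (Num.sqrt (2 * pi : R))^-1 * expR (- x))) => //.
- near=> x; rewrite ltW ?gauss_density_gt0//= /gauss_density ler_wpM2l//.
  rewrite ler_expR lerN2.
  have : 2 <= x by near: x; apply: nbhs_pinfty_ge; rewrite num_real.
  nra.
- exact: cvg_cst.
Unshelve. all: by end_near. Qed.

(** Such an [f] is nonincreasing, hence lies above its limit at infinity. Both Mills bounds follow
    by taking for [f] the difference of their two sides. *)
Lemma nonincreasing_cvgy_ge0 (f df : R -> R) (a : R) :
  (forall x, a < x -> is_derive x 1 f (df x)) ->
  (forall x, a < x -> df x <= 0) -> f x @[x --> +oo] --> (0 : R) ->
  forall x, a < x -> 0 <= f x.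
Proof.
move=> fd dfle0 f0 x ax.
apply: (@ler_cvg_to _ _ _ _ f (fun=> f x) 0 (f x) f0 (cvg_cst _)).
near=> z.
have xz : x < z by near: z; apply: nbhs_pinfty_gt; rewrite num_real.
have [c| |c] := @MVT _ f df x z xz.
- by rewrite in_itv/= => /andP[xc _]; apply: fd; exact: lt_trans xc.
- apply: derivable_within_continuous => c; rewrite in_itv/= => /andP[xc _].
  by have [] := fd c (lt_le_trans ax xc).
- rewrite in_itv/= => /andP[xc _] e.
  rewrite -subr_le0 e mulr_le0_ge0// ?subr_ge0 ?(ltW xz)//.
  by apply: dfle0; exact: lt_trans xc.
Unshelve. all: by end_near. Qed.

Lemma gauss_tail_le y : 0 < y -> gauss_tail y <= gauss_density y / y.
Proof.
move=> y0; rewrite -subr_ge0.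
pose f x := gauss_density x / x - gauss_tail x.
apply: (@nonincreasing_cvgy_ge0 f (fun x => - (gauss_density x / x ^+ 2)) 0); last exact: y0.
- move=> x x0; rewrite /f.
  have xn0 : x != 0 by rewrite gt_eqF.
  have h1 := is_derive_gauss_density x.
  have h2 := is_derive_gauss_tail x.
  have h3 : is_derive x 1 (fun x : R => x^-1) (- x ^- 2).
    have := is_deriveV (f := id) xn0 (is_derive_id x 1).
    by rewrite /GRing.scale/= mulr1.
  have h4 := is_deriveB (is_deriveM h1 h3) h2.
  apply: (is_derive_eq h4).
  by rewrite /GRing.scale/= expr2; field.
- by move=> x x0; rewrite oppr_le0 divr_ge0 ?exprn_ge0 ?ltW ?gauss_density_gt0.
- rewrite -[X in _ --> X](subr0 0); apply: cvgB; last exact: gauss_tail_cvgy.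
  apply: (@squeeze_cvgr _ _ _ _ (fun=> 0) gauss_density).
  + near=> x.
    have x1 : 1 <= x by near: x; apply: nbhs_pinfty_ge; rewrite num_real.
    have d0 := gauss_density_gt0 x.
    rewrite divr_ge0 ?(le_trans ler01 x1) ?(ltW d0)//=.
    by rewrite ler_pdivrMr ?(lt_le_trans ltr01 x1)// ler_peMr// ltW.
  + exact: cvg_cst.
  + exact: cvg_gauss_density_y.
Unshelve. all: by end_near. Qed.

(** Two terms of the asymptotic series of the tail: in the derivative of the difference everything
    cancels but [- (3 * gauss_density x / x ^+ 4)], which has a sign. *)
Lemma gauss_tail_ge y : 0 < y ->
  gauss_density y * (y^-1 - y ^- 3) <= gauss_tail y.
Proof.
move=> y0; rewrite -subr_ge0.
pose f x := gauss_tail x - gauss_density x * (x^-1 - x ^- 3).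
apply: (@nonincreasing_cvgy_ge0 f (fun x => - (3 * gauss_density x / x ^+ 4)) 0); last exact: y0.
- move=> x x0; rewrite /f.
  have xn0 : x != 0 by rewrite gt_eqF.
  have h1 := is_derive_gauss_density x.
  have h2 := is_derive_gauss_tail x.
  have h3 : is_derive x 1 (fun x : R => x^-1) (- x ^- 2).
    have := is_deriveV (f := id) xn0 (is_derive_id x 1).
    by rewrite /GRing.scale/= mulr1.
  have h5 : is_derive x 1 (fun x : R => x ^+ 3) (3 * x ^+ 2).
    have h0 := is_deriveM (is_derive_id x 1) (is_deriveM (is_derive_id x 1) (is_derive_id x 1)).
    by apply: (is_derive_eq h0); rewrite /GRing.scale/= !fctE; ring.
  have x3n0 : x ^+ 3 != 0 by rewrite expf_neq0.
  have h6 := is_deriveV (f := fun x : R => x ^+ 3) x3n0 h5.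
  have h4 := is_deriveB h2 (is_deriveM h1 (is_deriveB h3 h6)).
  apply: (is_derive_eq h4).
  by rewrite /GRing.scale/= !fctE; field.
- move=> x x0; rewrite oppr_le0 divr_ge0 ?exprn_ge0 ?(ltW x0)// mulr_ge0//.
  by rewrite ltW// gauss_density_gt0.
- rewrite -[X in _ --> X](subr0 0); apply: cvgB; first exact: gauss_tail_cvgy.
  apply: (@squeeze_cvgr _ _ _ _ (fun=> 0) gauss_density).
  + near=> x.
    have x1 : 1 <= x by near: x; apply: nbhs_pinfty_ge; rewrite num_real.
    have x0 : 0 < x by rewrite (lt_le_trans _ x1).
    have d0 := gauss_density_gt0 x.
    have xi1 : x^-1 <= 1 by rewrite invf_le1.
    have xi0 : 0 <= x^-1 by rewrite invr_ge0 ltW.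
    rewrite -exprVn; apply/andP; split.
      rewrite mulr_ge0 ?(ltW d0)// subr_ge0.
      by rewrite -[leRHS]expr1 ler_wiXn2l.
    rewrite -[leRHS]mulr1 ler_wpM2l ?(ltW d0)// lerBlDr (le_trans xi1)// lerDl.
    exact: exprn_ge0.
  + exact: cvg_cst.
  + exact: cvg_gauss_density_y.
Unshelve. all: by end_near. Qed.

End gaussian_tail.

(** * Averages over finite types *)

Definition avg (R : realType) (I : finType) (f : I -> R) : R :=
  (\sum_i f i) / #|I|%:R.

Section avg_theory.
Context {R : realType} {I : finType}.
Implicit Types f g : I -> R.

Lemma avgD f g : avg (fun i => f i + g i) = avg f + avg g.
Proof. by rewrite /avg big_split mulrDl. Qed.

Lemma avgZ c f : avg (fun i => c * f i) = c * avg f.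
Proof. by rewrite /avg -mulr_sumr mulrA. Qed.

Lemma avgN f : avg (fun i => - f i) = - avg f.
Proof. by rewrite /avg sumrN mulNr. Qed.

(** On an empty type the average is 0 whatever [c], hence the condition on the cardinal here and in
    the definitions built on averages. *)
Lemma avg_cst (c : R) : (0 < #|I|)%N -> avg (fun _ : I => c) = c.
Proof.
move=> I0; rewrite /avg sumr_const -[c *+ _]mulr_natr mulfK//.
by rewrite pnatr_eq0 -lt0n.
Qed.

Lemma eq_avg f g : f =1 g -> avg f = avg g.
Proof. by move=> fg; rewrite /avg (eq_bigr _ (fun i _ => fg i)). Qed.

Lemma ler_avg f g : (forall i, f i <= g i) -> avg f <= avg g.
Proof. by move=> fg; rewrite /avg ler_wpM2r ?invr_ge0// ler_sum. Qed.

Lemma ler_norm_avg f g : (forall i, `|f i| <= g i) -> `|avg f| <= avg g.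
Proof.
move=> fg; rewrite /avg normrM [`|_^-1|]ger0_norm ?invr_ge0//.
rewrite ler_wpM2r ?invr_ge0//.
by apply: (le_trans (ler_norm_sum _ _ _)); apply: ler_sum.
Qed.

End avg_theory.

Lemma avg_exchange (R : realType) (I J : finType) (f : I -> J -> R) :
  avg (fun i => avg (fun j => f i j)) = avg (fun j => avg (fun i => f i j)).
Proof.
rewrite /avg -!mulr_suml exchange_big/= -!mulrA.
by congr (_ * _); rewrite mulrC.
Qed.

Lemma avg_pair (R : realType) (I J : finType) (f : I * J -> R) :
  avg f = avg (fun i => avg (fun j => f (i, j))).
Proof.
rewrite /avg -mulr_suml pair_bigA/= card_prod natrM invfM mulrA mulrAC.
by congr (_ / _ / _); apply: eq_bigr => -[].
Qed.

Lemma reindex_avg (R : realType) (I J : finType) (h : J -> I) (f : I -> R) :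
  bijective h -> avg f = avg (f \o h).
Proof.
move=> hb; rewrite /avg (bij_eq_card hb).
by rewrite [in LHS](reindex h)//; apply: onW_bij.
Qed.

(** * Taylor estimates by iterated mean values *)

Section taylor.
Context {R : realType}.
Implicit Types (f g : R -> R) (x z B lo hi : R).

(** A mean value theorem indifferent to the order of [z] and [x]. That the intermediate point is no
    farther from [z] than [x] is what allows iteration. *)
Lemma mean_value_between g dg lo hi z x :
  (forall c, lo <= c <= hi -> is_derive c 1 g (dg c)) ->
  lo <= z <= hi -> lo <= x <= hi ->
  exists2 c, lo <= c <= hi /\ `|c - z| <= `|x - z| & g x - g z = dg c * (x - z).
Proof.
move=> dgP zb xb.
have [xz|zx|->] := ltgtP x z; last by exists z; rewrite ?subrr ?mulr0 ?lexx.
- have [c|c|c] := @MVT _ g dg x z xz.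
  + by rewrite in_itv/= => cb; apply: dgP; lra.
  + move: c; apply: derivable_within_continuous => c; rewrite in_itv/= => cb.
    by have [|] := dgP c; first by lra.
  + rewrite in_itv/= => cb e; exists c.
      by split; [lra | rewrite !ler0_norm; lra].
    by rewrite -opprB e -mulrN opprB.
- have [c|c|c] := @MVT _ g dg z x zx.
  + by rewrite in_itv/= => cb; apply: dgP; lra.
  + move: c; apply: derivable_within_continuous => c; rewrite in_itv/= => cb.
    by have [|] := dgP c; first by lra.
  + rewrite in_itv/= => cb e; exists c => //.
    by split; [lra | rewrite !ger0_norm; lra].
Qed.

(** The mean value theorem replaces integration; the factor 1 / (n + 1) is lost, which is immaterial
    as only orders of magnitude matter. *)
Lemma le_pow_of_derive g dg lo hi z B (n : nat) :
  (forall c, lo <= c <= hi -> is_derive c 1 g (dg c)) ->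
  lo <= z <= hi -> g z = 0 -> 0 <= B ->
  (forall c, lo <= c <= hi -> `|dg c| <= B * `|c - z| ^+ n) ->
  forall x, lo <= x <= hi -> `|g x| <= B * `|x - z| ^+ n.+1.
Proof.
move=> dgP zb gz B0 dgB x xb.
have [c [cb cz]] := mean_value_between dgP zb xb.
rewrite gz subr0 => ->; rewrite normrM exprSr mulrA ler_wpM2r//.
by apply: (le_trans (dgB c cb)); rewrite ler_wpM2l// lerXn2r ?nnegrE.
Qed.

(** The bound on the third derivative is lifted three times by [le_pow_of_derive], hence no factor
    1/6. *)
Lemma taylor3_bound f f1 f2 f3 lo hi z B :
  (forall c, lo <= c <= hi -> is_derive c 1 f (f1 c)) ->
  (forall c, lo <= c <= hi -> is_derive c 1 f1 (f2 c)) ->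
  (forall c, lo <= c <= hi -> is_derive c 1 f2 (f3 c)) ->
  lo <= z <= hi -> 0 <= B ->
  (forall c, lo <= c <= hi -> `|f3 c| <= B) ->
  forall x, lo <= x <= hi ->
  `|f x - f z - (x - z) * f1 z - (x - z) ^+ 2 / 2 * f2 z| <= B * `|x - z| ^+ 3.
Proof.
move=> d1 d2 d3 zb B0 f3B x xb.
have dz (c : R) : is_derive c 1 (fun x : R => x - z) (1 : R).
  by rewrite -[X in is_derive _ _ _ X](subr0 (1 : R)); exact: is_deriveB.
have h2 c : lo <= c <= hi -> `|f2 c - f2 z| <= B * `|c - z| ^+ 1.
  apply: (@le_pow_of_derive (fun x => f2 x - f2 z) f3 lo hi z B 0) => //.
  - move=> e eb; rewrite -[X in is_derive _ _ _ X]subr0.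
    exact: (is_deriveB (d3 e eb) (is_derive_cst _ _ _)).
  - by rewrite subrr.
  - by move=> e eb; rewrite expr0 mulr1 f3B.
have h1 c : lo <= c <= hi ->
    `|f1 c - f1 z - (c - z) * f2 z| <= B * `|c - z| ^+ 2.
  apply: (@le_pow_of_derive (fun x => f1 x - f1 z - (x - z) * f2 z)
    (fun x => f2 x - f2 z) lo hi z B 1) => //.
  - move=> e eb.
    have := is_deriveB (is_deriveB (d2 e eb) (is_derive_cst (f1 z) e 1))
      (is_deriveM (dz e) (is_derive_cst (f2 z) e 1)).
    move/is_derive_eq; apply; rewrite /GRing.scale/= /cst/=; ring.
  - by rewrite !subrr mul0r subrr.
apply: (@le_pow_of_derive
  (fun x => f x - f z - (x - z) * f1 z - (x - z) ^+ 2 / 2 * f2 z)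
  (fun x => f1 x - f1 z - (x - z) * f2 z) lo hi z B 2) => //.
- move=> e eb.
  have := is_deriveB (is_deriveB (is_deriveB (d1 e eb) (is_derive_cst (f z) e 1))
    (is_deriveM (dz e) (is_derive_cst (f1 z) e 1)))
    (is_deriveM (is_deriveM (is_deriveM (dz e) (dz e))
      (is_derive_cst (2^-1 : R) e 1)) (is_derive_cst (f2 z) e 1)).
  by move/is_derive_eq; apply; rewrite /GRing.scale/= !fctE; field.
- by rewrite !subrr !mul0r expr0n/= !mul0r !subrr.
Qed.

Lemma taylor2_bound f f1 f2 lo hi z B :
  (forall c, lo <= c <= hi -> is_derive c 1 f (f1 c)) ->
  (forall c, lo <= c <= hi -> is_derive c 1 f1 (f2 c)) ->
  lo <= z <= hi -> 0 <= B ->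
  (forall c, lo <= c <= hi -> `|f2 c| <= B) ->
  forall x, lo <= x <= hi ->
  `|f x - f z - (x - z) * f1 z| <= B * `|x - z| ^+ 2.
Proof.
move=> d1 d2 zb B0 f2B x xb.
have dz (c : R) : is_derive c 1 (fun x : R => x - z) (1 : R).
  by rewrite -[X in is_derive _ _ _ X](subr0 (1 : R)); exact: is_deriveB.
have h2 c : lo <= c <= hi -> `|f1 c - f1 z| <= B * `|c - z| ^+ 1.
  apply: (@le_pow_of_derive (fun x => f1 x - f1 z) f2 lo hi z B 0) => //.
  - move=> e eb; rewrite -[X in is_derive _ _ _ X]subr0.
    exact: (is_deriveB (d2 e eb) (is_derive_cst _ _ _)).
  - by rewrite subrr.
  - by move=> e eb; rewrite expr0 mulr1 f2B.
apply: (@le_pow_of_derive (fun x => f x - f z - (x - z) * f1 z)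
  (fun x => f1 x - f1 z) lo hi z B 1) => //.
- move=> e eb.
  have := is_deriveB (is_deriveB (d1 e eb) (is_derive_cst (f z) e 1))
    (is_deriveM (dz e) (is_derive_cst (f1 z) e 1)).
  move/is_derive_eq; apply; rewrite /GRing.scale/= /cst/=; ring.
- by rewrite !subrr mul0r subrr.
Qed.

End taylor.

(** * One-step estimates for the Gaussian tail and the exponential *)

Section gauss_bounds.
Context {R : realType}.
Implicit Types (y z c s T v b : R).

Lemma expR1_le4 : expR 1 <= 4 :> R.
Proof.
have := @expR_ge1Dx R (- (2^-1)); rewrite expRN => h.
have h2 : expR (2^-1) <= 2 :> R.
  rewrite -[leLHS]invrK -[leRHS]invrK lef_pV2 ?posrE ?invr_gt0 ?expR_gt0//.
  by lra.
have -> : expR 1 = expR 2^-1 * expR 2^-1 :> R.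
  by rewrite -expRD; congr expR; field.
have -> : 4 = 2 * 2 :> R by ring.
by rewrite ler_pM ?expR_ge0.
Qed.

Lemma gauss_density_le_expR z : gauss_density z <= expR (- (z ^+ 2 / 2)).
Proof.
rewrite /gauss_density ler_piMl ?expR_ge0//.
rewrite invf_le1 ?sqrtr_gt0 ?mulr_gt0 ?pi_gt0// -[leLHS]sqrtr1 ler_wsqrtr//.
by have := @pi_ge2 R; lra.
Qed.

(** Exponential tilting: - z^2/2 = - (z - c)^2/2 - c z + c^2/2, and the square on the right absorbs
    the cubic factor. The free parameter [c] turns derivatives of the Gaussian tail into Chernoff
    weights. *)
Lemma cube_gauss_density_le c z : 0 <= c ->
  (1 + `|z| ^+ 3) * gauss_density z <=
  33 * (1 + c ^+ 3) * expR (- (c * z) + c ^+ 2 / 2).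
Proof.
move=> c0; pose w := `|z - c|; pose E := expR (w ^+ 2 / 2).
have w0 : 0 <= w by exact: normr_ge0.
have w2 : w ^+ 2 = (z - c) ^+ 2 by rewrite real_normK ?num_real.
have E1 : 1 + w ^+ 4 / 8 <= E.
  have h : 0 <= w ^+ 2 / 2 by rewrite divr_ge0 ?exprn_ge0.
  apply: le_trans (expR_ge1Dxn 1 h).
  by rewrite lerD2l le_eqVlt; apply/orP; left; apply/eqP; rewrite (_ : 2`! = 2%N)//; field.
have dE : gauss_density z * E <= expR (- (c * z) + c ^+ 2 / 2).
  apply: (le_trans (ler_wpM2r (expR_ge0 _) (gauss_density_le_expR z))).
  by rewrite -expRD ler_expR w2 le_eqVlt; apply/orP; left; apply/eqP; field.
have zw : `|z| <= w + c.
  by rewrite /w -{2}(ger0_norm c0) -{1}(subrK c z) ler_normD.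
have z3 : `|z| ^+ 3 <= 4 * w ^+ 3 + 4 * c ^+ 3.
  have h : `|z| ^+ 3 <= (w + c) ^+ 3 by rewrite lerXn2r ?nnegrE// addr_ge0.
  apply: (le_trans h); rewrite -subr_ge0.
  have -> : 4 * w ^+ 3 + 4 * c ^+ 3 - (w + c) ^+ 3 = 3 * ((w + c) * (w - c) ^+ 2).
    by ring.
  by rewrite mulr_ge0// mulr_ge0 ?addr_ge0 ?sqr_ge0.
have w34 : w ^+ 3 <= 1 + w ^+ 4.
  have [w1|w1] := leP w 1.
    have : w ^+ 3 <= 1 by rewrite exprn_ile1.
    by have := exprn_ge0 4 w0; lra.
  have : w ^+ 3 <= w ^+ 4 by rewrite ler_weXn2l// ltW.
  by lra.
have c30 := exprn_ge0 3 c0.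
have w40 := exprn_ge0 4 w0.
(* 33 = 32 + 1, from 4 w^3 <= 4 + 4 w^4 <= 32 E and 1 + 4 c^3 <= (1 + 4 c^3) E. *)
have h : 1 + `|z| ^+ 3 <= 33 * (1 + c ^+ 3) * E.
  have : 4 * w ^+ 3 <= 32 * E by lra.
  have : 1 + 4 * c ^+ 3 <= (1 + 4 * c ^+ 3) * E.
    by rewrite ler_peMr//; lra.
  have : 0 <= c ^+ 3 * E by rewrite mulr_ge0 ?expR_ge0.
  lra.
have d0 := gauss_density_gt0 z.
apply: (le_trans (ler_wpM2r (ltW d0) h)).
rewrite -[leLHS]mulrA [E * _]mulrC ler_wpM2l// mulr_ge0//; lra.
Qed.

(** The third derivative of the tail is (1 - x^2) times the density, and |1 - x^2| <= 2 (1 + |x|^3);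
    this is the 2 in front of [B]. *)
Lemma gauss_tail_taylor z h B : 0 <= B ->
  (forall x, z - `|h| <= x <= z + `|h| -> (1 + `|x| ^+ 3) * gauss_density x <= B) ->
  `|gauss_tail (z - h) - gauss_tail z - h * gauss_density z
     - h ^+ 2 / 2 * (z * gauss_density z)| <= 2 * B * `|h| ^+ 3.
Proof.
move=> B0 hB.
have d2 (c : R) : is_derive c 1 (fun x : R => - gauss_density x) (c * gauss_density c).
  have := is_deriveN (is_derive_gauss_density c).
  by move/is_derive_eq; apply; ring.
have d3 (c : R) : is_derive c 1 (fun x : R => x * gauss_density x)
    ((1 - c ^+ 2) * gauss_density c).
  have := is_deriveM (is_derive_id c 1) (is_derive_gauss_density c).
  by move/is_derive_eq; apply; rewrite /GRing.scale/=; ring.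
have H := @taylor3_bound _ _ _ _ _ (z - `|h|) (z + `|h|) z (2 * B)
  (fun c _ => is_derive_gauss_tail c) (fun c _ => d2 c) (fun c _ => d3 c).
have hn := normr_ge0 h.
have zb : z - `|h| <= z <= z + `|h| by lra.
have f3B c : z - `|h| <= c <= z + `|h| ->
    `|(1 - c ^+ 2) * gauss_density c| <= 2 * B.
  move=> cb; have := hB c cb.
  have dc := gauss_density_gt0 c.
  rewrite normrM (gtr0_norm dc) => /(ler_wpM2l (ler0n _ 2)); apply: le_trans.
  rewrite [leRHS]mulrA ler_wpM2r ?(ltW dc)//.
  have -> : c ^+ 2 = `|c| ^+ 2 by rewrite real_normK ?num_real.
  have c0 := normr_ge0 c; set x := `|c| in c0 *.
  have c3 : x ^+ 2 <= 1 + x ^+ 3.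
    have [c1|c1] := leP x 1.
      have : x ^+ 2 <= 1 by rewrite exprn_ile1.
      by have := exprn_ge0 3 c0; lra.
    have : x ^+ 2 <= x ^+ 3 by rewrite ler_weXn2l// ltW.
    by lra.
  have c30 := exprn_ge0 3 c0.
  have c20 := exprn_ge0 2 c0.
  by rewrite ler_norml; lra.
have xb : z - `|h| <= z - h <= z + `|h|.
  have /andP[h1 h2] : - `|h| <= h <= `|h| by rewrite -ler_norml.
  by lra.
have := H zb (mulr_ge0 (ler0n _ 2) B0) f3B (z - h) xb.
rewrite (_ : z - h - z = - h); last by ring.
by rewrite normrN sqrrN mulrNN.
Qed.

(** Space half of Lindeberg's step: a centred increment of variance [v] contributes a second-order
    term, and the remainder carries a Chernoff weight of tilt [s]. As |xi| <= 2 <= b and s b <= 1,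
    one increment changes this weight by a bounded factor only. *)
Lemma avg_gauss_tail_step (I : finType) (xi : I -> R) (v s b T y : R) :
  (0 < #|I|)%N -> avg xi = 0 -> avg (fun i => xi i ^+ 2) = v ->
  (forall i, `|xi i| <= 2) ->
  0 <= s -> 2 <= b -> s * b <= 1 -> b ^+ 2 <= T ->
  `|avg (fun i => gauss_tail ((y - xi i) / Num.sqrt T)) -
    gauss_tail (y / Num.sqrt T) -
    v / T / 2 * (y / Num.sqrt T * gauss_density (y / Num.sqrt T))|
  <= 1056 * b ^- 3 * v * expR (- (s * y) + s ^+ 2 * T / 2).
Proof.
move=> I0 m1 m2 xi2 s0 b2 sb bT.
have b0 : 0 < b by lra.
have T0 : 0 < T by rewrite (lt_le_trans _ bT)// exprn_gt0.
pose t := Num.sqrt T; have t0 : 0 < t by rewrite sqrtr_gt0.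
have tT : t ^+ 2 = T by rewrite sqr_sqrtr// ltW.
have bt : b <= t by rewrite -(@ler_pXn2r _ 2) ?nnegrE ?(ltW b0) ?(ltW t0)// tT.
rewrite -/t.
set z := y / t.
pose E := expR (- (s * y) + s ^+ 2 * T / 2).
(* The tilt in the variable z = y / t is c = s t, so that c z = s y. The factor 4 bounds [expR 1],
   the loss incurred when y is replaced by y - |xi|. *)
pose B := 33 * (1 + (s * t) ^+ 3) * (4 * E).
have E0 : 0 < E by exact: expR_gt0.
have st0 : 0 <= s * t by rewrite mulr_ge0// ltW.
have B0 : 0 <= B.
  by have := exprn_ge0 3 st0; rewrite /B => h; rewrite !mulr_ge0//; lra.
have step i : `|gauss_tail ((y - xi i) / t) - gauss_tail z
   - (xi i / t) * gauss_density z - (xi i / t) ^+ 2 / 2 * (z * gauss_density z)|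
   <= (4 * B / t ^+ 3) * xi i ^+ 2.
  have -> : (y - xi i) / t = z - xi i / t by rewrite mulrBl.
  apply: (le_trans (@gauss_tail_taylor z (xi i / t) B B0 _)).
    move=> x xb; apply: (le_trans (cube_gauss_density_le x st0)).
    rewrite /B ler_wpM2l//.
      by have := exprn_ge0 3 st0 => h; rewrite mulr_ge0//; lra.
    apply: (@le_trans _ _ (expR 1 * E)); last by rewrite ler_wpM2r ?expR1_le4// ltW.
    rewrite -expRD ler_expR exprMn tT.
    have : - (s * t * x) <= 1 - s * y; last by lra.
    have {}xb : z - `|xi i / t| <= x by case/andP: xb.
    have h3 : t * (z - `|xi i / t|) <= t * x by rewrite ler_pM2l.
    have h4 : t * (z - `|xi i / t|) = y - `|xi i|.
      rewrite normrM [`|t^-1|]gtr0_norm ?invr_gt0// /z; field.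
      by rewrite gt_eqF.
    rewrite h4 in h3.
    have h5 := ler_wpM2l s0 h3.
    have h6 : s * `|xi i| <= s * b by rewrite ler_wpM2l// (le_trans (xi2 i)).
    by lra.
  rewrite normrM [`|t^-1|]gtr0_norm ?invr_gt0// exprMn exprVn.
  have -> : 2 * B * (`|xi i| ^+ 3 / t ^+ 3) = 2 * B / t ^+ 3 * `|xi i| ^+ 2 * `|xi i|.
    by rewrite !exprS expr0; ring.
  have -> : 4 * B / t ^+ 3 * xi i ^+ 2 = 2 * B / t ^+ 3 * `|xi i| ^+ 2 * 2.
    by rewrite real_normK ?num_real//; ring.
  have h : 0 <= 2 * B / t ^+ 3.
    exact: divr_ge0 (mulr_ge0 (ler0n _ 2) B0) (exprn_ge0 3 (ltW t0)).
  by rewrite ler_wpM2l// mulr_ge0// exprn_ge0.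
have := ler_norm_avg step; rewrite avgZ m2.
set X := avg (fun i => gauss_tail _).
have -> : avg (fun i => gauss_tail ((y - xi i) / t) - gauss_tail z
   - (xi i / t) * gauss_density z - (xi i / t) ^+ 2 / 2 * (z * gauss_density z))
   = X - gauss_tail z - v / T / 2 * (z * gauss_density z).
  rewrite /X -tT -m2.
  under eq_avg => i.
    rewrite (_ : _ - _ = gauss_tail ((y - xi i) / t) + (- gauss_tail z +
      ((- gauss_density z / t) * xi i + (- (z * gauss_density z) / t ^+ 2 / 2) * xi i ^+ 2))); last first.
      by field; rewrite gt_eqF.
    over.
  rewrite (avgD (fun i => gauss_tail ((y - xi i) / t))).
  set X' := avg (fun i => gauss_tail _).
  rewrite (avgD (fun=> - gauss_tail z)) avgD !avgZ avg_cst// m1.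
  by field; rewrite gt_eqF.
move/le_trans; apply.
have v0 : 0 <= v.
  by rewrite -m2 -(avg_cst (0 : R) I0); apply: ler_avg => i; rewrite sqr_ge0.
rewrite [leRHS]mulrAC ler_wpM2r// /B -/E.
(* 528 = 4 * 33 * 4; both t^-3 and s^3 are at most b^-3, which doubles it to 1056. *)
have -> : 4 * (33 * (1 + (s * t) ^+ 3) * (4 * E)) / t ^+ 3 =
   528 * E * (t ^- 3 + s ^+ 3) by rewrite exprMn; field; rewrite gt_eqF.
have tb : t ^- 3 <= b ^- 3.
  by rewrite lef_pV2 ?posrE ?exprn_gt0// lerXn2r ?nnegrE ?(ltW b0) ?(ltW t0).
have sb3 : s ^+ 3 <= b ^- 3.
  rewrite -exprVn lerXn2r ?nnegrE// ?invr_ge0 ?(ltW b0)//.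
  by rewrite -[leRHS]mul1r ler_pdivlMr.
have -> : 1056 * b ^- 3 * E = 528 * E * (b ^- 3 + b ^- 3) by ring.
by apply: ler_wpM2l (lerD tb sb3); apply: mulr_ge0 (ler0n R 528) (ltW E0).
Qed.

(** Time half: [gauss_tail (y / Num.sqrt t)] solves the heat equation, so lengthening the time by
    [v] produces the same second-order term as an increment of variance [v]. The bound 4 on [v]
    makes the remainder, quadratic in [v], linear. *)
Lemma gauss_tail_time_step (v s b T y : R) :
  0 <= v <= 4 -> 0 <= s -> 2 <= b -> s * b <= 1 -> b ^+ 2 <= T ->
  `|gauss_tail (y / Num.sqrt (T + v)) - gauss_tail (y / Num.sqrt T) -
    v / T / 2 * (y / Num.sqrt T * gauss_density (y / Num.sqrt T))|
  <= 264 * b ^- 3 * v * expR (- (s * y) + s ^+ 2 * (T + v) / 2).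
Proof.
move=> v4 s0 b2 sb bT.
have b0 : 0 < b by lra.
have T0 : 0 < T by rewrite (lt_le_trans _ bT)// exprn_gt0.
pose zeta t := y / Num.sqrt t.
have d0 (t : R) : T <= t <= T + v -> is_derive t 1 (fun t : R => (Num.sqrt t)^-1)
    (- ((Num.sqrt t)^-1 / t / 2)).
  move=> tb; have t0 : 0 < t by lra.
  have tn0 : Num.sqrt t != 0 by rewrite gt_eqF ?sqrtr_gt0.
  have := is_deriveV (f := Num.sqrt) tn0 (is_derive1_sqrt t0).
  move/is_derive_eq; apply; rewrite /GRing.scale/=.
  by rewrite -[X in _ / X / 2](sqr_sqrtr (ltW t0)); field.
have dz (t : R) : T <= t <= T + v -> is_derive t 1 zeta (- (zeta t / t / 2)).
  move=> tb; have := is_deriveM (is_derive_cst y t 1) (d0 t tb).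
  move/is_derive_eq; apply; rewrite /GRing.scale/= /zeta /cst/=; ring.
have d1 (t : R) : T <= t <= T + v -> is_derive t 1 (gauss_tail \o zeta)
    (zeta t * gauss_density (zeta t) / t / 2).
  move=> tb; have := @is_derive1_comp _ _ _ t _ _ (is_derive_gauss_tail _) (dz t tb).
  move/is_derive_eq; apply; rewrite /GRing.scale/=; ring.
have d2 (t : R) : T <= t <= T + v ->
    is_derive t 1 (fun t => zeta t * gauss_density (zeta t) / t / 2)
    (gauss_density (zeta t) / t ^+ 2 * ((zeta t ^+ 3 - 3 * zeta t) / 4)).
  move=> tb; have t0 : 0 < t by lra.
  have tn0 : t != 0 by rewrite gt_eqF.
  have h1 := @is_derive1_comp _ _ _ t _ _ (is_derive_gauss_density _) (dz t tb).
  have h2 := is_deriveV (f := id) tn0 (is_derive_id t 1).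
  have := is_deriveM (is_deriveM (is_deriveM (dz t tb) h1) h2)
     (is_derive_cst (2^-1 : R) t 1).
  move/is_derive_eq; apply; rewrite /GRing.scale/= !fctE /cst/=.
  by field.
pose E := expR (- (s * y) + s ^+ 2 * (T + v) / 2).
have E0 : 0 < E by exact: expR_gt0.
have bi0 : 0 <= b ^- 3 by rewrite invr_ge0 exprn_ge0// ltW.
have B0 : 0 <= 66 * (b ^- 3 * E) := mulr_ge0 (ler0n R 66) (mulr_ge0 bi0 (ltW E0)).
have d2B t : T <= t <= T + v ->
   `|gauss_density (zeta t) / t ^+ 2 * ((zeta t ^+ 3 - 3 * zeta t) / 4)| <=
   66 * (b ^- 3 * E).
  move=> tb; have t0 : 0 < t by lra.
  pose q := Num.sqrt t; have q0 : 0 < q by rewrite sqrtr_gt0.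
  have q2 : q ^+ 2 = t by rewrite sqr_sqrtr// ltW.
  have bq : b <= q.
    by rewrite -(@ler_pXn2r _ 2) ?nnegrE ?(ltW b0) ?(ltW q0)// q2; lra.
  have sq0 : 0 <= s * q by rewrite mulr_ge0// ltW.
  have d00 := gauss_density_gt0 (zeta t).
  have h1 : `|(zeta t ^+ 3 - 3 * zeta t) / 4| <= 1 + `|zeta t| ^+ 3.
    rewrite normrM [`|4^-1|]gtr0_norm ?invr_gt0//.
    rewrite ler_pdivrMr; last by lra.
    apply: (le_trans (ler_normB _ _)).
    rewrite normrX (normrM 3) [`|3|]gtr0_norm; last by lra.
    have x0 := normr_ge0 (zeta t); set x := `|zeta t| in x0 *.
    have x3 : x <= 1 + x ^+ 3.
      have [x1|x1] := leP x 1; first by have := exprn_ge0 3 x0; lra.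
      have : x ^+ 1 <= x ^+ 3 by rewrite ler_weXn2l// ltW.
      by rewrite expr1; lra.
    by have := exprn_ge0 3 x0; lra.
  rewrite normrM (normrM (gauss_density _)) normfV normrX (gtr0_norm d00) (gtr0_norm t0).
  have ti0 : 0 < t ^- 2 by rewrite invr_gt0 exprn_gt0.
  have h2 := ler_wpM2l (mulr_ge0 (ltW d00) (ltW ti0)) h1.
  apply: (le_trans h2).
  have h3 := cube_gauss_density_le (zeta t) sq0.
  have h4 : expR (- (s * q * zeta t) + (s * q) ^+ 2 / 2) <= E.
    rewrite ler_expR exprMn q2.
    have -> : s * q * zeta t = s * y.
      by rewrite /zeta -/q; field; rewrite gt_eqF.
    have : s ^+ 2 * t <= s ^+ 2 * (T + v) by rewrite ler_wpM2l ?sqr_ge0//; lra.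
    by lra.
  have s30 := exprn_ge0 3 sq0.
  have h5 : (1 + `|zeta t| ^+ 3) * gauss_density (zeta t) <=
      33 * (1 + (s * q) ^+ 3) * E.
    apply: (le_trans h3); apply: ler_wpM2l h4.
    by apply: mulr_ge0 (ler0n R 33) _; lra.
  have -> : gauss_density (zeta t) / t ^+ 2 * (1 + `|zeta t| ^+ 3) =
    (1 + `|zeta t| ^+ 3) * gauss_density (zeta t) * t ^- 2 by ring.
  apply: (le_trans (ler_wpM2r (ltW ti0) h5)).
  have -> : 33 * (1 + (s * q) ^+ 3) * E / t ^+ 2 =
     33 * E * ((q ^- 3 + s ^+ 3) * q^-1).
    by rewrite -q2 exprMn; field; rewrite gt_eqF.
  have -> : 66 * (b ^- 3 * E) = 33 * E * (b ^- 3 + b ^- 3) by ring.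
  apply: ler_wpM2l; first exact: mulr_ge0 (ler0n R 33) (ltW E0).
  have qb : q ^- 3 <= b ^- 3.
    by rewrite lef_pV2 ?posrE ?exprn_gt0// lerXn2r ?nnegrE ?(ltW b0) ?(ltW q0).
  have sb3 : s ^+ 3 <= b ^- 3.
    rewrite -exprVn lerXn2r ?nnegrE// ?invr_ge0 ?(ltW b0)//.
    by rewrite -[leRHS]mul1r ler_pdivlMr.
  have qi1 : q^-1 <= 1 by rewrite invf_le1//; lra.
  have s3 := exprn_ge0 3 s0.
  have qi30 : 0 <= q ^- 3 by rewrite invr_ge0 exprn_ge0// ltW.
  apply: (@le_trans _ _ (q ^- 3 + s ^+ 3)); last exact: lerD.
  by rewrite ler_piMr// addr_ge0.
have Tb : T <= T <= T + v by lra.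
have xb : T <= T + v <= T + v by lra.
have := taylor2_bound d1 d2 Tb B0 d2B xb.
rewrite /= /zeta (addrC T v) addrK.
have -> : v * (y / Num.sqrt T * gauss_density (y / Num.sqrt T) / T / 2) =
  v / T / 2 * (y / Num.sqrt T * gauss_density (y / Num.sqrt T)) by ring.
move/le_trans; apply.
rewrite real_normK ?num_real// (addrC v T) -/E.
have -> : 264 * b ^- 3 * v * E = 66 * (b ^- 3 * E) * (4 * v) by ring.
apply: (ler_wpM2l B0); rewrite expr2; apply: ler_wpM2r; lra.
Qed.

(** On [-1, 1], exp x <= 1 + x + x^2/2 + 4 |x|^3, and |s xi|^3 <= 2 s^3 xi^2; this is the correction
    8 s^3 v to the Gaussian moment generating function. *)
Lemma avg_expR_step (I : finType) (xi : I -> R) (v s : R) :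
  (0 < #|I|)%N -> avg xi = 0 -> avg (fun i => xi i ^+ 2) = v ->
  (forall i, `|xi i| <= 2) -> 0 <= s -> 2 * s <= 1 ->
  avg (fun i => expR (s * xi i)) <= expR (s ^+ 2 / 2 * v + 8 * s ^+ 3 * v).
Proof.
move=> I0 m1 m2 xi2 s0 s1.
apply: le_trans (expR_ge1Dx _).
have step i : expR (s * xi i) <=
    1 + (s * xi i + (s ^+ 2 / 2 + 8 * s ^+ 3) * xi i ^+ 2).
  have sx : `|s * xi i| <= 1.
    rewrite normrM (ger0_norm s0) (le_trans (ler_wpM2l s0 (xi2 i)))//; lra.
  have xb : -1 <= s * xi i <= 1 by rewrite -ler_norml.
  have zb : -1 <= (0 : R) <= 1 by lra.
  have B4 c : -1 <= c <= 1 -> `|expR c| <= 4 :> R.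
    move=> cb; rewrite gtr0_norm ?expR_gt0// (le_trans _ expR1_le4)// ler_expR.
    by lra.
  have dE (c : R) (_ : -1 <= c <= 1) := is_derive_expR c.
  have := taylor3_bound dE dE dE zb (ler0n R 4) B4 xb.
  rewrite expR0 !subr0 !mulr1 => /ler_normlW.
  have x3 : `|s * xi i| ^+ 3 <= 2 * s ^+ 3 * xi i ^+ 2.
    rewrite normrM (ger0_norm s0) exprMn [leRHS](_ : _ = s ^+ 3 * (2 * xi i ^+ 2)); last by ring.
    apply: ler_wpM2l; first exact: exprn_ge0.
    rewrite exprS real_normK ?num_real//.
    by apply: ler_wpM2r; [exact: sqr_ge0|exact: xi2].
  by rewrite exprMn; lra.
apply: (le_trans (ler_avg step)).
rewrite avgD avg_cst// avgD avgZ avgZ m1 m2; lra.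
Qed.

End gauss_bounds.

(* [G r x] is evaluated at position [x] with [r] units [v] of conditional variance
   left; a step may use up several units. *)
Definition superharmonic (R : realType) (v : R) (G : nat -> R -> R) :=
  forall (I : finType) (xi : I -> R) (j r : nat) (x : R),
    (0 < #|I|)%N -> avg xi = 0 -> avg (fun i => xi i ^+ 2) = j%:R * v ->
    (forall i, `|xi i| <= 2) ->
    avg (fun i => G r (x + xi i)) <= G (r + j)%N x.

(** * Superharmonic functions and tails of martingale ends *)

Section superharmonic_theory.
Context {R : realType}.
Implicit Types (c v s b a : R) (G : nat -> R -> R).

Lemma superharmonic_linear v c : superharmonic v (fun _ x => c * x).
Proof.
move=> I xi j r x I0 m1 _ _.
by rewrite avgZ avgD avg_cst// m1 addr0.
Qed.

Lemma superharmonic_square v c :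
  superharmonic v (fun r x => c * (x ^+ 2 + r%:R * v)).
Proof.
move=> I xi j r x I0 m1 m2 _; rewrite avgZ.
rewrite (@eq_avg _ _ _ (fun i => (x ^+ 2 + r%:R * v) +
  ((2 * x) * xi i + xi i ^+ 2))); last by move=> i; ring.
rewrite avgD avg_cst// avgD avgZ m1 m2 natrD.
by rewrite le_eqVlt; apply/orP; left; apply/eqP; ring.
Qed.

(* [heat_tail] is a Gaussian tail smoothed at scale [b]. Its steps fail to be
   exactly harmonic, and [heat_weight], a Chernoff bound tilted at
   [s = u / sqrt theta], dominates the error with the exponential decay of the
   tail itself, which a uniform error bound would lose. *)
Definition heat_weight s b a v (r : nat) (x : R) : R :=
  expR (- (s * (a - x)) + (s ^+ 2 / 2 + 8 * s ^+ 3) * (b ^+ 2 + r%:R * v)).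

Definition heat_tail b a v (r : nat) (x : R) : R :=
  gauss_tail ((a - x) / Num.sqrt (b ^+ 2 + r%:R * v)).

Lemma superharmonic_weight s b a v : 0 <= s -> 2 * s <= 1 ->
  superharmonic v (heat_weight s b a v).
Proof.
move=> s0 s1 I xi j r x I0 m1 m2 xi2.
rewrite (@eq_avg _ _ _ (fun i => heat_weight s b a v r x * expR (s * xi i))); last first.
  by move=> i; rewrite /heat_weight -expRD; congr expR; ring.
rewrite avgZ.
have := avg_expR_step I0 m1 m2 xi2 s0 s1.
move/(ler_wpM2l (expR_ge0 (- (s * (a - x)) + (s ^+ 2 / 2 + 8 * s ^+ 3) * (b ^+ 2 + r%:R * v)))).
move/le_trans; apply; rewrite -expRD ler_expR natrD.
by rewrite le_eqVlt; apply/orP; left; apply/eqP; ring.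
Qed.

(** The space step and the time step have the same second-order term, [Z] in the proof, which
    cancels; 1320 = 1056 + 264 adds the remainders. *)
Lemma heat_tail_step s b a v (I : finType) (xi : I -> R) (j r : nat) (x : R) :
  0 <= v -> 0 <= s -> 2 <= b -> s * b <= 1 ->
  (0 < #|I|)%N -> avg xi = 0 -> avg (fun i => xi i ^+ 2) = j%:R * v ->
  (forall i, `|xi i| <= 2) ->
  `|avg (fun i => heat_tail b a v r (x + xi i)) - heat_tail b a v (r + j) x| <=
  1320 * b ^- 3 * (j%:R * v) * heat_weight s b a v (r + j) x.
Proof.
move=> v0 s0 b2 sb I0 m1 m2 xi2.
pose T := b ^+ 2 + r%:R * v; pose w := j%:R * v.
have w0 : 0 <= w by rewrite mulr_ge0.
(* The variance of an increment bounded by 2, as the time step requires. *)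
have w4 : 0 <= w <= 4.
  rewrite w0 /w -m2 -(avg_cst (4 : R) I0); apply: ler_avg => i.
  rewrite -real_normK ?num_real// (_ : 4 = 2 ^+ 2); last by ring.
  by rewrite lerXn2r ?nnegrE.
have bT : b ^+ 2 <= T by rewrite lerDl mulr_ge0.
have Tw : b ^+ 2 + (r + j)%:R * v = T + w by rewrite natrD /T /w; ring.
rewrite /heat_weight /heat_tail Tw -/T.
under eq_avg => i do rewrite opprD addrA.
set y := a - x.
have h1 := avg_gauss_tail_step y I0 m1 m2 xi2 s0 b2 sb bT.
have h2 := gauss_tail_time_step y w4 s0 b2 sb bT.
have bi0 : 0 <= b ^- 3 by rewrite invr_ge0 exprn_ge0//; lra.
have e1 : expR (- (s * y) + s ^+ 2 * T / 2) <=
    expR (- (s * y) + (s ^+ 2 / 2 + 8 * s ^+ 3) * (T + w)).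
  rewrite ler_expR; have := sqr_ge0 s; have s3 := exprn_ge0 3 s0 => s2.
  have T0 : 0 <= T by rewrite (le_trans _ bT)// exprn_ge0//; lra.
  have := mulr_ge0 s2 w0; have := mulr_ge0 s3 (addr_ge0 T0 w0); lra.
have e2 : expR (- (s * y) + s ^+ 2 * (T + w) / 2) <=
    expR (- (s * y) + (s ^+ 2 / 2 + 8 * s ^+ 3) * (T + w)).
  rewrite ler_expR; have s3 := exprn_ge0 3 s0.
  have T0 : 0 <= T by rewrite (le_trans _ bT)// exprn_ge0//; lra.
  have := mulr_ge0 s3 (addr_ge0 T0 w0); lra.
have {}h1 := le_trans h1 (ler_wpM2l (mulr_ge0 (mulr_ge0 (ler0n R 1056) bi0) w0) e1).
have {}h2 := le_trans h2 (ler_wpM2l (mulr_ge0 (mulr_ge0 (ler0n R 264) bi0) w0) e2).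
move: h1 h2; rewrite -/w.
set Z := w / T / 2 * _; set A := avg _; set g1 := gauss_tail _.
set g2 := gauss_tail _; set E := expR _ => h1 h2.
have -> : A - g2 = (A - g1 - Z) - (g2 - g1 - Z) by ring.
apply: (le_trans (ler_normB _ _)); apply: (le_trans (lerD h1 h2)).
by rewrite le_eqVlt; apply/orP; left; apply/eqP; ring.
Qed.

(** The correction is proportional to the remaining variance: a step spending [j] units lowers it by
    exactly the error of [heat_tail_step], while the weight is itself superharmonic. The signs e = 1
    and e = -1 give the upper and the lower bound. *)
Lemma superharmonic_heat e s b a v : `|e| <= 1 -> 0 <= v -> 0 <= s -> 2 <= b ->
  s * b <= 1 ->
  superharmonic v (fun r x => e * heat_tail b a v r x +
    1320 * b ^- 3 * (r%:R * v) * heat_weight s b a v r x).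
Proof.
move=> e1 v0 s0 b2 sb I xi j r x I0 m1 m2 xi2.
have bi0 : 0 <= b ^- 3 by rewrite invr_ge0 exprn_ge0//; lra.
have h := heat_tail_step a r x v0 s0 b2 sb I0 m1 m2 xi2.
have s1 : 2 * s <= 1.
  by apply: le_trans sb; rewrite mulrC ler_wpM2l.
have hw := (superharmonic_weight b a (v := v) s0 s1) I xi j r x I0 m1 m2 xi2.
rewrite avgD !avgZ.
have K0 : 0 <= 1320 * b ^- 3 * (r%:R * v).
  exact: mulr_ge0 (mulr_ge0 (ler0n R _) bi0) (mulr_ge0 (ler0n R r) v0).
have {}hw := ler_wpM2l K0 hw.
set A := avg _ in h *; set F := heat_tail _ _ _ _ _ in h *.
set W := heat_weight _ _ _ _ _ _ in h hw *.
have h' : e * (A - F) <= 1320 * b ^- 3 * (j%:R * v) * W.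
  apply: (le_trans (ler_norm _)); rewrite normrM.
  by apply: le_trans h; rewrite ler_piMl.
apply: (le_trans (lerD (lexx (e * A)) hw)).
by rewrite natrD; lra.
Qed.

End superharmonic_theory.

(* The law of [S] under the uniform measure is that of the value at time [w] of
   a martingale with steps as in [superharmonic], started from 0. *)
Definition martingale_end (R : realType) (v : R) (w : nat) (J : finType)
    (S : J -> R) :=
  (0 < #|J|)%N /\
  forall G, superharmonic v G -> avg (fun c => G 0%N (S c)) <= G w 0.

Section martingale_end_moments.
Context {R : realType} (v : R) (w : nat) (J : finType) (S : J -> R).
Hypothesis v0 : 0 <= v.
Hypothesis SG : martingale_end v w S.

(** Linear functions are superharmonic with both signs, so the two inequalities form an equality.
    The same device gives the second moment. *)
Lemma martingale_end_mean : avg S = 0.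
Proof.
case: SG => J0 H.
have h1 := H _ (@superharmonic_linear _ v 1).
have h2 := H _ (@superharmonic_linear _ v (-1)).
move: h1 h2; rewrite !avgZ !mulr0; lra.
Qed.

Lemma martingale_end_square : avg (fun c => S c ^+ 2) = w%:R * v.
Proof.
case: SG => J0 H.
have h1 := H _ (@superharmonic_square _ v 1).
have h2 := H _ (@superharmonic_square _ v (-1)).
move: h1 h2; rewrite !avgZ !avgD !mul0r avg_cst// expr0n/=; lra.
Qed.

End martingale_end_moments.

(** At time 0 the heat tail is [gauss_tail u]; at the end it is a ramp of width [b] around u sqrt
    theta. Moving the level by [M * b] compares the ramp with an indicator: from above up to the
    factor [gauss_tail (- M)], from below up to the part of the ramp beyond the level, which is
    charged to the exponential weight so as to keep its decay in [u]. *)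
Lemma martingale_end_tail (R : realType) (v : R) (w : nat) (J : finType)
    (S : J -> R) (b u M : R) :
  let theta := b ^+ 2 + w%:R * v in
  let omega := expR (- (u ^+ 2 / 2) + 8 * u ^+ 3 / Num.sqrt theta) in
  0 <= v -> martingale_end v w S -> 2 <= b -> 0 < u ->
  u / Num.sqrt theta * b <= 1 -> 1 <= M ->
  (forall t, u * Num.sqrt theta + M * b <= t ->
    avg (fun c => (t < S c)%R%:R) * gauss_tail (- M) <=
    gauss_tail u + 1320 * b ^- 3 * (w%:R * v) * omega) /\
  (forall t, t <= u * Num.sqrt theta - M * b ->
    gauss_tail u - 1320 * b ^- 3 * (w%:R * v) * omega
      - expR (- ((M - 1) ^+ 2 / 2)) * omega <=
    avg (fun c => (t < S c)%R%:R)).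
Proof.
move=> theta omega v0 SG b2 u0 sb M1.
have b0 : 0 < b by exact: lt_le_trans b2.
have theta0 : 0 < theta by rewrite ltr_wpDr ?mulr_ge0// exprn_gt0.
pose s := u / Num.sqrt theta; pose a := u * Num.sqrt theta.
have rt0 : 0 < Num.sqrt theta by rewrite sqrtr_gt0.
have rt2 : Num.sqrt theta ^+ 2 = theta by rewrite sqr_sqrtr// ltW.
have s0 : 0 <= s by exact: divr_ge0 (ltW u0) (ltW rt0).
have bi0 : 0 <= b ^- 3 by rewrite invr_ge0 exprn_ge0// ltW.
(* For s = u / sqrt theta, the optimal Chernoff tilt, - s a + s^2 theta / 2 = - u^2 / 2. *)
have heat_weight_start : heat_weight s b a v w 0 = omega.
  rewrite /heat_weight -/theta /omega subr0 /s /a; congr expR.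
  by rewrite -[X in _ + _ * X = _]rt2; field; rewrite gt_eqF.
have heat_tail_start : heat_tail b a v w 0 = gauss_tail u.
  rewrite /heat_tail -/theta subr0 /a; congr gauss_tail.
  by field; rewrite gt_eqF.
have heat_tail_end x : heat_tail b a v 0 x = gauss_tail ((a - x) / b).
  by rewrite /heat_tail mul0r addr0 sqrtr_sqr gtr0_norm.
have avg_heat_tail (e : R) : `|e| <= 1 ->
    avg (fun c => e * heat_tail b a v 0 (S c)) <=
    e * gauss_tail u + 1320 * b ^- 3 * (w%:R * v) * omega.
  move=> e1; have [_ /(_ _ (superharmonic_heat a e1 v0 s0 b2 sb))] := SG.
  rewrite heat_weight_start heat_tail_start; apply: le_trans.
  by apply: ler_avg => c; rewrite mul0r mulr0 mul0r addr0.
split=> t ta.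
- have := @avg_heat_tail 1; rewrite normr1 lexx mul1r => /(_ isT).
  apply: le_trans; rewrite mulrC -avgZ; apply: ler_avg => c.
  rewrite mul1r heat_tail_end.
  case: ltP => tS; last by rewrite mulr0 gauss_tail_ge0.
  rewrite mulr1; apply: gauss_tail_nonincreasing.
  by rewrite ler_pdivrMr//; move: ta; rewrite -/a => ta; lra.
have := @avg_heat_tail (-1); rewrite normrN1 lexx => /(_ isT).
rewrite avgZ.
have s1 : 2 * s <= 1 by apply: le_trans sb; rewrite mulrC ler_wpM2l.
have [_ /(_ _ (superharmonic_weight b a (v := v) s0 s1))] := SG.
rewrite heat_weight_start => hW.
pose e := expR (- ((M - 1) ^+ 2 / 2)).
have e0 : 0 <= e by exact: expR_ge0.
have hF : avg (fun c => heat_tail b a v 0 (S c)) <=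
   avg (fun c => (t < S c)%R%:R + e * heat_weight s b a v 0 (S c)).
  apply: ler_avg => c; rewrite heat_tail_end.
  have w0 : 0 <= e * heat_weight s b a v 0 (S c) by rewrite mulr_ge0 ?expR_ge0.
  case: ltP => [tS|St]; first by rewrite ler_wpDr// gauss_tail_le1.
  rewrite add0r; set y := (a - S c) / b.
  have yM : M <= y by rewrite ler_pdivlMr//; move: ta; rewrite -/a => ta; lra.
  have y1 : 1 <= y := le_trans M1 yM.
  have y0 : 0 < y := lt_le_trans ltr01 y1.
  apply: (le_trans (gauss_tail_le y0)).
  apply: (@le_trans _ _ (gauss_density y)).
    by rewrite ler_pdivrMr// ler_peMr ?(ltW (gauss_density_gt0 _)).
  apply: (le_trans (gauss_density_le_expR _)).
  rewrite /e /heat_weight -expRD ler_expR mul0r addr0.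
  have -> : a - S c = y * b by rewrite /y divfK// gt_eqF.
  have sb' : s * b <= 1 by exact: sb.
  (* Completing the square, y^2/2 - s b y + (s b)^2/2 = (y - s b)^2/2, and y - s b >= M - 1 because
     s b <= 1. *)
  have h1 : (M - 1) ^+ 2 <= (y - s * b) ^+ 2.
    by rewrite lerXn2r ?nnegrE; lra.
  have h2 : 0 <= s ^+ 3 * b ^+ 2 by rewrite mulr_ge0 ?exprn_ge0// ltW.
  by lra.
have := ler_wpM2l e0 hW.
rewrite (avgD (fun c => (t < S c)%R%:R)) avgZ in hF.
rewrite -/e.
set A := avg _ in hF *; set B := avg _ in hF *; set C := avg _ in hF *.
lra.
Qed.

(** * Descents along a path of uniform residues *)

Section descents.
Variable (T : Type) (lt : rel T).

(** The relation is a parameter because descents are counted both for reals and for residues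
    compared as natural numbers. *)
Fixpoint descents_from (x : T) (s : seq T) : nat :=
  if s is y :: s' then (lt y x + descents_from y s')%N else 0%N.

Definition descents (s : seq T) : nat :=
  if s is x :: s' then descents_from x s' else 0%N.

End descents.

Section residues.
Context {R : realType} (m' : nat).
Notation m := (m'.+1).
Notation T := 'I_m.
Implicit Types (a b U y rho : T) (G : nat -> R -> R).

(** Mean, variance and centred value of U / m for U uniform on 0, ..., m - 1. *)
Definition residue_mean : R := m'%:R / (2 * m%:R).
Definition residue_var : R := (m%:R ^+ 2 - 1) / (12 * m%:R ^+ 2).
Definition residue_dev U : R := U%:R / m%:R - residue_mean.

Let m0 : m%:R != 0 :> R. Proof. by rewrite pnatr_eq0. Qed.

Let card_m : #|{: T}|%:R = m%:R :> R. Proof. by rewrite card_ord. Qed.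

Let T0 : (0 < #|{: T}|)%N. Proof. by rewrite card_ord. Qed.

Lemma sum_ord_natr n : \sum_(i < n) (i%:R : R) = n%:R * (n%:R - 1) / 2.
Proof.
elim: n => [|n IH]; first by rewrite big_ord0 mul0r mul0r.
by rewrite big_ord_recr/= IH -natr1; field.
Qed.

Lemma sum_ord_sqr n :
  \sum_(i < n) (i%:R ^+ 2 : R) = n%:R * (n%:R - 1) * (2 * n%:R - 1) / 6.
Proof.
elim: n => [|n IH]; first by rewrite big_ord0 !mul0r.
by rewrite big_ord_recr/= IH -natr1; field.
Qed.

Lemma residue_var_ge0 : 0 <= residue_var.
Proof.
rewrite /residue_var divr_ge0 ?mulr_ge0 ?exprn_ge0// subr_ge0.
by rewrite -natrX ler1n expn_gt0.
Qed.

Lemma avg_residue_dev : avg residue_dev = 0.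
Proof.
rewrite /avg /residue_dev card_m sumrB -mulr_suml sum_ord_natr sumr_const card_ord.
by rewrite /residue_mean -mulr_natr -(natr1 m'); field; rewrite natr1.
Qed.

Lemma avg_residue_dev_sqr : avg (fun U => residue_dev U ^+ 2) = residue_var.
Proof.
rewrite /avg card_m.
rewrite (eq_bigr (fun U : T => U%:R ^+ 2 / m%:R ^+ 2 +
  (- (2 * residue_mean / m%:R) * U%:R + residue_mean ^+ 2))); last first.
  by move=> U _; rewrite /residue_dev; field.
rewrite !big_split/= -mulr_suml -mulr_sumr sum_ord_natr sum_ord_sqr sumr_const.
rewrite card_ord /residue_mean /residue_var -mulr_natr -(natr1 m').
by field; rewrite natr1.
Qed.

Lemma residue_dev_norm U : `|residue_dev U| <= 2^-1.
Proof.
have m1 : 1 <= m%:R :> R by rewrite ler1n.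
have U0 : 0 <= U%:R :> R by [].
have Um : U%:R <= m'%:R :> R by rewrite ler_nat -ltnS.
have e : residue_dev U = (2 * U%:R - m'%:R) / (2 * m%:R).
  by rewrite /residue_dev /residue_mean; field.
rewrite e normrM [`|_^-1|]gtr0_norm ?invr_gt0 ?mulr_gt0 ?ltr0n//.
rewrite ler_pdivrMr ?mulr_gt0 ?ltr0n// ler_norml.
by have := natr1 m' : m'%:R + 1 = m%:R :> R; lra.
Qed.

Lemma superharmonic_residue G r x : superharmonic residue_var G ->
  avg (fun U => G r (x + residue_dev U)) <= G r.+1 x.
Proof.
move=> SH; rewrite -(addn1 r); apply: SH => //.
- exact: avg_residue_dev.
- by rewrite avg_residue_dev_sqr mul1r.
- by move=> U; apply: le_trans (residue_dev_norm U) _; lra.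
Qed.

Let step3 rho (p : T * T) : R :=
  residue_dev p.1 + residue_dev p.2 - residue_dev (p.1 + p.2 + rho).

Let avg_shift (f : T -> R) (c : T) : avg (fun b => f (b + c)) = avg f.
Proof. by rewrite (reindex_avg f (h := +%R^~ c))//; exists (+%R^~ (- c)); [exact: addrK|exact: addrNK]. Qed.

(* [a], [b] and [a + b + rho] are pairwise independent, which makes the variance
   of the step equal to three units. *)
Lemma superharmonic_residue3 G r x rho : superharmonic residue_var G ->
  avg (fun a => avg (fun b => G r (x + (residue_dev a + residue_dev b -
     residue_dev (a + b + rho))))) <= G (r + 3)%N x.
Proof.
move=> SH.
rewrite -(avg_pair (fun p : T * T => G r (x + step3 rho p))).
have shift (f : T -> R) a : avg (fun b => f (a + b + rho)) = avg f.
  by rewrite -[RHS](avg_shift f (a + rho)); apply: eq_avg => b; rewrite -addrA addrCA.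
have shiftl (f : T -> R) b : avg (fun a => f (a + b + rho)) = avg f.
  by rewrite -[RHS](avg_shift f (b + rho)); apply: eq_avg => a; rewrite addrA.
apply: SH => //.
- by rewrite card_prod muln_gt0 T0.
- rewrite avg_pair /step3/= -[RHS]avg_residue_dev; apply: eq_avg => a.
  rewrite (avgD (fun b => residue_dev a + residue_dev b)) avgN.
  by rewrite (avgD (fun=> residue_dev a)) shift avg_residue_dev avg_cst// subr0 addr0.
- rewrite avg_pair /step3/=.
  rewrite (@eq_avg _ _ _ (fun a => (residue_dev a ^+ 2 + 2 * residue_var) +
    (-2) * avg (fun b => residue_dev b * residue_dev (a + b + rho)))); last first.
    move=> a; rewrite (@eq_avg _ _ _ (fun b => residue_dev a ^+ 2 +
     (2 * residue_dev a * residue_dev b + (residue_dev b ^+ 2 +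
     (- (2 * residue_dev a) * residue_dev (a + b + rho) +
     (residue_dev (a + b + rho) ^+ 2 +
     (-2) * (residue_dev b * residue_dev (a + b + rho)))))))); last first.
      by move=> b; ring.
    rewrite (avgD (fun=> residue_dev a ^+ 2)) avg_cst//.
    rewrite (avgD (fun b => 2 * residue_dev a * residue_dev b)).
    rewrite (avgD (fun b => residue_dev b ^+ 2)).
    rewrite (avgD (fun b => - (2 * residue_dev a) * residue_dev (a + b + rho))).
    rewrite (avgD (fun b => residue_dev (a + b + rho) ^+ 2)).
    rewrite !avgZ (shift (fun z => residue_dev z ^+ 2)) shift.
    by rewrite avg_residue_dev avg_residue_dev_sqr; ring.
  rewrite (avgD (fun a => residue_dev a ^+ 2 + 2 * residue_var)).
  rewrite (avgD (fun a => residue_dev a ^+ 2)) avg_cst// avg_residue_dev_sqr.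
  rewrite avgZ avg_exchange.
  rewrite (@eq_avg _ _ _ (fun=> 0)); last first.
    by move=> b; rewrite avgZ shiftl avg_residue_dev mulr0.
  by rewrite avg_cst//; ring.
- move=> [a b]; rewrite /step3/=.
  have := residue_dev_norm a; have := residue_dev_norm b.
  have := residue_dev_norm (a + b + rho).
  rewrite !ler_norml; lra.
Qed.

(* The recentred sum of a path: with [U = y' - y] modulo [m], one has
   [(y' < y) = (U + y - y') / m], so that the descents of a path are the sum of
   independent uniform increments up to a boundary term. *)
Lemma residue_descent y U :
  (((y + U)%R < y)%N%:R + (y + U)%R%:R / m%:R : R) = U%:R / m%:R + y%:R / m%:R.
Proof.
have -> : (y + U)%R = ((y + U) %% m)%N :> nat by [].
have ym := ltn_ord y; have Um := ltn_ord U.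
have [h|h] := ltnP (y + U) m.
  rewrite modn_small// ltnNge leq_addr/= add0r natrD; ring.
have -> : ((y + U) %% m = y + U - m)%N.
  by rewrite -{1}(subnK h) modnDr modn_small//; lia.
have -> : (y + U - m < y)%N by lia.
by rewrite natrB// natrD mulr1n; field.
Qed.

Fixpoint list_avg (k : nat) (H : seq T -> R) : R :=
  if k is k'.+1 then avg (fun y => list_avg k' (fun s => H (y :: s))) else H [::].

Lemma eq_list_avg k H1 H2 : H1 =1 H2 -> list_avg k H1 = list_avg k H2.
Proof.
elim: k H1 H2 => //= k IH H1 H2 H12.
by apply: eq_avg => y; apply: IH => s; rewrite H12.
Qed.

(** The average over paths rewritten in terms of increments: [x] accumulates them, and the last
    residue is subtracted once, as boundary term. *)
Fixpoint chain_avg (g : R -> R) (k : nat) (x : R) (y : T) : R :=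
  if k is k'.+1
  then avg (fun U => chain_avg g k' (x + U%:R / m%:R) (y + U))
  else g (x - y%:R / m%:R).

(** [residue_descent] telescopes along the path; the substitution of y + U for the next residue
    preserves the uniform average. *)
Lemma list_avg_chain g k x y :
  list_avg k (fun s => g (x + (descents_from (fun i j : T => i < j)%N y s)%:R)) =
  chain_avg g k (x + y%:R / m%:R) y.
Proof.
elim: k x y => [|k IH] x y /=; first by rewrite addr0 addrK.
rewrite -[LHS](avg_shift _ y); apply: eq_avg => U.
rewrite -addrA [y%:R / _ + _]addrC -residue_descent addrA [y + U]addrC -IH.
by apply: eq_list_avg => s; rewrite natrD addrA.
Qed.

(** Here [a] is the first residue, [b] the first increment, and [rho] collects the other increments
    once they are fixed. Those are revealed first, one unit each. What remains is a + b - (a + b +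
    rho) over m: the boundary term depends on [a] and [b], so the three are treated as a single step
    of three units. *)
Lemma avg_chain_le G r k x rho : superharmonic residue_var G ->
  avg (fun a => avg (fun b =>
    chain_avg (G r) k (x + a%:R / m%:R + b%:R / m%:R) (a + b + rho))) <=
  G (r + k + 3)%N (x + k.+1%:R * residue_mean).
Proof.
move=> SH; elim: k x rho => [|k IH] x rho /=.
  rewrite addn0.
  apply: le_trans (superharmonic_residue3 r (x + 1 * residue_mean) rho SH).
  rewrite le_eqVlt; apply/orP; left; apply/eqP.
  apply: eq_avg => a; apply: eq_avg => b; congr G.
  by rewrite /residue_dev; ring.
(* The next increment [U] is moved towards the outside and joins [rho]. *)
rewrite (@eq_avg _ _ _ (fun a => avg (fun U => avg (fun b =>
  chain_avg (G r) k (x + U%:R / m%:R + a%:R / m%:R + b%:R / m%:R) (a + b + (rho + U)))))); last first.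
  move=> a; rewrite avg_exchange; apply: eq_avg => b; apply: eq_avg => U.
  by rewrite !addrA; congr chain_avg; ring.
rewrite avg_exchange.
have h U := IH (x + U%:R / m%:R) (rho + U).
apply: (le_trans (ler_avg h)).
have -> : (r + k.+1 + 3 = (r + k + 3).+1)%N by lia.
apply: le_trans (superharmonic_residue (r + k + 3) (x + k.+2%:R * residue_mean) SH).
rewrite le_eqVlt; apply/orP; left; apply/eqP.
by apply: eq_avg => U; congr G; rewrite /residue_dev -(natr1 k.+1); ring.
Qed.

(* A path with [k.+2] vertices has [k.+1] edges: [k] steps of one unit, and one step
   of three units for the last increment together with the boundary term. *)
Definition path_steps (k : nat) : nat := if (k <= 1)%N then 0%N else k.+1.

Lemma list_avg_descents_le G r k x : superharmonic residue_var G ->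
  list_avg k (fun s => G r (x +
    ((descents (fun i j : T => i < j)%N s)%:R - k.-1%:R * residue_mean))) <=
  G (r + path_steps k)%N x.
Proof.
move=> SH; case: k => [|[|k]].
- by rewrite /= addn0 mul0r subr0 addr0.
- by rewrite /= addn0 mul0r subr0 addr0 avg_cst.
have -> : (r + path_steps k.+2 = r + k + 3)%N by rewrite /path_steps/=; lia.
have -> : G (r + k + 3)%N x =
   G (r + k + 3)%N (x - k.+1%:R * residue_mean + k.+1%:R * residue_mean).
  by rewrite subrK.
apply: le_trans (avg_chain_le r k (x - k.+1%:R * residue_mean) 0 SH).
rewrite le_eqVlt; apply/orP; left; apply/eqP.
rewrite [LHS]/=.
apply: eq_avg => y.
have /= h := list_avg_chain (G r) k.+1 (x - k.+1%:R * residue_mean) y.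
transitivity (chain_avg (G r) k.+1 (x - k.+1%:R * residue_mean + y%:R / m%:R) y).
  rewrite /= -h; apply: eq_avg => z; apply: eq_list_avg => s.
  by congr G; ring.
by rewrite /=; apply: eq_avg => U; rewrite addr0.
Qed.

End residues.

(** * Averages over vertex labels; forests of disjoint paths *)

Section vertex_average.
Context {R : realType} {T : finType}.
Implicit Types (c : nat -> T) (F H : (nat -> T) -> R) (vs : seq nat).

Definition update c (v : nat) (y : T) : nat -> T :=
  fun i => if i == v then y else c i.

Fixpoint assign vs (ys : seq T) c : nat -> T :=
  match vs, ys with
  | v :: vs', y :: ys' => assign vs' ys' (update c v y)
  | _, _ => c
  end.

(** An iterated average, one vertex at a time, rather than an average over tuples: it can be
    reordered and cut along the paths. *)
Fixpoint vertex_avg vs F c : R :=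
  if vs is v :: vs' then avg (fun y => vertex_avg vs' F (update c v y)) else F c.

Lemma vertex_avg_cat vs1 vs2 F c :
  vertex_avg (vs1 ++ vs2) F c = vertex_avg vs1 (vertex_avg vs2 F) c.
Proof. by elim: vs1 c => //= v vs1 IH c; apply: eq_avg => y. Qed.

Lemma ler_vertex_avg vs F H c :
  (forall c', (forall i, i \notin vs -> c' i = c i) -> F c' <= H c') ->
  vertex_avg vs F c <= vertex_avg vs H c.
Proof.
elim: vs c => [|v vs IH] c FH /=; first exact: FH.
apply: ler_avg => y; apply: IH => c' c'E; apply: FH => i.
rewrite inE negb_or => /andP[iv ivs].
by rewrite c'E// /update (negbTE iv).
Qed.

Lemma eq_vertex_avg vs F H c :
  (forall c', (forall i, i \notin vs -> c' i = c i) -> F c' = H c') ->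
  vertex_avg vs F c = vertex_avg vs H c.
Proof.
move=> FH; apply/eqP; rewrite eq_le; apply/andP.
by split; apply: ler_vertex_avg => c' /FH ->.
Qed.

(** Fubini at one vertex; updates at distinct vertices commute. *)
Lemma vertex_avg_rem vs v F c : uniq vs -> v \in vs ->
  vertex_avg vs F c = vertex_avg (v :: rem v vs) F c.
Proof.
elim: vs c => [//|u vs IH] c /= /andP[uvs uniq_vs].
have [->//|vu] := eqVneq v u.
rewrite in_cons (negbTE vu)/= => v_vs.
under eq_avg => x do rewrite IH//=.
rewrite avg_exchange; apply: eq_avg => y; apply: eq_avg => x.
congr vertex_avg; apply/funext => i; rewrite /update.
by case: (eqVneq i v) => [->|//]; rewrite (negbTE vu).
Qed.

Lemma perm_vertex_avg vs1 vs2 F c : uniq vs1 -> perm_eq vs1 vs2 ->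
  vertex_avg vs1 F c = vertex_avg vs2 F c.
Proof.
elim: vs1 vs2 c => [|v vs1 IH] vs2 c.
  by move=> _; rewrite perm_sym => /perm_nilP ->.
move=> u1 p12; have u2 : uniq vs2 by rewrite -(perm_uniq p12).
have v2 : v \in vs2 by rewrite -(perm_mem p12) mem_head.
rewrite (vertex_avg_rem _ _ u2 v2) /=; apply: eq_avg => y.
apply: IH; first by case/andP: u1.
by rewrite -(perm_cons v) (permPl p12) perm_to_rem.
Qed.

Lemma vertex_avg_id vs F c : (0 < #|T|)%N ->
  (forall c', (forall i, i \notin vs -> c' i = c i) -> F c' = F c) ->
  vertex_avg vs F c = F c.
Proof.
move=> T0 Fc; rewrite (@eq_vertex_avg _ _ (fun=> F c))//.
move: (F c) => x; elim: vs c {Fc} => //= v vs IH c.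
by rewrite (eq_avg (fun y => IH _)) avg_cst.
Qed.

Lemma avg_tuple_cons n (F : n.+1.-tuple T -> R) :
  avg F = avg (fun y => avg (fun t : n.-tuple T => F [tuple of y :: t])).
Proof.
rewrite -(avg_pair (fun p : T * n.-tuple T => F [tuple of p.1 :: p.2])).
apply: (@reindex_avg _ _ _ (fun p : T * n.-tuple T => [tuple of p.1 :: p.2])).
exists (fun t => (thead t, [tuple of behead t])).
- by move=> [y t] /=; rewrite theadE; congr pair; apply/val_inj.
- by move=> t /=; rewrite -tuple_eta.
Qed.

Lemma avg_tuple_assign n vs F c : size vs = n ->
  avg (fun t : n.-tuple T => F (assign vs t c)) = vertex_avg vs F c.
Proof.
elim: vs n c => [|v vs IH] n c <-/=.
  rewrite (@eq_avg _ _ _ (fun=> F c)) ?avg_cst//.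
  by rewrite card_tuple expn0.
by rewrite avg_tuple_cons; apply: eq_avg => y; rewrite -(IH (size vs)).
Qed.

Lemma assign_notin vs ys c i : i \notin vs -> assign vs ys c i = c i.
Proof.
elim: vs ys c => [|v vs IH] [|y ys] c //=.
rewrite inE negb_or => /andP[iv ivs].
by rewrite IH// /update (negbTE iv).
Qed.

Lemma map_assign vs ys c : uniq vs -> size ys = size vs ->
  map (assign vs ys c) vs = ys.
Proof.
elim: vs ys c => [|v vs IH] [|y ys] c //= /andP[vvs u] [sz].
by rewrite IH// assign_notin// /update eqxx.
Qed.

End vertex_average.

Section path_forest.
Context {R : realType} (m' : nat).
Notation T := 'I_m'.+1.
Implicit Types (c : nat -> T) (p : seq nat) (ps : seq (seq nat)).

Definition path_dev c p : R :=
  (descents (fun i j : T => i < j)%N (map c p))%:R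
  - (size p).-1%:R * residue_mean m'.

Definition forest_steps ps : nat := \sum_(p <- ps) path_steps (size p).

Lemma vertex_avg_path p (H : seq T -> R) c : uniq p ->
  vertex_avg p (fun c' => H (map c' p)) c = list_avg (size p) H.
Proof.
elim: p H c => //= v p IH H c /andP[vp up].
apply: eq_avg => y; rewrite -(IH (fun s => H (y :: s)) (update c v y) up).
apply: eq_vertex_avg => c' /(_ v vp) ->.
by rewrite /update eqxx.
Qed.

(** The inner averages run over the later paths, started from the position shifted by the deviation
    of [p]; by disjointness this deviation does not move during them. The units of variance add
    up. *)
Lemma vertex_avg_forest_le ps G r x c : uniq (flatten ps) ->
  superharmonic (residue_var m') G ->
  vertex_avg (flatten ps) (fun c' => G r (x + \sum_(p <- ps) path_dev c' p)) c <=
  G (r + forest_steps ps)%N x.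
Proof.
move=> + SH; elim: ps r x c => [|p ps IH] r x c.
  by rewrite /= /forest_steps !big_nil addn0 addr0.
rewrite /= cat_uniq => /and3P[up disj ups].
rewrite vertex_avg_cat /forest_steps big_cons.
have step c' : vertex_avg (flatten ps)
    (fun c'' => G r (x + \sum_(q <- p :: ps) path_dev c'' q)) c' <=
    G (r + forest_steps ps)%N (x + path_dev c' p).
  apply: le_trans (IH r (x + path_dev c' p) c' ups).
  apply: ler_vertex_avg => c'' c''E.
  rewrite big_cons addrA (_ : path_dev c'' p = path_dev c' p)//.
  rewrite /path_dev (_ : map c'' p = map c' p)//.
  apply/eq_in_map => i ip; apply: c''E; apply/negP => ifl.
  by move/hasP: disj; apply; exists i.
apply: (@le_trans _ _ (vertex_avg p
  (fun c' => G (r + forest_steps ps)%N (x + path_dev c' p)) c)).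
  by apply: ler_vertex_avg => c' _; exact: step.
rewrite (vertex_avg_path (fun s => G (r + forest_steps ps)%N (x +
  ((descents (fun i j : T => i < j)%N s)%:R - (size p).-1%:R * residue_mean m'))))//.
apply: le_trans (list_avg_descents_le _ _ _ SH) _.
by rewrite -/(forest_steps ps) -addnA (addnC (forest_steps ps)).
Qed.

Lemma martingale_end_forest n vs ps c : uniq vs -> size vs = n ->
  uniq (flatten ps) -> {subset flatten ps <= vs} ->
  martingale_end (residue_var m') (forest_steps ps)
    (fun t : n.-tuple T => \sum_(p <- ps) path_dev (assign vs t c) p).
Proof.
move=> uvs szvs ups psvs; split.
  by rewrite card_tuple expn_gt0 card_ord.
move=> G SH.
rewrite (@avg_tuple_assign _ _ n vs
  (fun c' => G 0%N (\sum_(p <- ps) path_dev c' p)) c szvs).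
(* Labels outside the paths do not affect the sum and are averaged out by [vertex_avg_id]. *)
pose rest := [seq i <- vs | i \notin flatten ps].
have pe : perm_eq vs (flatten ps ++ rest).
  apply: uniq_perm => //.
    rewrite cat_uniq ups filter_uniq// andbT/=.
    by apply/hasPn => i; rewrite mem_filter => /andP[].
  move=> i; rewrite mem_cat mem_filter.
  by case: (boolP (i \in flatten ps)) => //= /psvs ->.
rewrite (perm_vertex_avg _ _ uvs pe) vertex_avg_cat.
apply: le_trans (vertex_avg_forest_le 0 0 c ups SH).
apply: ler_vertex_avg => c' _.
rewrite le_eqVlt; apply/orP; left; apply/eqP.
rewrite add0r vertex_avg_id ?card_ord// => c'' c''E; congr G.
apply: eq_big_seq => p pps; rewrite /path_dev (_ : map c'' p = map c' p)//.
apply/eq_in_map => i ip; apply: c''E.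
rewrite mem_filter negb_and negbK; apply/orP; left.
by apply/flattenP; exists p.
Qed.

End path_forest.

(** * Index combinatorics: arithmetic progressions and mirrored paths *)

Section consecutive_sums.
Implicit Types (g : nat -> nat -> nat) (s p : seq nat).

(** Descents and edges of a path are both sums over consecutive pairs, with [g] a comparison or the
    constant 1; a single combinatorial identity then serves [Xdes] and [Nroots]. *)
Fixpoint csum_from g x s : nat :=
  if s is y :: s' then (g x y + csum_from g y s')%N else 0%N.

Definition csum g s : nat := if s is x :: s' then csum_from g x s' else 0%N.

Lemma csum_descents (T : Type) (lt : rel T) (y : nat -> T) p :
  descents lt (map y p) = csum (fun i j => lt (y j) (y i)) p.
Proof. by case: p => //= x p; elim: p x => //= a p IH x; rewrite IH. Qed.

Lemma csum_size p : csum (fun _ _ => 1%N) p = (size p).-1.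
Proof. by case: p => //= x p; elim: p x => //= a p IH x; rewrite IH add1n. Qed.

Lemma csum_from_cat g x s1 s2 : csum_from g x (s1 ++ s2) =
  (csum_from g x s1 + csum_from g (last x s1) s2)%N.
Proof. by elim: s1 x => //= y s1 IH x; rewrite IH addnA. Qed.

Lemma csum_cat g x s1 y s2 : csum g ((x :: s1) ++ y :: s2) =
  (csum g (x :: s1) + g (last x s1) y + csum g (y :: s2))%N.
Proof. by rewrite /= csum_from_cat /= addnA. Qed.

Lemma csum_rev g s : csum g (rev s) = csum (fun i j => g j i) s.
Proof.
case: s => // x s; elim: s x => //= y s IH x.
rewrite rev_cons -cats1.
case E : (rev (y :: s)) => [|u r]; first by have := size_rev (y :: s); rewrite E.
rewrite csum_cat -E IH /= addn0 addnC; congr (_ + _)%N.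
by have := last_rcons u (rev s) y; rewrite -rev_cons E /= => ->.
Qed.

Lemma csum_iota g (h : nat -> nat) L a :
  csum g (map h (iota a L)) = (\sum_(a <= j < a + L.-1) g (h j) (h j.+1))%N.
Proof.
case: L => [|L]; first by rewrite addn0 big_geq.
elim: L a => [|L IH] a; first by rewrite addn0 big_geq.
rewrite /= big_ltn; last by rewrite addnS ltnS leq_addr.
by have /= := IH a.+1 => ->; rewrite addSnnS.
Qed.

End consecutive_sums.

Section residue_classes.
Variable d : nat.
Hypothesis d0 : (0 < d)%N.

(** The quotient of e - r by d rounded up: the number of terms r, r + d, ... below [e]. Truncated
    subtraction makes it 0 when r >= e. *)
Definition class_size (e r : nat) : nat := ((e - r + d.-1) %/ d)%N.

Lemma class_sizeP e r j : (j < class_size e r)%N = (r + j * d < e)%N.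
Proof. by rewrite /class_size leq_divRL// mulSn; lia. Qed.

Definition residue_class (e r : nat) : seq nat :=
  [seq (r + j * d)%N | j <- iota 0 (class_size e r)].

Lemma perm_residue_classes lo e : perm_eq (index_iota lo e)
  (flatten [seq residue_class e r | r <- iota lo d]).
Proof.
rewrite -[X in perm_eq _ X]/[seq (r + j * d)%N | r <- iota lo d, j <- iota 0 (class_size e r)].
apply: uniq_perm; first exact: iota_uniq.
  apply: allpairs_uniq_dep; first exact: iota_uniq.
    by move=> r _; exact: iota_uniq.
  move=> [r j] [r' j'] /= /allpairsPdep[r1 [j1 [+ _ [-> ->]]]].
  move=> + /allpairsPdep[r2 [j2 [+ _ [-> ->]]]].
  rewrite !mem_iota => r1P r2P E.
  have e1 : (r1 - lo = r2 - lo)%N.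
    rewrite -(modn_small (m := r1 - lo) (d := d)); last by lia.
    rewrite -(modn_small (m := r2 - lo) (d := d)); last by lia.
    rewrite -(modnMDl j1 (r1 - lo)) -(modnMDl j2 (r2 - lo)); congr modn; lia.
  have r12 : r1 = r2 by lia.
  subst r2; congr existT; apply/eqP; rewrite -(eqn_pmul2r d0); lia.
move=> i; rewrite mem_index_iota; apply/idP/allpairsPdep.
  move=> /andP[loi ie]; exists (lo + (i - lo) %% d)%N, ((i - lo) %/ d)%N.
  have E := divn_eq (i - lo) d.
  have M := ltn_pmod (i - lo) d0.
  rewrite !mem_iota/= add0n class_sizeP; split; lia.
move=> [r [j [+ + ->]]]; rewrite !mem_iota/= add0n class_sizeP; lia.
Qed.

(** An edge from i to i + d stays below [e] exactly when i < e - d, and a nonempty class has one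
    edge less than it has vertices; truncation settles the empty classes. *)
Lemma class_size_sub e r : class_size (e - d) r = (class_size e r).-1.
Proof.
apply/eqP; rewrite eqn_leq; apply/andP; split.
  rewrite leqNgt; apply/negP; rewrite class_sizeP => h.
  have : ((class_size e r).-1.+1 < class_size e r)%N; last by lia.
  rewrite class_sizeP mulSn; move: (_.-1 * d)%N h => x; lia.
rewrite leqNgt; apply/negP => h.
have : ((class_size (e - d) r).+1 < class_size e r)%N by lia.
have : ~~ (class_size (e - d) r < class_size (e - d) r)%N by rewrite ltnn.
by rewrite !class_sizeP mulSn; move: (_ * d)%N => x; lia.
Qed.

Lemma csum_residue_class g e r : csum g (residue_class e r) =
  (\sum_(0 <= j < class_size (e - d) r) g (r + j * d) (r + j * d + d))%N.
Proof.
rewrite /residue_class csum_iota add0n class_size_sub.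
by apply: eq_bigr => j _; rewrite mulSn addnA addnAC.
Qed.

Lemma sum_residue_classes f lo e :
  (\sum_(lo <= i < e) f i =
   \sum_(r <- iota lo d) \sum_(0 <= j < class_size e r) f (r + j * d))%N.
Proof.
rewrite (perm_big _ (perm_residue_classes lo e))/=.
rewrite big_flatten big_map; apply: eq_bigr => r _.
by rewrite /residue_class big_map /index_iota subn0.
Qed.

End residue_classes.

Section mirrored_paths.
Variable d : nat.
Hypothesis d0 : (0 < d)%N.

(** The residues 1, ..., d - 1 are paired by r <-> d - r; for even [d] the residue d / 2 is its own
    partner. *)
Lemma sum_mirror (A : nat -> nat) :
  (\sum_(1 <= r < d) A r = (if odd d then 0 else A d./2) +
   \sum_(1 <= r < uphalf d) (A r + A (d - r)))%N.
Proof.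
rewrite big_split/=.
have q1 : (0 < uphalf d)%N by rewrite uphalf_gt0.
have q2 : (uphalf d <= d)%N by have := odd_double_half d; rewrite uphalf_half; lia.
rewrite (big_cat_nat q1 q2)/= addnCA; congr (_ + _)%N.
have -> : (\sum_(1 <= i < uphalf d) A (d - i) =
           \sum_(d./2.+1 <= i < d) A i)%N.
  rewrite big_nat_rev/= -{1}(addn0 1%N).
  have hd := odd_double_half d.
  rewrite [RHS](_ : _ = \sum_(1 + d./2 <= i < (uphalf d) + d./2) A i)%N; last first.
    by congr bigop; congr index_iota; rewrite uphalf_half; lia.
  rewrite -[in RHS](addn0 1%N).
  rewrite [RHS]big_addn addnK addn0.
  rewrite big_nat [RHS]big_nat; apply: eq_bigr => i /andP[i1 i2]; congr A.
  by move: i2 hd; rewrite uphalf_half; lia.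
have hd := odd_double_half d.
case: (boolP (odd d)) => od.
  by rewrite add0n uphalf_half od add1n.
rewrite uphalf_half (negbTE od) add0n big_ltn//.
by move: hd; rewrite (negbTE od) -addnn; lia.
Qed.

Definition reflected (i : nat) : bool := (d < (i %% d).*2)%N.

(** For indices starting at [lo], which is 0 or 1, [lo * d] is the least one of residue 0. The
    classes of d - r and r, the first one reversed, are glued at their least elements; the gluing
    edge stands for a comparison with a negated variable. *)
Definition mirrored_paths (lo e : nat) : seq (seq nat) :=
  residue_class d e (lo * d) ::
  (if odd d then [::] else [:: residue_class d e d./2]) ++
  [seq rev (residue_class d e (d - r)) ++ residue_class d e r
     | r <- index_iota 1 (uphalf d)].

Lemma sum_residues (A : nat -> nat) lo : (lo <= 1)%N ->
  (\sum_(r <- iota lo d) A r = A (lo * d) +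
    ((if odd d then 0 else A d./2) +
     \sum_(1 <= r < uphalf d) (A r + A (d - r))))%N.
Proof.
move=> lo1; rewrite -sum_mirror.
have -> : iota lo d = index_iota lo (lo + d) by rewrite /index_iota addKn.
case: lo lo1 => [|[|//]] _.
  by rewrite add0n mul0n big_ltn.
by rewrite add1n mul1n big_nat_recr//= addnC.
Qed.

Lemma sum_mirrored_paths (A : seq nat -> nat) lo e :
  (\sum_(p <- mirrored_paths lo e) A p = A (residue_class d e (lo * d)) +
    ((if odd d then 0 else A (residue_class d e d./2)) +
     \sum_(1 <= r < uphalf d)
       A (rev (residue_class d e (d - r)) ++ residue_class d e r)))%N.
Proof.
rewrite /mirrored_paths big_cons big_cat/= big_map.
by case: ifP => _; rewrite ?big_nil ?big_seq1.
Qed.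

Lemma perm_mirrored_paths lo e : (lo <= 1)%N ->
  perm_eq (index_iota lo e) (flatten (mirrored_paths lo e)).
Proof.
move=> lo1; rewrite (permPl (perm_residue_classes d0 lo e)).
apply/permP => a; rewrite !count_flatten !sumnE !big_map.
rewrite (sum_residues (fun r => count a (residue_class d e r)))//.
rewrite (sum_mirrored_paths (count a)).
congr (_ + (_ + _))%N; apply: eq_bigr => r _.
by rewrite count_cat count_rev addnC.
Qed.

Lemma csum_rev_cat g s1 s2 : csum g (rev s1 ++ s2) =
  (csum (fun i j => g j i) s1 + csum g s2 +
   (if s1 is x :: _ then if s2 is y :: _ then g x y else 0 else 0))%N.
Proof.
case: s1 => [|x s1]; first by rewrite addn0.
case: s2 => [|y s2]; first by rewrite cats0 csum_rev !addn0.
rewrite -(csum_rev g (x :: s1)).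
case E : (rev (x :: s1)) => [|u r]; first by have := size_rev (x :: s1); rewrite E.
rewrite csum_cat addnAC; congr (_ + _ + _)%N.
by have := last_rcons u (rev s1) x; rewrite -rev_cons E /= => ->.
Qed.

Lemma residue_class_cons e r : residue_class d e r =
  if (r < e)%N then r :: behead (residue_class d e r) else [::].
Proof.
have := class_sizeP d0 e r 0; rewrite mul0n addn0 /residue_class => <-.
by case: (class_size d e r) => //= k; rewrite mul0n addn0.
Qed.

(** The hypotheses evaluate [g] on the three kinds of edges: forward, backward on a reflected class,
    gluing. A gluing edge is present when both classes are nonempty, which is the filter of the last
    sum. *)
Lemma csum_mirrored_paths (f l : nat -> nat) g lo e : (lo <= 1)%N ->
  (forall i, ~~ reflected i -> g i (i + d)%N = f i) ->
  (forall i, reflected i -> g (i + d)%N i = f i) ->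
  (forall i, (1 <= i < uphalf d)%N -> g (d - i)%N i = l i) ->
  (\sum_(p <- mirrored_paths lo e) csum g p =
   \sum_(lo <= i < e - d) f i +
   \sum_(1 <= i < uphalf d | (i < e) && (d - i < e)) l i)%N.
Proof.
move=> lo1 gf gr gl.
have hd := odd_double_half d.
pose F r := (\sum_(0 <= j < class_size d (e - d) r) f (r + j * d))%N.
have refl r j : (r < d)%N -> reflected (r + j * d) = (d < r.*2)%N.
  by move=> rd; rewrite /reflected addnC modnMDl modn_small.
have cls_f r : (r.*2 <= d)%N -> csum g (residue_class d e r) = F r.
  move=> rd; rewrite csum_residue_class//; apply: eq_bigr => j _; apply: gf.
  by rewrite refl -?leqNgt//; lia.
have cls_r r : (r < d)%N -> (d < r.*2)%N ->
    csum (fun i j => g j i) (residue_class d e r) = F r.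
  move=> rd rd2; rewrite csum_residue_class//; apply: eq_bigr => j _; apply: gr.
  by rewrite refl.
rewrite (sum_residue_classes d0) (sum_residues F)// sum_mirrored_paths -!addnA.
congr (_ + (_ + _))%N.
- case: lo lo1 => [|[|//]] _; first by rewrite mul0n cls_f.
  rewrite mul1n csum_residue_class//; apply: eq_bigr => j _; apply: gf.
  by rewrite /reflected -mulSn modnMl.
- by case: ifPn => // od; rewrite cls_f//; move: hd; rewrite (negbTE od); lia.
rewrite [X in (_ + X)%N]big_mkcond -big_split/= big_nat [RHS]big_nat.
apply: eq_bigr => r rb; rewrite csum_rev_cat addnAC.
have rd2 : (r.*2 < d)%N by move: rb hd; rewrite uphalf_half; lia.
rewrite cls_f ?(ltnW rd2)// cls_r; [|lia|lia].
rewrite addnAC [(F _ + F _)%N]addnC; congr (_ + _)%N.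
rewrite (residue_class_cons e (d - r)) (residue_class_cons e r).
by case: (ltnP (d - r) e); case: (ltnP r e) => //= _ _; exact: gl.
Qed.

End mirrored_paths.

(** * The paths attached to the three families of groups *)

Section weyl_paths.
Context {R : realType}.
Implicit Types (z : nat -> R) (t : weyl_type) (n d : nat).

(* The signed indices -n, ..., n split into arithmetic progressions of step [d];
   modulo the global sign these are disjoint paths, [Y i = - Z i] being used for
   the indices which are met on the negative side. In type B the root joining
   the index 0 to [d], in type D the root joining -1 to [d + 1], is left out. *)
Definition weyl_paths t n d : seq (seq nat) :=
  match t with
  | WeylS => [seq residue_class d n.+1 r | r <- iota 1 d]
  | WeylB => mirrored_paths d 1 n.+1
  | WeylD => [seq map succn p | p <- mirrored_paths d 0 n]
  end.

Definition weyl_sign t d (i : nat) : bool :=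
  match t with
  | WeylS => false
  | WeylB => reflected d i
  | WeylD => reflected d i.-1
  end.

Definition signed (sg : nat -> bool) z (i : nat) : R :=
  if sg i then - z i else z i.

Definition path_descents t n d z : nat :=
  (\sum_(p <- weyl_paths t n d)
    descents (fun x y : R => (x < y)%R) (map (signed (weyl_sign t d) z) p))%N.

Definition path_edges t n d : nat := (\sum_(p <- weyl_paths t n d) (size p).-1)%N.

Lemma perm_weyl_paths t n d : (0 < d)%N ->
  perm_eq (iota 1 n) (flatten (weyl_paths t n d)).
Proof.
move=> d0; have E : iota 1 n = index_iota 1 n.+1 by rewrite /index_iota subSS subn0.
case: t; rewrite /weyl_paths.
- by rewrite E; exact: perm_residue_classes.
- by rewrite E; exact: perm_mirrored_paths.
- rewrite -map_flatten -[1%N]addn0 iotaDl; apply: perm_map.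
  have := perm_mirrored_paths d0 (lo := 0) n isT.
  by rewrite /index_iota subn0.
Qed.

(** A reflected class is traversed backwards and with opposite signs; the two reversals
    compensate. *)
Lemma descents_mirrored_paths z n d lo e : (0 < d)%N -> (lo <= 1)%N ->
  (\sum_(p <- mirrored_paths d lo e)
     descents (fun x y : R => (x < y)%R) (map (signed (reflected d) z) p) =
   \sum_(lo <= i < e - d) (z (i + d)%N < z i)%R +
   \sum_(1 <= i < uphalf d | (i < e) && (d - i < e)) (z (d - i)%N < - z i)%R)%N.
Proof.
move=> d0 lo1.
under eq_bigr => p _ do rewrite csum_descents.
apply: csum_mirrored_paths => // i.
- move=> ri; rewrite /signed {1}/reflected modnDr -/(reflected d i).
  by rewrite (negbTE ri).
- move=> ri; rewrite /signed {2}/reflected modnDr -/(reflected d i).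
  by rewrite ri ltrN2.
- move=> ib; have hd := odd_double_half d.
  have i2 : (i.*2 < d)%N by move: ib hd; rewrite uphalf_half; lia.
  rewrite /signed /reflected !modn_small; [|lia|lia].
  have -> : (d < i.*2)%N = false by lia.
  have -> : (d < (d - i).*2)%N by lia.
  by rewrite ltrNr.
Qed.

Let shift_range n d (F : nat -> nat) : (0 < d)%N ->
  (\sum_(1 <= i < (n - d).+1) F i = \sum_(1 <= i < n.+1 - d) F i)%N.
Proof.
move=> d0; have [dn|nd] := leqP d n; first by rewrite subSn.
by rewrite !big_geq//; lia.
Qed.

(** The slack is the indicator of the root left out of the paths: [z d < 0] in type B, the term i =
    1 in type D, whose two indices 1 and d + 1 are already joined by an edge. *)
Lemma Xdes_path_descents t n d z : (0 < d)%N ->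
  (path_descents t n d z)%:R <= Xdes t n d z <= (path_descents t n d z)%:R + 1.
Proof.
move=> d0; rewrite /path_descents /Xdes; case: t; rewrite /weyl_paths /weyl_sign.
- rewrite big_map (eq_bigr (fun r => \sum_(0 <= j < class_size d (n.+1 - d) r)
     (z (r + j * d + d)%N < z (r + j * d)%N)%R)%N); last first.
    by move=> r _; rewrite csum_descents csum_residue_class.
  rewrite -(sum_residue_classes d0 (fun i => (z (i + d)%N < z i)%R : nat)).
  by rewrite -[X in _ <= X <= _]natr_sum shift_range// lexx lerDl ler01.
- rewrite (descents_mirrored_paths z n (lo := 1) n.+1 d0)//.
  rewrite -!natr_sum shift_range// natrD.
  have -> : (\sum_(1 <= i < uphalf d | (i <= n) && (d - i <= n)) (z (d - i)%N < - z i)%R =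
    \sum_(1 <= i < uphalf d | (i < n.+1) && (d - i < n.+1)) (z (d - i)%N < - z i)%R)%N.
    by [].
  rewrite lerDl lerD2l.
  by case: ifP => _; [case: (z d < 0)%R|]; rewrite ?lexx ?ler01.
- rewrite big_map.
  have -> : (\sum_(p <- mirrored_paths d 0 n)
     descents (fun x y : R => (x < y)%R)
       (map (signed (fun i => reflected d i.-1) z) (map succn p)) =
    \sum_(p <- mirrored_paths d 0 n)
     descents (fun x y : R => (x < y)%R)
       (map (signed (reflected d) (fun i => z i.+1)) p))%N.
    by apply: eq_bigr => p _; rewrite -map_comp.
  rewrite (descents_mirrored_paths (fun i => z i.+1) n (lo := 0) n d0)//.
  rewrite -!natr_sum natrD.
  have -> : (\sum_(1 <= i < (n - d).+1) (z (i + d)%N < z i)%R =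
     \sum_(0 <= i < n - d) (z (i + d).+1 < z i.+1)%R)%N.
    by rewrite big_add1.
  rewrite -!addrA lerD2l lerD2l.
  (* After the indices are lowered by one, i and d + 2 - i become i and d - i as in type B; the term
     i = 0 is then split off. *)
  have -> : (\sum_(1 <= i < (uphalf d).+1 | (i <= n) && (d + 2 - i <= n))
        (z (d + 2 - i)%N < - z i)%R =
     \sum_(0 <= i < uphalf d | (i < n) && (d - i < n))
        (z (d - i).+1 < - z i.+1)%R)%N.
    rewrite big_add1/= big_nat_cond [RHS]big_nat_cond.
    have hd := odd_double_half d.
    apply: eq_big => [i|i /andP[/andP[_ ib] _]].
      case: (ltnP i (uphalf d)) => ib//; rewrite !andbT.
      have -> : (d + 2 - i.+1 = (d - i).+1)%N by move: ib hd; rewrite uphalf_half; lia.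
      by [].
    by have -> : (d + 2 - i.+1 = (d - i).+1)%N by move: ib hd; rewrite uphalf_half; lia.
  have q1 : (0 < uphalf d)%N by rewrite uphalf_gt0.
  rewrite (big_ltn_cond q1).
  set B := (\sum_(1 <= i < _ | _) _)%N.
  case: ifP => _; last by rewrite lexx lerDl ler01.
  by rewrite natrD lerDr [X in _ && (X <= _)]addrC lerD2l; case: (_ < _)%R;
    rewrite ?lexx ?ler01.
Qed.

Lemma Nroots_path_edges t n d : (0 < d)%N ->
  (Nroots t n d <= (path_edges t n d).+1)%N.
Proof.
move=> d0; rewrite /path_edges /Nroots; case: t; rewrite /weyl_paths.
- rewrite shift_range// (sum_residue_classes d0) big_map.
  apply: leqW; rewrite leq_eqVlt; apply/orP; left; apply/eqP.
  by apply: eq_bigr => r _; rewrite -csum_size csum_residue_class.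
- under [X in (_ <= X.+1)%N]eq_bigr => p _ do rewrite -csum_size.
  rewrite (csum_mirrored_paths d0 (f := fun=> 1%N) (l := fun=> 1%N))//.
  by rewrite shift_range// -[X in (_ <= X)%N]addn1 leq_add2l; case: ifP.
- rewrite big_map.
  under [X in (_ <= X.+1)%N]eq_bigr => p _ do rewrite size_map -csum_size.
  rewrite (csum_mirrored_paths d0 (f := fun=> 1%N) (l := fun=> 1%N))//.
  have -> : (\sum_(1 <= i < (n - d).+1) 1 = \sum_(0 <= i < n - d) 1)%N.
    by rewrite big_add1.
  rewrite -addnS leq_add2l big_add1/=.
  have hd := odd_double_half d.
  have q1 : (0 < uphalf d)%N by rewrite uphalf_gt0.
  rewrite (big_ltn_cond q1)/=.
  have -> : (\sum_(1 <= i < uphalf d | (i < n) && (d + 2 - i.+1 <= n)) 1 =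
    \sum_(1 <= i < uphalf d | (i < n) && (d - i < n)) 1)%N.
    rewrite big_nat_cond [RHS]big_nat_cond; apply: eq_bigl => i.
    case: (ltnP i (uphalf d)) => ib; last by rewrite andbF.
    by have -> : (d + 2 - i.+1 = (d - i).+1)%N by move: ib hd; rewrite uphalf_half; lia.
  by case: ifP.
Qed.

Lemma path_edges_le t n d : (0 < d)%N -> (path_edges t n d <= n)%N.
Proof.
move=> d0; have := perm_size (perm_weyl_paths t n d0).
rewrite size_iota size_flatten sumnE big_map => nE; rewrite [leqRHS]nE.
by apply: leq_sum => p _; exact: leq_pred.
Qed.

(** This bounds the variance from below by the number of edges, hence of roots. *)
Lemma path_edges_le_steps t n d :
  (path_edges t n d <= forest_steps (weyl_paths t n d))%N.
Proof.
apply: leq_sum => p _; rewrite /path_steps; case: (size p) => [|[|k]]//=.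
by rewrite ltnS leqW// leqW.
Qed.

End weyl_paths.

(** * Bounded random variables and discretization of the uniform variables *)

Section bounded_functions.
Context {R : realType} {d : measure_display} {T : measurableType d}
  (P : probability T R).
Implicit Types X Y : T -> R.

(** All variables met below are bounded; integrability is then automatic and stable under sums and
    products. *)
Definition bounded_rv X : Prop :=
  measurable_fun [set: T] X /\ exists B, forall w, `|X w| <= B.

Definition mean X : R := (\int[P]_w X w)%R.

Lemma bounded_rv_integrable X : bounded_rv X -> P.-integrable [set: T] (EFin \o X).
Proof.
move=> [mX [B XB]]; apply: measurable_bounded_integrable => //.
  by rewrite (le_lt_trans (probability_le1 P measurableT))// ltry.
by exists B; split; [rewrite num_real | move=> x Bx w _; exact: (le_trans (XB w) (ltW Bx))].
Qed.

Lemma bounded_rv_cst c : bounded_rv (fun=> c).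
Proof. by split; [exact: measurable_cst|exists `|c|]. Qed.

Lemma bounded_rvD X Y : bounded_rv X -> bounded_rv Y -> bounded_rv (fun w => X w + Y w).
Proof.
move=> [mX [A XA]] [mY [B YB]]; split; first exact: measurable_funD.
by exists (A + B) => w; rewrite (le_trans (ler_normD _ _))// lerD.
Qed.

Lemma bounded_rvM X Y : bounded_rv X -> bounded_rv Y -> bounded_rv (fun w => X w * Y w).
Proof.
move=> [mX [A XA]] [mY [B YB]]; split; first exact: measurable_funM.
by exists (A * B) => w; rewrite normrM ler_pM.
Qed.

Lemma bounded_rvZ c X : bounded_rv X -> bounded_rv (fun w => c * X w).
Proof. exact/bounded_rvM/bounded_rv_cst. Qed.

Lemma bounded_rvX X n : bounded_rv X -> bounded_rv (fun w => X w ^+ n).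
Proof.
move=> bX; elim: n => [|n IH]; first exact: bounded_rv_cst.
have -> : (fun w => X w ^+ n.+1) = (fun w => X w * X w ^+ n).
  by apply/funext => w; rewrite exprS.
exact: bounded_rvM.
Qed.

Lemma bounded_rv_sum (I : Type) (s : seq I) (X : I -> T -> R) :
  (forall i, bounded_rv (X i)) -> bounded_rv (fun w => \sum_(i <- s) X i w).
Proof.
move=> bX; elim: s => [|i s IH].
  have -> : (fun w => \sum_(i <- [::]) X i w) = (fun=> 0).
    by apply/funext => w; rewrite big_nil.
  exact: bounded_rv_cst.
have -> : (fun w => \sum_(j <- i :: s) X j w) = (fun w => X i w + \sum_(j <- s) X j w).
  by apply/funext => w; rewrite big_cons.
exact: bounded_rvD.
Qed.

Lemma bounded_rv_indic (A : set T) : measurable A -> bounded_rv (\1_A : T -> R).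
Proof.
move=> mA; split; first exact: measurable_indic.
by exists 1 => w; rewrite indicE ger0_norm// lern1 leq_b1.
Qed.

Lemma meanD X Y : bounded_rv X -> bounded_rv Y ->
  mean (fun w => X w + Y w) = mean X + mean Y.
Proof.
by move=> /bounded_rv_integrable iX /bounded_rv_integrable iY; exact: RintegralD.
Qed.

Lemma meanZ c X : bounded_rv X -> mean (fun w => c * X w) = c * mean X.
Proof. by move=> /bounded_rv_integrable iX; exact: RintegralZl. Qed.

Lemma mean_cst c : mean (fun=> c) = c.
Proof.
have P1 : P [set: T] = 1%E := probability_setT P.
by rewrite /mean Rintegral_cst// [X in fine X]P1 mulr1.
Qed.

Lemma le_mean X Y : bounded_rv X -> bounded_rv Y -> (forall w, X w <= Y w) ->
  mean X <= mean Y.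
Proof.
move=> /bounded_rv_integrable iX /bounded_rv_integrable iY XY.
by apply: le_Rintegral => // w _; exact: XY.
Qed.

Lemma mean_indic (A : set T) : measurable A -> mean (\1_A : T -> R) = fine (P A).
Proof. by move=> mA; rewrite /mean /Rintegral integral_indic// setIT. Qed.

Lemma mean_sum (I : Type) (s : seq I) (X : I -> T -> R) :
  (forall i, bounded_rv (X i)) ->
  mean (fun w => \sum_(i <- s) X i w) = \sum_(i <- s) mean (X i).
Proof.
move=> bX; elim: s => [|i s IH].
  rewrite big_nil -[RHS](mean_cst 0); congr mean.
  by apply/funext => w; rewrite big_nil.
rewrite big_cons -IH -meanD//; last exact: bounded_rv_sum.
by congr mean; apply/funext => w; rewrite big_cons.
Qed.

Lemma fine_expectation X : fine ('E_P[X])%E = mean X.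
Proof. by rewrite unlock. Qed.

Lemma fine_variance X : fine ('V_P[X])%E = mean (fun w => (X w - mean X) ^+ 2).
Proof.
rewrite /variance unlock fine_expectation; congr mean.
by apply/funext => w /=; rewrite fine_expectation expr2.
Qed.

End bounded_functions.

Lemma uniform_prob_itv (R : realType) (a b p q : R) (ab : a < b) (bp bq : bool) :
  a <= p -> p < q -> q <= b ->
  uniform_prob ab [set` Interval (BSide bp p) (BSide bq q)] =
  ((q - p) / (b - a))%:E.
Proof.
move=> ap pq qb; rewrite /uniform_prob (eq_integral (fun=> (b - a)^-1%:E)).
  rewrite integral_cst//= lebesgue_measure_itv/= lte_fin pq.
  by rewrite -EFinD -EFinM mulrC.
move=> x; rewrite inE/= => xI; rewrite /uniform_pdf ifT//.
move: xI; rewrite itv_boundlr => /andP[h1 h2].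
have px : p <= x by move: h1; case: bp => /=; rewrite !bnd_simp => // /ltW.
have xq : x <= q by move: h2; case: bq => /=; rewrite !bnd_simp => // /ltW.
by rewrite (le_trans ap px) (le_trans xq qb).
Qed.

Lemma eq_csum_uniq (g1 g2 : nat -> nat -> nat) p : uniq p ->
  (forall i j, i \in p -> j \in p -> i != j -> g1 i j = g2 i j) ->
  csum g1 p = csum g2 p.
Proof.
case: p => //= x p; elim: p x => //= y p IH x /andP[xp up] H.
rewrite H ?mem_head ?inE ?eqxx ?orbT//; last first.
  by apply: contraNneq xp => ->; rewrite mem_head.
congr (_ + _)%N; apply: IH => // i j ip jp; apply: H; by rewrite inE ?ip ?jp orbT.
Qed.

Lemma uniq_map_inj_in (A B : eqType) (f : A -> B) s i j :
  uniq (map f s) -> i \in s -> j \in s -> i != j -> f i != f j.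
Proof.
elim: s => //= x s IH /andP[xs us]; rewrite !inE.
move=> /predU1P[->|si] /predU1P[->|sj] ij.
- by rewrite eqxx in ij.
- by apply: contraNneq xs => ->; exact: map_f.
- by apply: contraNneq xs => <-; exact: map_f.
- exact: IH.
Qed.

(** Birthday bound: the right-hand side is the probability that [n] independent uniform labels among
    m are pairwise distinct. *)
Lemma ffact_ratio_ge (R : realType) (m' n : nat) :
  1 - n%:R ^+ 2 / m'.+1%:R <= (m'.+1 ^_ n)%:R / (m'.+1 ^ n)%:R :> R.
Proof.
set m := m'.+1.
have m0 : 0 < m%:R :> R by rewrite ltr0n.
elim: n => [|n IH]; first by rewrite ffactn0 expn0 expr0n mul0r subr0 divr1.
rewrite ffactnSr expnSr !natrM.
have [nm|mn] := leqP n m; last first.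
  rewrite (_ : (m - n = 0)%N); last by apply/eqP; rewrite subn_eq0 ltnW.
  rewrite mulr0 mul0r subr_le0 ler_pdivlMr// mul1r -natrX ler_nat.
  by rewrite expnS expn1 (leq_trans (ltnW mn))// (leq_trans (leqnSn n))// leq_pmulr.
have e : (m ^_ n)%:R * (m - n)%:R / ((m ^ n)%:R * m%:R) =
   ((m ^_ n)%:R / (m ^ n)%:R) * (1 - n%:R / m%:R) :> R.
  rewrite natrB//; field; rewrite gt_eqF//= natrX expf_neq0// gt_eqF//.
rewrite e.
have q0 : 0 <= 1 - n%:R / m%:R :> R.
  by rewrite subr_ge0 ler_pdivrMr// mul1r ler_nat.
apply: le_trans (ler_wpM2r q0 IH).
have x0 : 0 <= m%:R^-1 :> R by rewrite invr_ge0 ltW.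
have n0 : 0 <= n%:R :> R by [].
have h : 0 <= (n%:R ^+ 2 / m%:R) * (n%:R / m%:R) :> R.
  by rewrite !mulr_ge0 ?exprn_ge0.
have h2 : 0 <= n%:R / m%:R :> R by rewrite mulr_ge0.
rewrite -natr1.
have -> : (n%:R + 1) ^+ 2 / m%:R = n%:R ^+ 2 / m%:R + 2 * (n%:R / m%:R) + m%:R^-1 :> R.
  by field; rewrite gt_eqF.
lra.
Qed.

Section discretization.
Context {R : realType} {dT : measure_display} {T : measurableType dT}
  (P : probability T R) (Z : nat -> {RV P >-> R}).
Variables (t : weyl_type) (n d m' : nat).
Hypothesis d0 : (0 < d)%N.
Hypothesis hZ : iid_with_law n Z (uniform_prob (Zinf_lt1 R t)).
Local Notation m := (m'.+1).
Local Notation a := (Zinf R t).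
Local Notation sg := (weyl_sign t d).
Local Notation vs := (iota 1 n).
Implicit Types (c : 'I_m) (ys : n.-tuple 'I_m).

Let lc (k : nat) : R := a + (1 - a) * k%:R / m%:R.

Let m0 : 0 < m%:R :> R. Proof. by rewrite ltr0n. Qed.

Let L0 : 0 < 1 - a. Proof. by rewrite subr_gt0 Zinf_lt1. Qed.

Let lc_lt k l : (k < l)%N -> lc k < lc l.
Proof.
by move=> kl; rewrite /lc ltrD2l ltr_pM2r ?invr_gt0// ltr_pM2l// ltr_nat.
Qed.

Let lc_le k l : (k <= l)%N -> lc k <= lc l.
Proof. by rewrite leq_eqVlt => /predU1P[->//|/lc_lt/ltW]. Qed.

Let lc0 : lc 0 = a. Proof. by rewrite /lc mulr0 mul0r addr0. Qed.

Let lcm : lc m = 1. Proof. by rewrite /lc mulfK ?gt_eqF// subrKC. Qed.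

Definition in_cell c (x : R) : bool := lc c <= x < lc c.+1.

Lemma in_cell_lt c1 c2 x1 x2 : in_cell c1 x1 -> in_cell c2 x2 -> c1 != c2 ->
  (x1 < x2) = (c1 < c2)%N.
Proof.
move=> /andP[l1 h1] /andP[l2 h2] c12.
have [lt12|lt21|/val_inj e] := ltngtP c1 c2; last by rewrite e eqxx in c12.
- by rewrite (lt_le_trans h1)// (le_trans _ l2)// lc_le.
- apply/negbTE; rewrite -leNgt.
  by rewrite (le_trans (ltW h2))// (le_trans _ l1)// lc_le.
Qed.

Lemma in_cell_inj c1 c2 x : in_cell c1 x -> in_cell c2 x -> c1 = c2.
Proof.
move=> h1 h2; apply/eqP/negPn/negP => c12.
have := in_cell_lt h1 h2 c12; rewrite ltxx.
have := in_cell_lt h2 h1; rewrite eq_sym c12 ltxx => /(_ isT).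
by case: ltngtP c12 => // /val_inj ->; rewrite eqxx.
Qed.

(** Cells are tested on the signed variable, which is what the paths compare. Signs occur only in
    types B and D, where the law is symmetric, so all these sets have mass 1 / m. *)
Definition signed_cell (i : nat) c : set R :=
  [set x | in_cell c (if sg i then - x else x)].

Lemma signed_cellE i c : signed_cell i c =
  if sg i then [set` Interval (BRight (- lc c.+1)) (BRight (- lc c))]
  else [set` Interval (BLeft (lc c)) (BLeft (lc c.+1))].
Proof.
apply/seteqP; split => x; rewrite /signed_cell /in_cell; case: (sg i) => /=.
- by rewrite in_itv/= lerNr ltrNl andbC.
- by rewrite in_itv.
- by rewrite in_itv/= lerNr ltrNl andbC.
- by rewrite in_itv.
Qed.

Lemma measurable_signed_cell i c : measurable (signed_cell i c).
Proof. by rewrite signed_cellE; case: ifP => _; exact: measurable_itv. Qed.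

Lemma uniform_signed_cell i c :
  uniform_prob (Zinf_lt1 R t) (signed_cell i c) = (m%:R^-1)%:E.
Proof.
have lo : a <= lc c by rewrite -lc0 lc_le.
have hi : lc c.+1 <= 1 by rewrite -lcm lc_le// ltn_ord.
have lh : lc c < lc c.+1 by exact: lc_lt.
have e : (lc c.+1 - lc c) / (1 - a) = m%:R^-1.
  by rewrite /lc -natr1; field; rewrite !gt_eqF.
rewrite signed_cellE; case: ifP => [sgi|_]; last by rewrite uniform_prob_itv// e.
have a1 : a = -1 by move: sgi; rewrite /weyl_sign /Zinf; case: (t).
rewrite uniform_prob_itv; [|lra|lra|lra].
by rewrite -e; congr (_ / _)%:E; ring.
Qed.

Let c0 : nat -> 'I_m := fun=> ord0.

Definition grid_event ys : set T :=
  [set w | forall j, j \in vs -> signed_cell j (assign vs ys c0 j) (Z j w)].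

Lemma grid_event_prob ys : P (grid_event ys) = ((m%:R ^- n)%:E).
Proof.
have [h1 h2] := hZ.
rewrite /grid_event (h1 vs (fun j => signed_cell j (assign vs ys c0 j))).
- rewrite (eq_big_seq (fun=> (m%:R^-1)%:E)).
    rewrite prodEFin big_const_seq count_predT size_iota; congr EFin.
    rewrite -exprVn; elim: (n) => //= k ->.
    by rewrite exprS.
  move=> j; rewrite mem_iota => jn; rewrite h2; last first.
    + exact: measurable_signed_cell.
    + lia.
  exact: uniform_signed_cell.
- exact: iota_uniq.
- by move=> j; rewrite mem_iota; lia.
- by move=> j; exact: measurable_signed_cell.
Qed.

Lemma measurable_grid_event ys : measurable (grid_event ys).
Proof.
have -> : grid_event ys =
    \big[setI/setT]_(j <- vs) (Z j @^-1` signed_cell j (assign vs ys c0 j)).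
  apply/seteqP; split => w.
    by move=> H; rewrite -bigcap_seq => j /= /H.
  by rewrite -bigcap_seq => H j jvs; exact: H.
apply: bigsetI_measurable => j _; rewrite -[X in measurable X]setTI.
by apply: measurable_funP => //; exact: measurable_signed_cell.
Qed.

Lemma grid_event_inj ys1 ys2 w : grid_event ys1 w -> grid_event ys2 w -> ys1 = ys2.
Proof.
move=> h1 h2; apply/val_inj => /=.
rewrite -(@map_assign _ vs ys1 c0) ?iota_uniq ?size_tuple ?size_iota//.
rewrite -[RHS](@map_assign _ vs ys2 c0) ?iota_uniq ?size_tuple ?size_iota//.
apply/eq_in_map => j jvs.
by have := in_cell_inj (h1 j jvs) (h2 j jvs).
Qed.

Definition grid_descents ys : nat :=
  (\sum_(p <- weyl_paths t n d)
    descents (fun i j : 'I_m => i < j)%N (map (assign vs ys c0) p))%N.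

(** With pairwise distinct labels, every comparison of signed values is decided by their cells. *)
Lemma path_descents_grid ys w : uniq ys -> grid_event ys w ->
  path_descents t n d (Z^~ w) = grid_descents ys.
Proof.
move=> uys Ew; rewrite /path_descents /grid_descents.
have pe := perm_weyl_paths t n d0.
apply: eq_big_seq => p pp; rewrite !csum_descents.
have upp : uniq p.
  have : uniq (flatten (weyl_paths t n d)) by rewrite -(perm_uniq pe) iota_uniq.
  elim: (weyl_paths t n d) pp => //= q qs IH; rewrite inE cat_uniq.
  by case/predU1P => [-> /and3P[]|/IH H /and3P[_ _ /H]].
have pvs i : i \in p -> i \in vs.
  by move=> ip; rewrite (perm_mem pe); apply/flattenP; exists p.
apply: eq_csum_uniq => // i j ip jp ij; congr nat_of_bool.
apply: in_cell_lt; [exact: Ew (pvs _ jp)|exact: Ew (pvs _ ip)|].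
apply: (@uniq_map_inj_in _ _ _ vs); [|exact: pvs|exact: pvs|by rewrite eq_sym].
by rewrite map_assign ?iota_uniq ?size_tuple ?size_iota.
Qed.

Lemma path_descents_le z : (path_descents (R := R) t n d z <= path_edges t n d)%N.
Proof.
apply: leq_sum => p _; rewrite csum_descents -csum_size.
case: p => //= x p; elim: p x => //= y p IH x.
by rewrite leq_add// leq_b1.
Qed.

Lemma grid_descents_le ys : (grid_descents ys <= path_edges t n d)%N.
Proof.
apply: leq_sum => p _; rewrite csum_descents -csum_size.
case: p => //= x p; elim: p x => //= y p IH x.
by rewrite leq_add// leq_b1.
Qed.

Lemma measurable_path_descents :
  measurable_fun [set: T] (fun w => path_descents t n d (Z^~ w)).
Proof.
have mY i : measurable_fun [set: T] (fun w => signed sg (Z^~ w) i).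
  by rewrite /signed; case: (sg i) => //; exact: measurable_funN.
rewrite /path_descents; elim: (weyl_paths t n d) => [|p ps IH].
  by under eq_fun do rewrite big_nil; exact: measurable_cst.
under eq_fun do rewrite big_cons csum_descents.
apply: measurable_fun_addn => //.
case: p => [|x p] /=; first exact: measurable_cst.
elim: p x => [|y p IHp] x /=; first exact: measurable_cst.
apply: measurable_fun_addn => //.
exact: (measurableT_comp _ (measurable_fun_ltr (mY y) (mY x))).
Qed.

Lemma bounded_rv_path_descents (g : nat -> R) :
  bounded_rv (fun w => g (path_descents t n d (Z^~ w))).
Proof.
split; first exact: (measurableT_comp _ measurable_path_descents).
exists (\sum_(k < (path_edges t n d).+1) `|g k|) => w.
have kP : (path_descents t n d (Z^~ w) < (path_edges t n d).+1)%N.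
  by rewrite ltnS path_descents_le.
by rewrite (bigD1 (Ordinal kP))//= lerDl sumr_ge0.
Qed.

(** In the proof [F] reads the labels instead of the variables and [U] is the indicator that labels
    exist and are distinct. The two counts agree on that event, whose probability is at least the
    birthday bound. *)
Lemma discretization_bound (g : nat -> R) (B : R) :
  (forall k, (k <= path_edges t n d)%N -> `|g k| <= B) ->
  `|mean P (fun w => g (path_descents t n d (Z^~ w))) -
    avg (fun ys => g (grid_descents ys))| <= 2 * B * (n%:R ^+ 2 / m%:R).
Proof.
move=> gB.
have B0 : 0 <= B by rewrite (le_trans _ (gB 0%N _)).
pose X w := g (path_descents t n d (Z^~ w)).
have bX : bounded_rv X by exact: bounded_rv_path_descents.
pose F w : R := \sum_(ys : n.-tuple 'I_m) g (grid_descents ys) * \1_(grid_event ys) w.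
pose U w : R := \sum_(ys : n.-tuple 'I_m) (uniq ys)%:R * \1_(grid_event ys) w.
have bE ys : bounded_rv (\1_(grid_event ys) : T -> R).
  exact/bounded_rv_indic/measurable_grid_event.
have bF : bounded_rv F by apply: bounded_rv_sum => ys; exact: bounded_rvZ.
have bU : bounded_rv U by apply: bounded_rv_sum => ys; exact: bounded_rvZ.
have mE ys : mean P (\1_(grid_event ys)) = m%:R ^- n.
  by rewrite mean_indic ?grid_event_prob//; exact: measurable_grid_event.
have mF : mean P F = avg (fun ys => g (grid_descents ys)).
  rewrite mean_sum; last by move=> ys; exact: bounded_rvZ.
  rewrite /avg card_tuple card_ord natrX mulr_suml; apply: eq_bigr => ys _.
  by rewrite meanZ// mE.
have mU : 1 - n%:R ^+ 2 / m%:R <= mean P U.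
  apply: le_trans (ffact_ratio_ge R m' n) _.
  rewrite mean_sum; last by move=> ys; exact: bounded_rvZ.
  have -> : (m ^_ n)%:R / (m ^ n)%:R =
      \sum_(ys : n.-tuple 'I_m) (uniq ys)%:R * m%:R ^- n :> R.
    rewrite -mulr_suml natrX; congr (_ / _).
    rewrite -natr_sum; congr (_%:R).
    have := card_uniq_tuples n (predT : pred 'I_m).
    rewrite [#|predT|]card_ord => <-.
    rewrite -sum1_card big_mkcond/=; apply: eq_bigr => ys _.
    by rewrite inE all_predT /=; case: uniq.
  by rewrite le_eqVlt; apply/orP; left; apply/eqP; apply: eq_bigr => ys _;
    rewrite meanZ// mE.
have only ys w : grid_event ys w ->
    forall (f : n.-tuple 'I_m -> R), \sum_(zs : n.-tuple 'I_m) f zs * \1_(grid_event zs) w = f ys.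
  move=> Ew f; rewrite (bigD1 ys)//= indicE mem_set// mulr1 big1 ?addr0// => zs zy.
  rewrite indicE memNset ?mulr0// => Ezs.
  by move: zy; rewrite (grid_event_inj Ew Ezs) eqxx.
have key w : `|X w - F w| <= 2 * B * (1 - U w).
  have XB : `|X w| <= B by apply: gB; exact: path_descents_le.
  (* The half-open cells may miss an endpoint; such outcomes have U = 0 and are charged to 1 - U. *)
  have [[ys Ew]|noE] := pselect (exists ys, grid_event ys w).
    rewrite /F /U !(only ys)//.
    have [uys|_] := boolP (uniq ys).
      by rewrite /X (path_descents_grid uys Ew) !subrr normr0 mulr0.
    rewrite subr0 mulr1 (le_trans (ler_normB _ _))// (_ : 2 * B = B + B); last by ring.
    by rewrite lerD// gB// grid_descents_le.
  have out (f : n.-tuple 'I_m -> R) : \sum_(zs : n.-tuple 'I_m) f zs * \1_(grid_event zs) w = 0.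
    apply: big1 => zs _; rewrite indicE memNset ?mulr0// => Ew; apply: noE.
    by exists zs.
  by rewrite /F /U !out !subr0 mulr1 (le_trans XB)//; lra.
have up : mean P X <= mean P (fun w => F w + (2 * B + (- (2 * B)) * U w)).
  apply: le_mean => //.
    apply: bounded_rvD => //; apply: bounded_rvD; first exact: bounded_rv_cst.
    exact: bounded_rvZ.
  by move=> w; have := ler_norm (X w - F w); have := key w; lra.
have dn : mean P (fun w => F w + (- (2 * B) + (2 * B) * U w)) <= mean P X.
  apply: le_mean => //.
    apply: bounded_rvD => //; apply: bounded_rvD; first exact: bounded_rv_cst.
    exact: bounded_rvZ.
  by move=> w; have := lerNnormlW (key w); lra.
move: up dn; rewrite !meanD ?meanZ ?mean_cst//;
  try by [exact: bounded_rv_cst | exact: bounded_rvZ |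
    apply: bounded_rvD; [exact: bounded_rv_cst | exact: bounded_rvZ]].
rewrite mF -/X => up dn.
have := ler_wpM2l (mulr_ge0 (ler0n R 2) B0) mU.
set q := n%:R ^+ 2 / m%:R; rewrite ler_norml.
move: up dn; move: (mean P X) (avg _) (mean P U) q => x y u q.
by rewrite mulNr mulrBr mulr1; move: (2 * B * u) (2 * B) (2 * B * q) => e f h; lra.
Qed.

End discretization.

Lemma dist_le_of_sqr (R : realType) (x y c : R) : 0 <= x -> 0 < y ->
  `|x ^+ 2 - y ^+ 2| <= c * y -> `|x - y| <= c.
Proof.
move=> x0 y0; rewrite subr_sqr normrM [`|x + y|]ger0_norm ?addr_ge0 ?(ltW y0)// => h.
rewrite -(ler_pM2r y0); apply: le_trans h.
by rewrite ler_wpM2l// lerDr.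
Qed.

(** * Mean, variance and tails of [Xdes] *)

Section Xdes_law.
Context {R : realType} {dT : measure_display} {T : measurableType dT}
  (P : probability T R) (Z : nat -> {RV P >-> R}).
Variables (t : weyl_type) (n d : nat).
Hypothesis d0 : (0 < d)%N.
Hypothesis hZ : iid_with_law n Z (uniform_prob (Zinf_lt1 R t)).

Let V w : R := Xdes t n d (fun i => Z i w).
Let V' w : R := (path_descents t n d (Z^~ w))%:R.

Lemma bounded_rv_Xdes : bounded_rv V.
Proof.
have mlt (f g : T -> R) : measurable_fun [set: T] f -> measurable_fun [set: T] g ->
    measurable_fun [set: T] (fun w => (f w < g w)%R%:R : R).
  move=> mf mg.
  by apply: (measurableT_comp (f := fun b : bool => b%:R : R) _ (measurable_fun_ltr mf mg)).
have mb i j : measurable_fun [set: T] (fun w => (Z j w < Z i w)%R%:R : R).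
  exact: mlt.
have mbN i j : measurable_fun [set: T] (fun w => (Z j w < - Z i w)%R%:R : R).
  by apply: mlt => //; exact: measurable_funN.
have mS (s : seq nat) (Q : pred nat) (h : nat -> T -> R) :
   (forall i, measurable_fun [set: T] (h i)) ->
   measurable_fun [set: T] (fun w => \sum_(i <- s | Q i) h i w).
  move=> mh; under eq_fun do rewrite -big_filter.
  exact: measurable_sum.
split.
  rewrite /V /Xdes; case: (t).
  - exact: mS.
  - apply: measurable_funD; first apply: measurable_funD.
    + exact: mS.
    + exact: mS.
    + case: (leqP d n) => _; last exact: measurable_cst.
      by apply: mlt => //; exact: measurable_cst.
  - by apply: measurable_funD; exact: mS.
exists ((path_edges t n d)%:R + 1) => w.
have /andP[h1 h2] := Xdes_path_descents t n (Z^~ w) d0.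
have h3 : (path_descents t n d (Z^~ w))%:R <= (path_edges t n d)%:R :> R.
  by rewrite ler_nat path_descents_le.
rewrite ger0_norm; first by rewrite (le_trans h2)// lerD2r.
by rewrite (le_trans _ h1).
Qed.

Let VV' w : V' w <= V w <= V' w + 1.
Proof. exact: Xdes_path_descents. Qed.

Variable m' : nat.
Hypothesis m1 : (n.+1 ^ 4 <= m'.+1)%N.
Hypothesis m2 : (2 <= m'.+1)%N.

Let N := path_edges t n d.
Let mu : R := N%:R * residue_mean m'.
Let S (ys : n.-tuple 'I_m'.+1) : R := (grid_descents t d ys)%:R - mu.
Let v : R := residue_var m'.
Let w := forest_steps (weyl_paths t n d).
Let sigma' : R := Num.sqrt (w%:R * v).

Lemma martingale_end_grid : martingale_end v w S.
Proof.
have pe := perm_weyl_paths t n d0.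
have := @martingale_end_forest R m' n (iota 1 n) (weyl_paths t n d)
  (fun=> ord0) (iota_uniq _ _) (size_iota _ _).
rewrite -(perm_uniq pe) iota_uniq => /(_ isT) [|J0 H].
  by move=> i; rewrite (perm_mem pe).
split=> // G SG; have := H G SG; congr (_ <= _); apply: eq_avg => ys; congr G.
rewrite /S /mu /grid_descents /path_dev sumrB natr_sum; congr (_ - _).
by rewrite -mulr_suml -natr_sum.
Qed.

Let v0 : 0 <= v. Proof. exact: residue_var_ge0. Qed.

Let sigma2 : sigma' ^+ 2 = w%:R * v.
Proof. by rewrite sqr_sqrtr// mulr_ge0. Qed.

(** The fourth power in [m1] leaves (n + 1)^-2, enough to absorb the square of a deviation bounded
    by n + 1. *)
Let nm : n%:R ^+ 2 / m'.+1%:R <= (n.+1%:R ^+ 2)^-1 :> R.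
Proof.
have h0 : 0 < n.+1%:R ^+ 2 :> R by rewrite exprn_gt0.
rewrite ler_pdivrMr// ler_pdivlMl// -!natrX -natrM ler_nat (leq_trans _ m1)//.
by rewrite (expnD _ 2 2) leq_mul// leq_sqr.
Qed.

Let Nn : (N <= n)%N. Proof. exact: path_edges_le. Qed.

Let mu0 : 0 <= mu <= N%:R.
Proof.
have r0 : 0 <= residue_mean m' :> R by rewrite divr_ge0.
have r1 : residue_mean m' <= 1 :> R.
  rewrite /residue_mean ler_pdivrMr// mul1r -natrM ler_nat; lia.
by rewrite mulr_ge0//= ler_piMr.
Qed.

Let dev_bound k : (k <= N)%N -> `|k%:R - mu| <= n.+1%:R :> R.
Proof.
move=> kN; have kN' : k%:R <= n%:R :> R by rewrite ler_nat (leq_trans kN).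
have Nn' : N%:R <= n%:R :> R by rewrite ler_nat.
have k0 : 0 <= k%:R :> R by [].
by have := natr1 n : n%:R + 1 = n.+1%:R :> R; move: mu0 => /andP[]; rewrite ler_norml; lra.
Qed.

Let bV' : bounded_rv V'.
Proof. exact: (bounded_rv_path_descents Z t n d (fun k => k%:R : R)). Qed.

(** Discretization accounts for 2, the indicator left out of the paths for 1. *)
Lemma mean_Xdes : `|mean P V - mu| <= 3.
Proof.
have n0 : 1 <= n.+1%:R :> R by rewrite ler1n.
have := discretization_bound m' d0 hZ (g := fun k => k%:R - mu) dev_bound.
have -> : avg (fun ys : n.-tuple 'I_m'.+1 => (grid_descents t d ys)%:R - mu) = 0 :> R.
  exact: martingale_end_mean martingale_end_grid.
rewrite subr0 (meanD P (X := V') (Y := fun=> - mu))//; last exact: bounded_rv_cst.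
rewrite mean_cst => h.
have h2 : 2 * n.+1%:R * (n%:R ^+ 2 / m'.+1%:R) <= 2 :> R.
  rewrite -mulrA ler_piMr// (le_trans (ler_wpM2l (ler0n R n.+1) nm))//.
  rewrite ler_pdivrMr ?exprn_gt0// mul1r expr2 ler_pMr//.
have lo : mean P V' <= mean P V.
  by apply: le_mean => //; [exact: bounded_rv_Xdes|move=> x; case/andP: (VV' x)].
have hi : mean P V <= mean P (fun x => V' x + 1).
  apply: le_mean => //; [exact: bounded_rv_Xdes| |move=> x; case/andP: (VV' x)] => //.
  by apply: bounded_rvD => //; exact: bounded_rv_cst.
rewrite meanD// in hi; last exact: bounded_rv_cst.
rewrite mean_cst in hi; move: h h2 lo hi; set q := 2 * n.+1%:R * _.
rewrite !ler_norml; lra.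
Qed.

Let square_V' : `|mean P (fun x => (V' x - mu) ^+ 2) - sigma' ^+ 2| <= 2.
Proof.
have n0 : 0 < n.+1%:R :> R by rewrite ltr0n.
have B k : (k <= N)%N -> `|(k%:R - mu) ^+ 2| <= n.+1%:R ^+ 2 :> R.
  by move=> kN; rewrite normrX lerXn2r ?nnegrE// dev_bound.
have := discretization_bound m' d0 hZ (g := fun k => (k%:R - mu) ^+ 2) B.
have -> : avg (fun ys : n.-tuple 'I_m'.+1 => ((grid_descents t d ys)%:R - mu) ^+ 2) =
    w%:R * v :> R.
  exact: martingale_end_square martingale_end_grid.
rewrite -sigma2 => /le_trans; apply.
rewrite -mulrA ler_piMr// (le_trans (ler_wpM2l (exprn_ge0 2 (ltW n0)) nm))//.
by rewrite mulfV// gt_eqF// exprn_gt0.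
Qed.

(** V = V' + e with 0 <= e <= 1: Young's inequality with weight 1 / sigma' shows that [e] moves the
    second moment by O(sigma') only, which is a bounded change of the standard deviation. *)
Lemma sd_Xdes : 1 <= sigma' -> `|Num.sqrt (fine ('V_P[V])%E) - sigma'| <= 15.
Proof.
move=> s1; have s0 : 0 < sigma' by exact: lt_le_trans s1.
pose q := mean P (fun x => (V x - mu) ^+ 2).
have bV := bounded_rv_Xdes.
have bVc c : bounded_rv (fun x => V x - c) by apply: bounded_rvD => //; exact: bounded_rv_cst.
have bV'2 : bounded_rv (fun x => (V' x - mu) ^+ 2).
  by apply: bounded_rvX; apply: bounded_rvD => //; exact: bounded_rv_cst.
have var : fine ('V_P[V])%E = q - (mean P V - mu) ^+ 2.
  rewrite fine_variance /q.
  have -> : (fun x => (V x - mean P V) ^+ 2) =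
     (fun x => (V x - mu) ^+ 2 + (- (2 * (mean P V - mu)) * (V x - mu) + (mean P V - mu) ^+ 2)).
    by apply/funext => x; ring.
  have mVmu : mean P (fun x => V x - mu) = mean P V - mu.
    by rewrite meanD ?mean_cst//; exact: bounded_rv_cst.
  rewrite (meanD P (X := fun x => (V x - mu) ^+ 2)).
  - rewrite (meanD P (X := fun x => - (2 * (mean P V - mu)) * (V x - mu))).
    + by rewrite meanZ// mVmu mean_cst; ring.
    + exact: bounded_rvZ.
    + exact: bounded_rv_cst.
  - exact: bounded_rvX.
  - by apply: bounded_rvD; [exact: bounded_rvZ|exact: bounded_rv_cst].
have si0 : 0 < sigma'^-1 by rewrite invr_gt0.
have si1 : sigma'^-1 <= 1 by rewrite invf_le1.
have qle : q <= (1 + sigma'^-1) * mean P (fun x => (V' x - mu) ^+ 2) + (1 + sigma').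
  rewrite -(mean_cst P (1 + sigma')) -meanZ// -meanD//; [|exact: bounded_rvZ|exact: bounded_rv_cst].
  apply: le_mean; [exact: bounded_rvX|by apply: bounded_rvD; [exact: bounded_rvZ|exact: bounded_rv_cst]|].
  move=> x; have /andP[h1 h2] := VV' x.
  pose y := V' x - mu; pose e := V x - V' x.
  have e0 : 0 <= e <= 1 by rewrite /e; lra.
  have -> : V x - mu = y + e by rewrite /y /e; ring.
  rewrite -/y -subr_ge0.
  have -> : (1 + sigma'^-1) * y ^+ 2 + (1 + sigma') - (y + e) ^+ 2 =
    sigma'^-1 * (y - sigma' * e) ^+ 2 + (1 + sigma') * (1 - e ^+ 2).
    by field; rewrite gt_eqF.
  rewrite addr_ge0// mulr_ge0 ?sqr_ge0 ?(ltW si0)//; first by lra.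
  by rewrite subr_ge0 exprn_ile1//; lra.
have qge : (1 - sigma'^-1) * mean P (fun x => (V' x - mu) ^+ 2) - sigma' <= q.
  rewrite -(mean_cst P (- sigma')) -meanZ// -meanD//; [|exact: bounded_rvZ|exact: bounded_rv_cst].
  apply: le_mean; [by apply: bounded_rvD; [exact: bounded_rvZ|exact: bounded_rv_cst]|exact: bounded_rvX|].
  move=> x; have /andP[h1 h2] := VV' x.
  pose y := V' x - mu; pose e := V x - V' x.
  have e0 : 0 <= e <= 1 by rewrite /e; lra.
  have -> : V x - mu = y + e by rewrite /y /e; ring.
  rewrite -/y -subr_ge0.
  have -> : (y + e) ^+ 2 - ((1 - sigma'^-1) * y ^+ 2 - sigma') =
    sigma'^-1 * (y + sigma' * e) ^+ 2 + sigma' * (1 - e ^+ 2) + e ^+ 2.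
    by field; rewrite gt_eqF.
  rewrite !addr_ge0 ?sqr_ge0// mulr_ge0 ?sqr_ge0 ?(ltW si0) ?(ltW s0)//.
  by rewrite subr_ge0 exprn_ile1//; lra.
(* The variance lies between sigma'^2 - 2 sigma' - 13 and sigma'^2 + 2 sigma' + 5, hence within 15
   sigma' of sigma'^2 since sigma' >= 1. *)
apply: dist_le_of_sqr => //.
have mV := mean_Xdes; have sV := square_V'.
pose r := mean P (fun x => (V' x - mu) ^+ 2) - sigma' ^+ 2.
have r2 : `|r| <= 2 by exact: sV.
have qle' : q <= sigma' ^+ 2 + 2 * sigma' + 5.
  apply: (le_trans qle).
  have -> : (1 + sigma'^-1) * mean P (fun x => (V' x - mu) ^+ 2) =
     sigma' ^+ 2 + sigma' + (1 + sigma'^-1) * r by rewrite /r; field; rewrite gt_eqF.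
  have : (1 + sigma'^-1) * r <= (1 + 1) * 2.
    apply: (le_trans (ler_norm _)); rewrite normrM ler_pM// ger0_norm; lra.
  lra.
have qge' : sigma' ^+ 2 - 2 * sigma' - 4 <= q.
  apply: le_trans qge.
  have -> : (1 - sigma'^-1) * mean P (fun x => (V' x - mu) ^+ 2) =
     sigma' ^+ 2 - sigma' + (1 - sigma'^-1) * r by rewrite /r; field; rewrite gt_eqF.
  have : `|(1 - sigma'^-1) * r| <= 1 * 2.
    rewrite normrM ler_pM// ger0_norm; lra.
  by rewrite ler_norml; lra.
have d2 : 0 <= (mean P V - mu) ^+ 2 <= 9.
  rewrite sqr_ge0/= -real_normK ?num_real// (_ : 9 = 3 ^+ 2); last by ring.
  by rewrite lerXn2r ?nnegrE.
have var0 : 0 <= fine ('V_P[V])%E.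
  rewrite fine_variance -(mean_cst P 0); apply: le_mean; [exact: bounded_rv_cst|exact: bounded_rvX|].
  by move=> x; exact: sqr_ge0.
rewrite sqr_sqrtr// var ler_norml; move: d2 qle' qge'; move: s1.
by move: (_ ^+ 2) (sigma' ^+ 2) (sigma') (q) => x y z q' *; apply/andP; split; lra.
Qed.

(** The indicator left out of the paths can only increase the count, by at most 1: the level is
    shifted on one side only. *)
Lemma Xdes_tail y :
  avg (fun ys => (y - mu < S ys)%R%:R) - 2 * (n%:R ^+ 2 / m'.+1%:R) <=
    fine (P [set x | y < V x]) /\
  fine (P [set x | y < V x]) <=
  avg (fun ys => (y - 1 - mu < S ys)%R%:R) + 2 * (n%:R ^+ 2 / m'.+1%:R).
Proof.
have mV : measurable [set x | y < V x].
  rewrite -[X in measurable X]setTI.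
  have [h _] := bounded_rv_Xdes.
  have -> : [set x | y < V x] = V @^-1` [set` Interval (BRight y) +oo%O].
    by apply/seteqP; split => x /=; rewrite in_itv/= andbT.
  by apply: h => //; exact: measurable_itv.
have bI (z : R) k : (k <= N)%N -> `|(z < k%:R)%R%:R| <= 1 :> R.
  by move=> _; case: (_ < _)%R; rewrite ?normr1 ?normr0.
have bI' (z : R) : bounded_rv (fun x => (z < V' x)%R%:R : R).
  exact: (bounded_rv_path_descents Z t n d (fun k => (z < k%:R)%R%:R : R)).
have avgE (z : R) : avg (fun ys : n.-tuple 'I_m'.+1 => (z < (grid_descents t d ys)%:R)%R%:R) =
    avg (fun ys => (z - mu < S ys)%R%:R) :> R.
  by apply: eq_avg => ys; rewrite /S ltrD2r.
have bound (z : R) : `|mean P (fun x => (z < V' x)%R%:R) -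
    avg (fun ys => (z - mu < S ys)%R%:R)| <= 2 * (n%:R ^+ 2 / m'.+1%:R).
  by have := discretization_bound m' d0 hZ (bI z); rewrite avgE mulr1.
rewrite -mean_indic//; split.
- have h := bound y.
  have h2 : mean P (fun x => (y < V' x)%R%:R) <= mean P (\1_[set x | y < V x]).
    apply: le_mean; [exact: bI'|exact: bounded_rv_indic|] => x.
    rewrite indicE; case: ltP => [h3|_]; last by case: (_ \in _).
    by rewrite mem_set//=; have /andP[h4 _] := VV' x; exact: lt_le_trans h4.
  apply: le_trans h2; move: h; rewrite ler_norml => /andP[+ _].
  move: (mean _ _) (avg _) (2 * _) => e f g; lra.
- have h := bound (y - 1).
  have h2 : mean P (\1_[set x | y < V x]) <= mean P (fun x => (y - 1 < V' x)%R%:R).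
    apply: le_mean; [exact: bounded_rv_indic|exact: bI'|] => x.
    rewrite indicE; have [xV|xV] := boolP (x \in _); last by case: (_ < _)%R.
    have {}xV : y < V x by move: xV; rewrite inE.
    have /andP[_ h4] := VV' x; rewrite (_ : (y - 1 < V' x) = true)//.
    by rewrite ltrBlDr; exact: lt_le_trans xV h4.
  apply: (le_trans h2); move: h; rewrite ler_norml => /andP[_].
  move: (mean _ _) (avg _) (2 * _) => e f g; lra.
Qed.

End Xdes_law.

(** * The Gumbel threshold *)

Section gumbel_threshold.
Context {R : realType}.
Implicit Types (x L : R).

(* With [L = sqrt (2 ln k)], this is [alpha k * x + beta k]. *)
Definition threshold x L : R := L + (x - ln L - ln (Num.sqrt (2 * pi))) / L.

Lemma ln_div_le L : 1 <= L -> 0 <= ln L / L <= 2 / Num.sqrt L.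
Proof.
move=> L1; have L0 : 0 < L by exact: lt_le_trans L1.
have r0 : 0 < Num.sqrt L by rewrite sqrtr_gt0.
have r2 : Num.sqrt L ^+ 2 = L by rewrite sqr_sqrtr// ltW.
rewrite divr_ge0 ?ln_ge0 ?(ltW L0)//=.
have e : ln L = 2 * ln (Num.sqrt L).
  by rewrite -{1}r2 lnXn// mulr_natl.
rewrite e -{2}r2 ler_pdivrMr ?exprn_gt0// expr2 mulrA divfK ?gt_eqF//.
by rewrite ler_wpM2l// ltW// ln_sublinear.
Qed.

(** For u = L + h one has u^2/2 = L^2/2 + h L + h^2/2, and h L is designed to cancel the Gaussian
    constant and to leave L exp (- x); Mills' ratio then consumes the factor L. *)
Lemma threshold_mills x L : 0 < L ->
  expR (L ^+ 2 / 2) * gauss_density (threshold x L) =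
  L * expR (- x) * expR (- (((x - ln L - ln (Num.sqrt (2 * pi))) / L) ^+ 2 / 2)).
Proof.
move=> L0; rewrite /gauss_density /threshold.
have s0 : 0 < Num.sqrt (2 * pi) :> R by rewrite sqrtr_gt0 mulr_gt0 ?pi_gt0.
set h := (x - _ - _) / L.
have hL : h * L = x - ln L - ln (Num.sqrt (2 * pi)) by rewrite divfK// gt_eqF.
have -> : (Num.sqrt (2 * pi))^-1 = expR (- ln (Num.sqrt (2 * pi))) :> R.
  by rewrite expRN lnK ?posrE.
have -> : L * expR (- x) * expR (- (h ^+ 2 / 2)) = expR (ln L + - x + - (h ^+ 2 / 2)).
  by rewrite !expRD lnK ?posrE.
by rewrite -!expRD; congr expR; lra.
Qed.

Variable (L : nat -> R).
Hypothesis Ly : L n @[n --> \oo] --> +oo.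

Let L_gt (c : R) : \forall n \near \oo, c < L n.
Proof. by move/cvgryPgt : Ly; exact. Qed.

Lemma threshold_shift_cvg x :
  (x - ln (L n) - ln (Num.sqrt (2 * pi))) / L n @[n --> \oo] --> (0 : R).
Proof.
have LV : (L n)^-1 @[n --> \oo] --> (0 : R).
  by apply/gtr0_cvgV0 => //; exact: L_gt.
have rV : (Num.sqrt (L n))^-1 @[n --> \oo] --> (0 : R).
  apply/gtr0_cvgV0; first by near=> n; rewrite sqrtr_gt0; near: n; exact: L_gt.
  apply/cvgryPge => A; near=> n.
  have LA : A ^+ 2 < L n by near: n; exact: L_gt.
  apply: (le_trans (ler_norm A)); rewrite -sqrtr_sqr ler_wsqrtr//.
  exact: ltW.
have lL : ln (L n) / L n @[n --> \oo] --> (0 : R).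
  apply: (@squeeze_cvgr _ _ _ _ (fun=> 0) (fun n => 2 * (Num.sqrt (L n))^-1)).
  - near=> n; apply: ln_div_le; apply: ltW; near: n; exact: L_gt.
  - exact: cvg_cst.
  - by rewrite -[X in _ --> X](mulr0 (2 : R)); exact: cvgMr.
have -> : (fun n => (x - ln (L n) - ln (Num.sqrt (2 * pi))) / L n) =
  (fun n => (x - ln (Num.sqrt (2 * pi))) * (L n)^-1 - ln (L n) / L n).
  by apply/funext => n; ring.
rewrite -[X in _ --> X](subr0 0); apply: cvgB => //.
by rewrite -[X in _ --> X](mulr0 (x - ln (Num.sqrt (2 * pi)))); exact: cvgMr.
Unshelve. all: by end_near. Qed.

Lemma threshold_near x :
  \forall n \near \oo, L n / 2 <= threshold x (L n) <= 2 * L n.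
Proof.
have /cvgr0Pnorm_le h1 := threshold_shift_cvg x.
near=> n.
have L2 : 2 < L n by near: n; exact: L_gt.
have : `|(x - ln (L n) - ln (Num.sqrt (2 * pi))) / L n| <= 1 by near: n; exact: h1.
by rewrite ler_norml /threshold; lra.
Unshelve. all: by end_near. Qed.

Lemma threshold_cvgy x : threshold x (L n) @[n --> \oo] --> +oo.
Proof.
apply/cvgryPge => A; near=> n.
have : L n / 2 <= threshold x (L n) <= 2 * L n by near: n; exact: threshold_near.
have : 2 * A < L n by near: n; exact: L_gt.
by lra.
Unshelve. all: by end_near. Qed.

Lemma threshold_ratio_cvg x : L n / threshold x (L n) @[n --> \oo] --> (1 : R).
Proof.
have LV : (L n)^-1 @[n --> \oo] --> (0 : R) by apply/gtr0_cvgV0 => //; exact: L_gt.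
have h : 1 + (x - ln (L n) - ln (Num.sqrt (2 * pi))) / L n * (L n)^-1 @[n --> \oo] --> (1 : R).
  rewrite -[X in _ --> X](addr0 1) -[X in _ --> _ + X](mulr0 (0 : R)).
  by apply: cvgD; [exact: cvg_cst|apply: cvgM => //; exact: threshold_shift_cvg].
have h2 : (1 + (x - ln (L n) - ln (Num.sqrt (2 * pi))) / L n * (L n)^-1)^-1 @[n --> \oo] --> (1 : R).
  by rewrite -[X in _ --> X]invr1; apply: cvgV => //; exact: oner_neq0.
apply: cvg_trans h2; apply: near_eq_cvg; near=> n.
have L0 : 0 < L n by near: n; exact: L_gt.
rewrite -[RHS]invf_div; congr (_^-1); rewrite /threshold.
by rewrite [RHS]mulrDl divff// gt_eqF.
Unshelve. all: by end_near. Qed.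

(** By [threshold_mills], Mills' upper bound is [q] and the lower one is [q] times 1 - u^-2. *)
Lemma gauss_tail_threshold_cvg x :
  expR (L n ^+ 2 / 2) * gauss_tail (threshold x (L n)) @[n --> \oo] --> expR (- x).
Proof.
pose h n := (x - ln (L n) - ln (Num.sqrt (2 * pi))) / L n.
pose q n := expR (- x) * expR (- (h n ^+ 2 / 2)) * (L n / threshold x (L n)).
have qc : q n @[n --> \oo] --> expR (- x).
  rewrite -[X in _ --> X]mulr1; apply: cvgM; last exact: threshold_ratio_cvg.
  rewrite -[X in _ --> X]mulr1; apply: cvgM; first exact: cvg_cst.
  rewrite -[X in _ --> X](expR0 R).
  have h0 : h n @[n --> \oo] --> (0 : R) by exact: threshold_shift_cvg.
  have hh : - (h n ^+ 2 / 2) @[n --> \oo] --> (0 : R).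
    have -> : (fun n => - (h n ^+ 2 / 2)) = (fun n => (- 2^-1) * (h n * h n)).
      by apply/funext => n; rewrite expr2; ring.
    rewrite -[X in _ --> X](mulr0 (- 2^-1 : R)); apply: cvgMr.
    by rewrite -[X in _ --> X](mulr0 (0 : R)); exact: cvgM.
  by apply: (cvg_comp (fun n => - (h n ^+ 2 / 2)) expR hh); exact: continuous_expR.
have uV : (threshold x (L n))^-1 @[n --> \oo] --> (0 : R).
  apply/gtr0_cvgV0; last exact: threshold_cvgy.
  by have /cvgryPgt := threshold_cvgy x; exact.
have qc' : q n * (1 - (threshold x (L n))^-1 * (threshold x (L n))^-1) @[n --> \oo] --> expR (- x).
  rewrite -[X in _ --> X]mulr1; apply: cvgM => //.
  rewrite -[X in _ --> X](subr0 1); apply: cvgB; first exact: cvg_cst.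
  by rewrite -[X in _ --> X](mulr0 (0 : R)); exact: cvgM.
apply: (@squeeze_cvgr _ _ _ _ (fun n => q n * (1 - (threshold x (L n))^-1 * (threshold x (L n))^-1)) q) => //.
near=> n.
have L0 : 0 < L n by near: n; exact: L_gt.
have u0 : 0 < threshold x (L n).
  have : L n / 2 <= threshold x (L n) <= 2 * L n by near: n; exact: threshold_near.
  lra.
have m := threshold_mills x L0.
have e0 : 0 <= expR (L n ^+ 2 / 2) by exact: expR_ge0.
apply/andP; split.
- apply: le_trans (ler_wpM2l e0 (gauss_tail_ge u0)).
  rewrite mulrA m /q -/(h n) le_eqVlt; apply/orP; left; apply/eqP.
  by field; rewrite gt_eqF.
- apply: (le_trans (ler_wpM2l e0 (gauss_tail_le u0))).
  by rewrite mulrA m /q -/(h n) le_eqVlt; apply/orP; left; apply/eqP; ring.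
Unshelve. all: by end_near. Qed.

(** Multiplied by k, the exponential weight of the Lindeberg error is of order [L]; this factor
    raises the power of [L] in that error from 6 to 7. *)
Lemma expR_threshold_le x : \forall n \near \oo,
  expR (L n ^+ 2 / 2) * expR (- (threshold x (L n) ^+ 2 / 2)) <=
  Num.sqrt (2 * pi) * expR (- x) * L n.
Proof.
near=> n.
have L0 : 0 < L n by near: n; exact: L_gt.
have m := threshold_mills x L0.
have s0 : 0 < Num.sqrt (2 * pi) :> R by rewrite sqrtr_gt0 mulr_gt0 ?pi_gt0.
have -> : expR (- (threshold x (L n) ^+ 2 / 2)) =
    Num.sqrt (2 * pi) * gauss_density (threshold x (L n)).
  by rewrite /gauss_density mulrA mulfV ?mul1r// gt_eqF.
rewrite mulrCA m -[leRHS]mulrA ler_wpM2l ?(ltW s0)// mulrC [L n * _]mulrC mulrA.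
rewrite ler_wpM2r ?(ltW L0)// ler_piMl ?expR_ge0// -[leRHS](expR0 R) ler_expR.
by rewrite oppr_le0 divr_ge0// sqr_ge0.
Unshelve. all: by end_near. Qed.

End gumbel_threshold.

(** * Moderate deviations and the limit of the rescaled tail *)

Section moderate_regime.
Context {R : realType} (L s' u : R).
Let b : R := s' / u ^+ 2.
Let theta : R := b ^+ 2 + s' ^+ 2.
Let omega : R := expR (- (u ^+ 2 / 2) + 8 * u ^+ 3 / Num.sqrt theta).

(** Since theta = s'^2 (1 + u^-4), smoothing moves the level u sqrt theta by at most s' u^-3, which
    is within the blur s' / (u sqrt u) of the cutoff. *)
Lemma moderate_regime : 1 <= s' -> 8 < L -> L / 2 <= u <= 2 * L ->
  L ^+ 7 <= 64^-1 * s' ->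
  [/\ 2 <= b, 4 <= u & u / Num.sqrt theta * b <= 1] /\
  s' * u <= u * Num.sqrt theta <= s' * (u + (u * Num.sqrt u)^-1).
Proof.
move=> s1 L8 Lu h1; have s0 : 0 < s' by exact: lt_le_trans s1.
have u4 : 4 <= u by lra.
have u0 : 0 < u by lra.
have u20 : 0 < u ^+ 2 by rewrite exprn_gt0.
have b0 : 0 < b by rewrite divr_gt0.
have ub : u ^+ 2 <= 4 * L ^+ 2.
  have -> : 4 * L ^+ 2 = (2 * L) ^+ 2 by ring.
  by rewrite lerXn2r ?nnegrE; lra.
have L27 : L ^+ 2 <= L ^+ 7 by rewrite ler_weXn2l//; lra.
have b2 : 2 <= b by rewrite ler_pdivlMr//; lra.
pose q := Num.sqrt (theta).
have t0 : 0 < theta by rewrite /theta ltr_pwDr ?exprn_gt0// sqr_ge0.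
have q0 : 0 < q by rewrite sqrtr_gt0.
have q2 : q ^+ 2 = theta by rewrite sqr_sqrtr// ltW.
have sq : s' <= q.
  by rewrite -(@ler_pXn2r _ 2) ?nnegrE ?(ltW s0) ?(ltW q0)// q2 lerDr sqr_ge0.
have r0 : 0 < Num.sqrt u by rewrite sqrtr_gt0.
have r2 : Num.sqrt u ^+ 2 = u by rewrite sqr_sqrtr// ltW.
have r1 : 1 <= Num.sqrt u by rewrite -[leLHS]sqrtr1 ler_wsqrtr//; lra.
rewrite -/q; split; first split=> //.
  have -> : u / q * b = (s' / q) / u by rewrite /b; field; rewrite !gt_eqF.
  rewrite ler_pdivrMr// mul1r (@le_trans _ _ 1)//; last by lra.
  by rewrite ler_pdivrMr// mul1r.
rewrite [s' * u]mulrC ler_pM2l// sq/=.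
have qs : q <= s' * (1 + u ^- 4).
  have a0 : 0 <= u ^- 4 by rewrite invr_ge0 exprn_ge0// ltW.
  rewrite -(@ler_pXn2r _ 2) ?nnegrE ?(ltW q0)//; last first.
    by rewrite mulr_ge0// ?addr_ge0// ltW.
  rewrite q2 /theta.
  have -> : (s' / u ^+ 2) ^+ 2 = s' ^+ 2 * u ^- 4 by field; rewrite gt_eqF.
  have := mulr_ge0 (sqr_ge0 (s')) a0; have := mulr_ge0 (sqr_ge0 (s')) (sqr_ge0 (u ^- 4)).
  by rewrite exprMn; lra.
apply: (le_trans (ler_wpM2l (ltW u0) qs)).
have -> : u * (s' * (1 + u ^- 4)) = s' * (u + u ^- 3) by field; rewrite gt_eqF.
rewrite ler_wpM2l ?(ltW s0)// lerD2l lef_pV2 ?posrE ?exprn_gt0 ?mulr_gt0//.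
rewrite exprS ler_wpM2l ?(ltW u0)//.
rewrite -{2}r2 -exprM -{1}(expr1 (Num.sqrt u)) ler_weXn2l//.
Qed.

(** Here b^-3 s'^2 = u^6 / s', and [omega] times expR (L^2/2) is at most 4 c L: hence L^7 / s'. The
    loss due to the ramp is exponentially small in u, but a bound of order 1 / L suffices. *)
Lemma moderate_errors (c : R) : 0 <= c -> 1 <= s' -> 8 < L ->
  L / 2 <= u <= 2 * L -> L ^+ 7 <= 64^-1 * s' ->
  expR (L ^+ 2 / 2) * expR (- (u ^+ 2 / 2)) <= c * L ->
  expR (L ^+ 2 / 2) * (1320 * b ^- 3 * s' ^+ 2 * omega)
    <= 1320 * (256 * c) * (L ^+ 7 / s') /\
  expR (L ^+ 2 / 2) * (expR (- ((Num.sqrt u - 1) ^+ 2 / 2)) * omega)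
    <= 2048 * c * L^-1.
Proof.
move=> c0 s1 L8 Lu h1 hc; have s0 : 0 < s' by exact: lt_le_trans s1.
have L0 : 0 < L by lra.
have u4 : 4 <= u by lra.
have u0 : 0 < u by lra.
have u20 : 0 < u ^+ 2 by rewrite exprn_gt0.
have b0 : 0 < b by rewrite divr_gt0.
pose q := Num.sqrt (theta).
have t0 : 0 < theta by rewrite /theta ltr_pwDr ?exprn_gt0// sqr_ge0.
have q0 : 0 < q by rewrite sqrtr_gt0.
have q2 : q ^+ 2 = theta by rewrite sqr_sqrtr// ltW.
have sq : s' <= q.
  by rewrite -(@ler_pXn2r _ 2) ?nnegrE ?(ltW s0) ?(ltW q0)// q2 lerDr sqr_ge0.
(* The constant 64 gives 8 u^3 <= 64 L^3 <= s', so the cubic term in the exponent is at most 1. *)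
have om : omega <= 4 * expR (- (u ^+ 2 / 2)).
  rewrite /omega expRD mulrC ler_wpM2r ?expR_ge0//.
  apply: le_trans expR1_le4; rewrite ler_expR ler_pdivrMr// mul1r.
  apply: le_trans sq.
  have : u ^+ 3 <= (2 * L) ^+ 3 by rewrite lerXn2r ?nnegrE; lra.
  have : L ^+ 3 <= L ^+ 7 by rewrite ler_weXn2l//; lra.
  by rewrite exprMn; lra.
have K0 : 0 <= expR (L ^+ 2 / 2) by exact: expR_ge0.
have Kom : expR (L ^+ 2 / 2) * omega <= 4 * c * L.
  apply: (le_trans (ler_wpM2l K0 om)).
  by rewrite mulrCA -mulrA ler_wpM2l.
split.
- have -> : 1320 * b ^- 3 * s' ^+ 2 = 1320 * (u ^+ 6 / s').
    by rewrite /b; field; rewrite !gt_eqF.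
  have u6 : u ^+ 6 <= 64 * L ^+ 6.
    have -> : 64 * L ^+ 6 = (2 * L) ^+ 6 by ring.
    by rewrite lerXn2r ?nnegrE; lra.
  have -> : expR (L ^+ 2 / 2) * (1320 * (u ^+ 6 / s') * omega) =
     (1320 * (u ^+ 6 / s')) * (expR (L ^+ 2 / 2) * omega) by ring.
  have -> : 1320 * (256 * c) * (L ^+ 7 / s') =
     (1320 * (64 * L ^+ 6 / s')) * (4 * c * L) by field; rewrite gt_eqF.
  have uL : u ^+ 6 / s' <= 64 * L ^+ 6 / s' by rewrite ler_wpM2r ?invr_ge0 ?(ltW s0).
  have us : 0 <= u ^+ 6 / s' := divr_ge0 (exprn_ge0 6 (ltW u0)) (ltW s0).
  have om0 : 0 <= expR (L ^+ 2 / 2) * omega := mulr_ge0 K0 (expR_ge0 _).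
  have C0 := ler0n R 1320.
  apply: ler_pM; [exact: mulr_ge0|exact: om0|exact: ler_wpM2l|exact: Kom].
- have r2 : Num.sqrt u ^+ 2 = u by rewrite sqr_sqrtr// ltW.
  have r4 : 2 <= Num.sqrt u.
    rewrite -(@ler_pXn2r _ 2) ?nnegrE ?sqrtr_ge0// r2; lra.
  (* sqrt u >= 2 gives (sqrt u - 1)^2 >= u / 4; then exp (u/8) >= (u/8)^2 / 2 = u^2 / 128. *)
  have e8 : expR (- ((Num.sqrt u - 1) ^+ 2 / 2)) <= 128 / u ^+ 2.
    apply: (@le_trans _ _ (expR (- (u / 8)))).
      rewrite ler_expR -{2}r2; nra.
    rewrite expRN -[leRHS]invf_div lef_pV2 ?posrE ?expR_gt0//; last by rewrite divr_gt0.
    have u8 : 0 <= u / 8 by lra.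
    have := expR_ge1Dxn 1 u8; rewrite (_ : 2`! = 2%N)//; lra.
  have -> : expR (L ^+ 2 / 2) * (expR (- ((Num.sqrt u - 1) ^+ 2 / 2)) * omega) =
     expR (- ((Num.sqrt u - 1) ^+ 2 / 2)) * (expR (L ^+ 2 / 2) * omega) by ring.
  have u2L : 128 / u ^+ 2 <= 512 / L ^+ 2.
    rewrite ler_pdivrMr// mulrAC ler_pdivlMr ?exprn_gt0//.
    have : (L / 2) ^+ 2 <= u ^+ 2 by rewrite lerXn2r ?nnegrE; lra.
    by rewrite exprMn; lra.
  apply: (@le_trans _ _ (512 / L ^+ 2 * (4 * c * L))).
    apply: ler_pM; [exact: expR_ge0|exact: mulr_ge0 K0 (expR_ge0 _)| |exact: Kom].
    exact: le_trans u2L.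
  by rewrite le_eqVlt; apply/orP; left; apply/eqP; field; rewrite gt_eqF.
Qed.

End moderate_regime.

Section tail_limit.
Context {R : realType}.

(* [A t] stands for the tail at [t] of a martingale with total variance [s' ^+ 2]. *)
Definition gaussian_tails (s' : R) (A : R -> R) := forall u : R,
  let b := s' / u ^+ 2 in
  let theta := b ^+ 2 + s' ^+ 2 in
  let M := Num.sqrt u in
  let omega := expR (- (u ^+ 2 / 2) + 8 * u ^+ 3 / Num.sqrt theta) in
  2 <= b -> 0 < u -> u / Num.sqrt theta * b <= 1 -> 1 <= M ->
  (forall t, u * Num.sqrt theta + M * b <= t ->
    A t * gauss_tail (- M) <= gauss_tail u + 1320 * b ^- 3 * s' ^+ 2 * omega) /\
  (forall t, t <= u * Num.sqrt theta - M * b ->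
    gauss_tail u - 1320 * b ^- 3 * s' ^+ 2 * omega
      - expR (- ((M - 1) ^+ 2 / 2)) * omega <= A t).

Section one_size.
Variables (L s' u sg e mu dlt eta c : R) (A Q : R -> R).
Local Notation K := (expR (L ^+ 2 / 2)).
Hypotheses (s1 : 1 <= s') (L8 : 8 < L) (Lu : L / 2 <= u <= 2 * L)
  (L7 : L ^+ 7 <= 64^-1 * s') (c0 : 0 <= c)
  (hc : K * expR (- (u ^+ 2 / 2)) <= c * L)
  (hsg : `|sg - s'| <= 15) (he : `|e - mu| <= 3)
  (dlt0 : 0 <= dlt) (eta01 : 0 < eta <= 1) (heta : 40 * (L ^+ 7 / s') + 4 / Num.sqrt u <= eta)
  (hA : gaussian_tails s' A)
  (hQ : forall y, A (y - mu) - dlt <= Q y /\ Q y <= A (y - 1 - mu) + dlt).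

Let s0 : 0 < s'. Proof. exact: lt_le_trans s1. Qed.
Let L0 : 0 < L. Proof. by move: L8 Lu; lra. Qed.
Let u4 : 4 <= u. Proof. by move: L8 Lu; lra. Qed.
Let r1 : 1 <= Num.sqrt u.
Proof. by rewrite -[leLHS]sqrtr1 ler_wsqrtr//; move: L8 Lu; lra. Qed.

(** A slack eta / L in the threshold is worth s' eta / L on the scale of the count. It must swallow
    the error 15 on the standard deviation, multiplied by about u <= 2 L, and the bounded errors on
    mean and level, all within 40 L, then up to twice the blur s' / (u sqrt u): for theta and for
    the ramp. *)
Lemma shift_margin :
  40 * L + 2 * (s' * (u * Num.sqrt u)^-1) <= s' * (eta / L).
Proof.
have u0 : 0 < u by move: L8 Lu; lra.
have r0 : 0 < Num.sqrt u by rewrite sqrtr_gt0.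
have LL : L ^+ 2 / s' <= L ^+ 7 / s'.
  by rewrite ler_wpM2r ?invr_ge0 ?(ltW s0)// ler_weXn2l//; move: L8; lra.
have uL : L / u <= 2 by rewrite ler_pdivrMr//; move: L8 Lu; lra.
have h : 40 * (L ^+ 2 / s') + 2 * (L / u / Num.sqrt u) <= eta.
  apply: le_trans heta; apply: lerD; first by rewrite ler_pM2l.
  have -> : 4 / Num.sqrt u = 2 * (2 / Num.sqrt u) by ring.
  by rewrite ler_pM2l// ler_wpM2r ?invr_ge0 ?(ltW r0).
have -> : 40 * L + 2 * (s' * (u * Num.sqrt u)^-1) =
    (40 * (L ^+ 2 / s') + 2 * (L / u / Num.sqrt u)) * (s' / L).
  by field; rewrite !gt_eqF.
have -> : s' * (eta / L) = eta * (s' / L) by ring.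
by rewrite ler_wpM2r// divr_ge0// ltW.
Qed.

Let Mb : Num.sqrt u * (s' / u ^+ 2) = s' * (u * Num.sqrt u)^-1.
Proof.
have u0 : 0 < u by move: L8 Lu; lra.
have r0 : 0 < Num.sqrt u by rewrite sqrtr_gt0.
have r2 : Num.sqrt u ^+ 2 = u by rewrite sqr_sqrtr// ltW.
move: r0 r2; move: (Num.sqrt u) => r r0 <-; field.
by rewrite gt_eqF.
Qed.

Let eL : 0 <= eta / L <= 1.
Proof. by rewrite divr_ge0 ?ler_pdivrMr//; move: L8 eta01; lra. Qed.

Lemma tail_upper :
  K * Q (sg * (u + eta / L) + e) * gauss_tail (- Num.sqrt u) <=
  K * gauss_tail u + 1320 * (256 * c) * (L ^+ 7 / s') + K * dlt.
Proof.
have [[b2 _ ub] /andP[_ st]] := moderate_regime s1 L8 Lu L7.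
have [er1 _] := moderate_errors c0 s1 L8 Lu L7 hc.
have u0 : 0 < u by move: L8 Lu; lra.
have [+ _] := hA b2 u0 ub r1.
set y := sg * (u + eta / L) + e => /(_ (y - 1 - mu)).
have cond : u * Num.sqrt ((s' / u ^+ 2) ^+ 2 + s' ^+ 2) + Num.sqrt u * (s' / u ^+ 2)
    <= y - 1 - mu.
  rewrite Mb; apply: (le_trans (lerD st (lexx _))).
  have sm := shift_margin; rewrite /y.
  have h1 : s' * (u + eta / L) - 15 * (u + eta / L) <= sg * (u + eta / L).
    rewrite -mulrBl ler_wpM2r//; first by move: L8 Lu eL; lra.
    by move: hsg L8 Lu eL; rewrite ler_norml; lra.
  move: he; rewrite ler_norml mulrDr => /andP[he1 _].
  move: sm h1 L8 Lu eL; rewrite mulrDr; lra.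
move=> /(_ cond) h.
have K0 : 0 <= K by exact: expR_ge0.
have /andP[g0 g1] : 0 <= gauss_tail (- Num.sqrt u) <= 1.
  by rewrite gauss_tail_ge0 gauss_tail_le1.
have [q0 q1] := hQ y.
apply: (@le_trans _ _ (K * (A (y - 1 - mu) * gauss_tail (- Num.sqrt u)) + K * dlt)).
  rewrite -mulrA -mulrDr ler_wpM2l//.
  apply: (le_trans (ler_wpM2r g0 q1)); rewrite mulrDl lerD2l.
  by rewrite ler_piMr.
rewrite lerD2r; apply: (le_trans (ler_wpM2l K0 h)).
by rewrite mulrDr lerD2l.
Qed.

Lemma tail_lower :
  K * gauss_tail u - 1320 * (256 * c) * (L ^+ 7 / s') - 2048 * c * L^-1 - K * dlt <=
  K * Q (sg * (u - eta / L) + e).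
Proof.
have [[b2 _ ub] /andP[st _]] := moderate_regime s1 L8 Lu L7.
have [er1 er2] := moderate_errors c0 s1 L8 Lu L7 hc.
have u0 : 0 < u by move: L8 Lu; lra.
have [_ +] := hA b2 u0 ub r1.
set y := sg * (u - eta / L) + e => /(_ (y - mu)).
have cond : y - mu <= u * Num.sqrt ((s' / u ^+ 2) ^+ 2 + s' ^+ 2)
    - Num.sqrt u * (s' / u ^+ 2).
  rewrite Mb; apply: le_trans (lerB st (lexx _)).
  have sm := shift_margin; rewrite /y.
  have h1 : sg * (u - eta / L) <= s' * (u - eta / L) + 15 * (u - eta / L).
    rewrite -mulrDl ler_wpM2r//; first by move: L8 Lu eL; lra.
    by move: hsg L8 Lu eL; rewrite ler_norml; lra.
  move: he; rewrite ler_norml => /andP[_ he2].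
  have X0 : 0 <= s' * (u * Num.sqrt u)^-1.
    by rewrite divr_ge0 ?(ltW s0)// mulr_ge0 ?sqrtr_ge0// ltW.
  move: sm h1 L8 Lu eL; rewrite [s' * (u - _)]mulrBr; lra.
move=> /(_ cond) h.
have K0 : 0 <= K by exact: expR_ge0.
have [q0 q1] := hQ y.
apply: le_trans (ler_wpM2l K0 q0); rewrite [K * (A _ - _)]mulrBr lerD2r.
apply: le_trans (ler_wpM2l K0 h).
rewrite (mulrBr K (gauss_tail u - _)) (mulrBr K (gauss_tail u)).
by apply: lerB; [rewrite lerD2l lerN2|].
Qed.

End one_size.

Section all_sizes.
Variables (L s' sg e mu dlt : nat -> R) (A Q : nat -> R -> R).
Local Notation K n := (expR (L n ^+ 2 / 2)).
Hypotheses (Ly : L n @[n --> \oo] --> +oo)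
  (L7 : L n ^+ 7 / s' n @[n --> \oo] --> (0 : R))
  (Kdlt : K n * dlt n @[n --> \oo] --> (0 : R)).
Hypothesis regime : \forall n \near \oo,
  [/\ 1 <= s' n, `|sg n - s' n| <= 15, `|e n - mu n| <= 3 & 0 <= dlt n] /\
  gaussian_tails (s' n) (A n) /\
  (forall y, A n (y - mu n) - dlt n <= Q n y /\
             Q n y <= A n (y - 1 - mu n) + dlt n).

Let LV : (L n)^-1 @[n --> \oo] --> (0 : R).
Proof. by apply/gtr0_cvgV0 => //; move/cvgryPgt : Ly; exact. Qed.

Let sqrt_thr x : Num.sqrt (threshold x (L n)) @[n --> \oo] --> +oo.
Proof.
apply/cvgryPge => B; near=> n.
have LA : B ^+ 2 <= threshold x (L n).
  by near: n; have /cvgryPge := threshold_cvgy Ly x; exact.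
by apply: (le_trans (ler_norm B)); rewrite -sqrtr_sqr ler_wsqrtr.
Unshelve. all: by end_near. Qed.

Let margin x (eta : R) : 0 < eta -> \forall n \near \oo,
  40 * (L n ^+ 7 / s' n) + 4 / Num.sqrt (threshold x (L n)) <= eta.
Proof.
move=> e0.
have h : 40 * (L n ^+ 7 / s' n) + 4 * (Num.sqrt (threshold x (L n)))^-1
    @[n --> \oo] --> (0 : R).
  rewrite -[X in _ --> X](addr0 0); apply: cvgD.
    by rewrite -[X in _ --> X](mulr0 (40 : R)); exact: cvgMr.
  rewrite -[X in _ --> X](mulr0 (4 : R)); apply: cvgMr.
  by apply/gtr0_cvgV0 => //; move/cvgryPgt : (sqrt_thr x); exact.
by move/cvgr0_norm_le: h => /(_ _ e0); apply: filterS => n /ler_normlW.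
Unshelve. all: by end_near. Qed.

(** The slack eta / L is thus exactly a shift of the Gumbel variable [x] by eta. *)
Let shiftE x y n : 0 < L n -> threshold x (L n) = threshold y (L n) + (x - y) / L n.
Proof. by move=> L0; rewrite /threshold; field; rewrite gt_eqF. Qed.

Let regime_at x (eta : R) : 0 < eta -> \forall n \near \oo,
  [/\ 8 < L n, L n / 2 <= threshold x (L n) <= 2 * L n,
     L n ^+ 7 <= 64^-1 * s' n,
     K n * expR (- (threshold x (L n) ^+ 2 / 2)) <=
       Num.sqrt (2 * pi) * expR (- x) * L n &
     40 * (L n ^+ 7 / s' n) + 4 / Num.sqrt (threshold x (L n)) <= eta].
Proof.
move=> e0.
have i64 : 0 < 64^-1 :> R by rewrite invr_gt0.
near=> n; split; near: n.
- by move/cvgryPgt : Ly; exact.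
- exact: threshold_near.
- have := regime; move/cvgr0_norm_le : L7 => /(_ _ i64).
  apply: filterS2 => n /ler_normlW h [[s1 _ _ _] _].
  by rewrite -ler_pdivrMr// (lt_le_trans ltr01).
- exact: expR_threshold_le.
- exact: margin.
Unshelve. all: by end_near. Qed.

Let Q_le x (eta : R) : 0 < eta <= 1 -> \forall n \near \oo,
  K n * Q n (sg n * threshold x (L n) + e n) <= expR (- (x - eta)) + eta.
Proof.
move=> eta01; have /andP[e0 _] := eta01.
pose c := Num.sqrt (2 * pi) * expR (- (x - eta)).
pose g n := gauss_tail (- Num.sqrt (threshold (x - eta) (L n))).
(* The cutoff sqrt u tends to infinity, so the factor lost on the ramp can be divided out. *)
have gc : g n @[n --> \oo] --> (1 : R).
  apply: cvg_comp gauss_tail_cvgNy.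
  by apply/cvgNry; rewrite opprK; exact: sqrt_thr.
pose B n := (K n * gauss_tail (threshold (x - eta) (L n)) +
  1320 * (256 * c) * (L n ^+ 7 / s' n) + K n * dlt n) / g n.
have Bc : B n @[n --> \oo] --> expR (- (x - eta)).
  rewrite -[X in _ --> X]divr1; apply: cvgM; last by apply: cvgV => //; exact: oner_neq0.
  rewrite -[X in _ --> X]addr0; apply: cvgD => //.
  rewrite -[X in _ --> X]addr0; apply: cvgD; first exact: gauss_tail_threshold_cvg.
  by rewrite -[X in _ --> X](mulr0 (1320 * (256 * c))); exact: cvgMr.
have nB : \forall n \near \oo, B n <= expR (- (x - eta)) + eta.
  move/cvgrPdist_le : Bc => /(_ _ e0); apply: filterS => n.
  by rewrite ler_distlC => /andP[].
have ng : \forall n \near \oo, 0 < g n by move/cvgr_gt : gc => /(_ _ ltr01).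
near=> n; apply: (@le_trans _ _ (B n)); last by near: n.
have g0 : 0 < g n by near: n.
have [[s1 h1 h2 h3] [h4 h5]] : [/\ 1 <= s' n, `|sg n - s' n| <= 15, `|e n - mu n| <= 3 & 0 <= dlt n] /\
  gaussian_tails (s' n) (A n) /\
  (forall y, A n (y - mu n) - dlt n <= Q n y /\
             Q n y <= A n (y - 1 - mu n) + dlt n) by near: n.
have [k1 k2 k3 k4 k5] : [/\ 8 < L n, L n / 2 <= threshold (x - eta) (L n) <= 2 * L n,
     L n ^+ 7 <= 64^-1 * s' n,
     K n * expR (- (threshold (x - eta) (L n) ^+ 2 / 2)) <= c * L n &
     40 * (L n ^+ 7 / s' n) + 4 / Num.sqrt (threshold (x - eta) (L n)) <= eta].
  by near: n; exact: regime_at.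
have c0 : 0 <= c by rewrite mulr_ge0 ?sqrtr_ge0 ?expR_ge0.
have := tail_upper s1 k1 k2 k3 c0 k4 h1 h2 h3 eta01 k5 h4 h5.
rewrite /B ler_pdivlMr// (shiftE x (x - eta)) ?(lt_trans _ k1)// subKr.
exact.
Unshelve. all: by end_near. Qed.

Let Q_ge x (eta : R) : 0 < eta <= 1 -> \forall n \near \oo,
  expR (- (x + eta)) - eta <= K n * Q n (sg n * threshold x (L n) + e n).
Proof.
move=> eta01; have /andP[e0 _] := eta01.
pose c := Num.sqrt (2 * pi) * expR (- (x + eta)).
pose B n := K n * gauss_tail (threshold (x + eta) (L n)) -
  1320 * (256 * c) * (L n ^+ 7 / s' n) - 2048 * c * (L n)^-1 - K n * dlt n.
have Bc : B n @[n --> \oo] --> expR (- (x + eta)).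
  rewrite -[X in _ --> X]subr0; apply: cvgB => //.
  rewrite -[X in _ --> X]subr0; apply: cvgB; last first.
    by rewrite -[X in _ --> X](mulr0 (2048 * c)); exact: cvgMr.
  rewrite -[X in _ --> X]subr0; apply: cvgB; first exact: gauss_tail_threshold_cvg.
  by rewrite -[X in _ --> X](mulr0 (1320 * (256 * c))); exact: cvgMr.
have nB : \forall n \near \oo, expR (- (x + eta)) - eta <= B n.
  move/cvgrPdist_le : Bc => /(_ _ e0); apply: filterS => n.
  by rewrite ler_distlC => /andP[].
near=> n; apply: (@le_trans _ _ (B n)); first by near: n.
have [[s1 h1 h2 h3] [h4 h5]] : [/\ 1 <= s' n, `|sg n - s' n| <= 15, `|e n - mu n| <= 3 & 0 <= dlt n] /\
  gaussian_tails (s' n) (A n) /\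
  (forall y, A n (y - mu n) - dlt n <= Q n y /\
             Q n y <= A n (y - 1 - mu n) + dlt n) by near: n.
have [k1 k2 k3 k4 k5] : [/\ 8 < L n, L n / 2 <= threshold (x + eta) (L n) <= 2 * L n,
     L n ^+ 7 <= 64^-1 * s' n,
     K n * expR (- (threshold (x + eta) (L n) ^+ 2 / 2)) <= c * L n &
     40 * (L n ^+ 7 / s' n) + 4 / Num.sqrt (threshold (x + eta) (L n)) <= eta].
  by near: n; exact: regime_at.
have c0 : 0 <= c by rewrite mulr_ge0 ?sqrtr_ge0 ?expR_ge0.
have := tail_lower s1 k1 k2 k3 c0 k4 h1 h2 eta01 k5 h4 h5.
rewrite /B [threshold x _](shiftE x (x + eta)) ?(lt_trans _ k1)//.
by rewrite opprD addNKr mulNr; exact.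
Unshelve. all: by end_near. Qed.

(** The bounds obtained at x - eta and x + eta close up on exp (- x) as eta tends to 0. *)
Lemma tail_threshold_cvg x :
  K n * Q n (sg n * threshold x (L n) + e n) @[n --> \oo] --> expR (- x).
Proof.
apply/cvgrPdist_le => eps eps0.
have e2 : 0 < eps / 2 by rewrite divr_gt0.
have lim (s : R) : expR (- (x + s * eta)) @[eta --> 0^'+] --> expR (- x).
  apply: cvg_at_right_filter.
  rewrite -[X in _ --> expR (- X)]addr0 -[X in _ --> expR (- (x + X))](mulr0 s).
  have h : - (x + s * z) @[z --> 0] --> - (x + s * 0 : R).
    by apply: cvgN; apply: cvgD; [exact: cvg_cst|apply: cvgMr; exact: cvg_id].
  exact: (cvg_comp (fun z => - (x + s * z)) expR h (@continuous_expR R _)).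
have /cvgrPdist_le/(_ _ e2) h1 := lim 1.
have /cvgrPdist_le/(_ _ e2) h2 := lim (- 1).
have [eta [e01 he u1 u2]] : exists eta : R, [/\ 0 < eta <= 1, eta <= eps / 2,
    `|expR (- x) - expR (- (x + 1 * eta))| <= eps / 2 &
    `|expR (- x) - expR (- (x + (-1) * eta))| <= eps / 2].
  near (0%R : R)^'+ => eta; exists eta; split; [|near: eta..] => //.
  - apply/andP; split; near: eta; [exact: nbhs_right_gt|exact: nbhs_right_le].
  - exact: nbhs_right_le.
have := Q_ge x e01; have := Q_le x e01; apply: filterS2 => n.
move: u1 u2; rewrite mul1r mulN1r !ler_distl; lra.
Unshelve. all: by end_near. Qed.

End all_sizes.
End tail_limit.

(** * Maxima, normalizing sequences and the limit law *)

Lemma expr_onemX_cvg (R : realType) (k : nat -> nat) (q : nat -> R) (l : R) :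
  k n @[n --> \oo] --> \oo ->
  (k n)%:R * q n @[n --> \oo] --> l ->
  (1 - q n) ^+ k n @[n --> \oo] --> expR (- l).
Proof.
move=> ky kq.
have kV : ((k n)%:R : R)^-1 @[n --> \oo] --> (0 : R).
  have := cvg_comp k (fun m : nat => (m%:R : R)^-1) ky.
  apply; apply/gtr0_cvgV0.
    by near=> m; rewrite ltr0n; near: m; exact: nbhs_infty_gt.
  exact: cvgr_idn.
have q0 : q n @[n --> \oo] --> (0 : R).
  have h : (k n)%:R^-1 * ((k n)%:R * q n) @[n --> \oo] --> (0 : R).
    by rewrite -[X in _ --> X](mul0r l); exact: cvgM.
  apply: cvg_trans h; apply: near_eq_cvg; near=> n.
  rewrite mulKf// pnatr_eq0 -lt0n; near: n.
  by move/cvgnyPgt : ky; exact.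
have E (a : nat -> R) : a n @[n --> \oo] --> l -> expR (- a n) @[n --> \oo] --> expR (- l).
  by move=> al; exact: (cvg_comp (fun n => - a n) expR (cvgN al) (@continuous_expR R _)).
(* exp (- q / (1 - q)) <= 1 - q <= exp (- q), raised to the power k. *)
apply: (@squeeze_cvgr _ _ _ _ (fun n => expR (- ((k n)%:R * q n / (1 - q n))))
  (fun n => expR (- ((k n)%:R * q n)))).
- near=> n.
  have q1 : q n < 1 by near: n; apply: (cvgr_lt _ q0); exact: ltr01.
  have p0 : 0 < 1 - q n by rewrite subr_gt0.
  apply/andP; split.
  + have -> : - ((k n)%:R * q n / (1 - q n)) = (k n)%:R * - (q n / (1 - q n)) by ring.
    rewrite expRM_natl lerXn2r ?nnegrE ?expR_ge0 ?(ltW p0)//.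
    rewrite expRN -[leRHS]invrK lef_pV2 ?posrE ?expR_gt0 ?invr_gt0//.
    apply: le_trans (expR_ge1Dx _).
    by rewrite le_eqVlt; apply/orP; left; apply/eqP; field; rewrite gt_eqF.
  + have -> : - ((k n)%:R * q n) = (k n)%:R * - q n by ring.
    rewrite expRM_natl lerXn2r ?nnegrE ?expR_ge0 ?(ltW p0)//.
    exact: expR_ge1Dx.
- apply: E; rewrite -[X in _ --> X]divr1; apply: cvgM => //.
  apply: cvgV; first exact: oner_neq0.
  by rewrite -[X in _ --> X]subr0; apply: cvgB => //; exact: cvg_cst.
- exact: E.
Unshelve. all: by end_near. Qed.

Section max_law.
Context {R : realType} {d : measure_display} {T : measurableType d} (P : probability T R).
Context {d' : measure_display} {T' : measurableType d'} (P' : probability T' R).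

Lemma prob_le_compl (V : T -> R) y : measurable_fun setT V ->
  P (V @^-1` `]-oo, y]) = (1 - fine (P [set w | y < V w]))%:E.
Proof.
move=> mfV.
have mV : measurable [set w | y < V w].
  rewrite -[X in measurable X]setTI.
  have -> : [set w | y < V w] = V @^-1` [set` Interval (BRight y) +oo%O].
    by apply/seteqP; split => w /=; rewrite in_itv/= andbT.
  by apply: mfV => //; exact: measurable_itv.
have -> : V @^-1` `]-oo, y] = ~` [set w | y < V w].
  by apply/seteqP; split => w /=; rewrite in_itv/= leNgt => /negP.
rewrite probability_setC// EFinB fineK//.
exact: fin_num_measure.
Qed.

(** The seed [X 1%N] of the maximum is one of its terms because [0 < k], so the event is an
    intersection of [k] independent ones. *)
Lemma prob_max_le (k : nat) (X : nat -> {RV P' >-> R}) (mu : set R -> \bar R) (p y : R) :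
  (0 < k)%N -> iid_with_law k X mu -> mu `]-oo, y]%classic = p%:E ->
  P' [set w | \big[Num.max/X 1%N w]_(1 <= j < k.+1) X j w <= y] = (p ^+ k)%:E.
Proof.
move=> k0 [ind law] mup.
have mA : measurable (`]-oo, y] : set R) by exact: measurable_itv.
have -> : [set w | \big[Num.max/X 1%N w]_(1 <= j < k.+1) X j w <= y] =
    [set w | forall j, j \in iota 1 k -> `]-oo, y]%classic (X j w)].
  apply/seteqP; split => w /=.
  - rewrite big_add1 big_mkord => /bigmax_leP[_ h] j; rewrite mem_iota => /andP[j1 jk].
    have jk' : (j.-1 < k)%N by lia.
    by have := h (Ordinal jk') isT; rewrite /= prednK// in_itv.
  - move=> h; have {}h j : (1 <= j <= k)%N -> X j w <= y.
      by move=> jk; have := h j; rewrite mem_iota in_itv/=; apply; lia.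
    rewrite big_add1 big_mkord; apply/bigmax_leP; split; first by apply: h; lia.
    by move=> i _; apply: h; have := ltn_ord i; lia.
rewrite (ind _ (fun=> `]-oo, y]%classic)) ?iota_uniq//; last first.
  by move=> j; rewrite mem_iota; lia.
have -> : (\prod_(j <- iota 1 k) P' (X j @^-1` `]-oo, y]) = \prod_(j <- iota 1 k) p%:E)%E.
  apply: eq_big_seq => j; rewrite mem_iota => jk; rewrite law// ?mup//; lia.
by rewrite prodEFin big_const_seq count_predT size_iota iter_mulr_1.
Qed.

End max_law.

Section normalization.
Context {R : realType}.
Implicit Types k : nat -> nat.

Lemma sqrt_ln_cvgy k : k n @[n --> \oo] --> \oo ->
  Num.sqrt (2 * ln (k n)%:R) @[n --> \oo] --> (+oo : set_system R).
Proof.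
move=> ky; apply/cvgryPge => B.
have kR : ((k n)%:R : R) @[n --> \oo] --> +oo by exact: cvg_comp ky cvgr_idn.
near=> n; have : expR (B ^+ 2) <= (k n)%:R by near: n; move/cvgryPge : kR; exact.
move=> h; have k0 : 0 < (k n)%:R :> R by exact: lt_le_trans (expR_gt0 _) h.
have hl : B ^+ 2 <= ln (k n)%:R by rewrite -ler_expR lnK.
apply: (le_trans (ler_norm B)); rewrite -sqrtr_sqr ler_wsqrtr//.
by apply: (le_trans hl); rewrite ler_peMl ?ler1n// (le_trans _ hl)// sqr_ge0.
Unshelve. all: by end_near. Qed.

(** For L = sqrt (2 ln k), 4 pi ln k = (L sqrt (2 pi))^2: the logarithms in [beta] are twice those
    in [threshold]. *)
Lemma alpha_beta_threshold (k : nat) (x : R) : (1 < k)%N ->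
  alpha R k * x + beta R k = threshold x (Num.sqrt (2 * ln k%:R)).
Proof.
move=> k1; rewrite /beta /alpha /threshold.
have l0 : 0 < ln k%:R :> R by rewrite ln_gt0// ltr1n.
set L := Num.sqrt _; have L0 : 0 < L by rewrite sqrtr_gt0 mulr_gt0.
have p0 : 0 < 2 * pi :> R by rewrite mulr_gt0 ?pi_gt0.
have s0 : 0 < Num.sqrt (2 * pi) :> R by rewrite sqrtr_gt0.
have e : ln (ln k%:R) + ln (4 * pi) = 2 * (ln L + ln (Num.sqrt (2 * pi))) :> R.
  rewrite -!lnM ?posrE ?mulr_gt0 ?pi_gt0// [2 * ln _]mulr_natl -lnXn ?mulr_gt0//.
  rewrite exprMn !sqr_sqrtr ?(ltW p0) ?mulr_ge0 ?(ltW l0)//; congr ln; ring.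
by rewrite e invrK; field; rewrite gt_eqF.
Qed.

Lemma expR_half_sqr (k : nat) : (0 < k)%N ->
  expR (Num.sqrt (2 * ln k%:R) ^+ 2 / 2) = k%:R :> R.
Proof.
move=> k0; have k1 : 0 <= ln k%:R :> R by rewrite ln_ge0// ler1n.
by rewrite sqr_sqrtr ?mulr_ge0// mulrAC divff// mul1r lnK// posrE ltr0n.
Qed.

(** The place where the exponent 1/7 enters: L^14 = (2 ln k)^7 is o(N), while N is O(s'^2). *)
Lemma rare_levels (k N : nat -> nat) (s' u : nat -> R) :
  u =o_\oo (fun n => (N n)%:R `^ (7^-1)) -> (forall n, (k n)%:R = expR (u n)) ->
  (\forall n \near \oo, 0 < s' n /\ (N n)%:R <= 32 * s' n ^+ 2) ->
  Num.sqrt (2 * ln (k n)%:R) ^+ 7 / s' n @[n --> \oo] --> (0 : R).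
Proof.
move=> uo kE sN; apply/cvgr0Pnorm_le => eta eta0.
(* Squaring produces the constant 2^7 * 32 = 64^2; the cap at 1 gives c^7 <= c. *)
pose c : R := Num.min 1 ((64 ^-1 * eta) ^+ 2).
have c0 : 0 < c by rewrite lt_min ltr01/= exprn_gt0// mulr_gt0.
have c1 : c <= 1 by rewrite ge_min lexx.
have ce : c <= (64 ^-1 * eta) ^+ 2 by rewrite ge_min lexx orbT.
have /eqoP/(_ _ c0) h := uo.
near=> n.
have [s0 sn] : 0 < s' n /\ (N n)%:R <= 32 * s' n ^+ 2 by near: n.
have hn : `|u n| <= c * `|(N n)%:R `^ (7^-1)| by near: n.
rewrite kE expRK.
rewrite ger0_norm ?divr_ge0 ?exprn_ge0 ?sqrtr_ge0 ?(ltW s0)//.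
rewrite ler_pdivrMr// -(@ler_pXn2r _ 2) ?nnegrE ?exprn_ge0 ?sqrtr_ge0 ?mulr_ge0 ?(ltW s0) ?(ltW eta0)//.
rewrite exprAC.
have [u0|u0] := leP (u n) 0.
  rewrite ler0_sqrtr; last by rewrite mulr_ge0_le0.
  by rewrite !expr0n/= sqr_ge0.
rewrite sqr_sqrtr ?mulr_ge0 ?(ltW u0)//.
move: hn; rewrite (gtr0_norm u0) ger0_norm ?powR_ge0// => hn.
have u7 : u n ^+ 7 <= c ^+ 7 * (N n)%:R.
  apply: (@le_trans _ _ ((c * (N n)%:R `^ 7^-1) ^+ 7)).
    by rewrite lerXn2r ?nnegrE ?mulr_ge0 ?powR_ge0 ?(ltW c0) ?(ltW u0).
  by rewrite exprMn -[(_ `^ _) ^+ 7]powR_mulrn ?powR_ge0// -powRrM mulVf// powRr1.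
have c7 : c ^+ 7 <= c by rewrite -[leRHS]expr1 ler_wiXn2l ?(ltW c0).
rewrite exprMn.
apply: (@le_trans _ _ (2 ^+ 7 * (c * (32 * s' n ^+ 2)))).
  rewrite ler_wpM2l ?exprn_ge0//; apply: (le_trans u7).
  by rewrite ler_pM ?exprn_ge0 ?(ltW c0).
have -> : (eta * s' n) ^+ 2 = 2 ^+ 7 * ((64^-1 * eta) ^+ 2 * (32 * s' n ^+ 2)) by field.
apply: ler_wpM2l; first exact: exprn_ge0.
exact: ler_wpM2r (mulr_ge0 (ler0n R 32) (sqr_ge0 _)) _ _ ce.
Unshelve. all: by end_near. Qed.

End normalization.

Definition grid_sd (R : realType) (t : weyl_type) (n d m' : nat) : R :=
  Num.sqrt ((forest_steps (weyl_paths t n d))%:R * residue_var m').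

(** 32 = 2 * 16: the residue variance is least at m = 2, where it equals 1/16, and a number of roots
    between 2 and steps + 1 is at most twice the number of steps. *)
Lemma Nroots_grid_sd (R : realType) (t : weyl_type) (n d m' : nat) :
  (0 < d)%N -> (2 <= m'.+1)%N -> (2 <= Nroots t n d)%N ->
  (Nroots t n d)%:R <= 32 * grid_sd R t n d m' ^+ 2.
Proof.
move=> d0 m2 N2; rewrite sqr_sqrtr; last by rewrite mulr_ge0// residue_var_ge0.
have v16 : 16^-1 <= residue_var m' :> R.
  have m2R : 2 <= m'.+1%:R :> R by rewrite (ler_nat R 2).
  have m4 : 4 <= m'.+1%:R ^+ 2 :> R.
    by rewrite expr2 (_ : 4 = 2 * 2 :> R) ?ler_pM//; ring.
  by rewrite /residue_var ler_pdivlMr ?mulr_gt0 ?exprn_gt0//; lra.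
have N2e : (Nroots t n d)%:R <= 2 * (forest_steps (weyl_paths t n d))%:R :> R.
  rewrite -natrM ler_nat.
  have := Nroots_path_edges t n d0; have := path_edges_le_steps t n d; lia.
apply: (le_trans N2e); set w := (forest_steps _)%:R.
have w0 : 0 <= w :> R by exact: ler0n.
have := ler_wpM2l w0 v16; lra.
Qed.

Section regime.
Context {R : realType} {dT : measure_display} {T : measurableType dT} (P : probability T R).
Variables (Z : nat -> {RV P >-> R}) (t : weyl_type) (n d m' : nat).
Hypotheses (d0 : (0 < d)%N) (hZ : iid_with_law n Z (uniform_prob (Zinf_lt1 R t))).
Hypotheses (m1 : (n.+1 ^ 4 <= m'.+1)%N) (m2 : (2 <= m'.+1)%N).
Let V w : R := Xdes t n d (fun i => Z i w).
Let mu : R := (path_edges t n d)%:R * residue_mean m'.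

Lemma Xdes_regime : 1 <= grid_sd R t n d m' ->
  let dlt := 2 * (n%:R ^+ 2 / m'.+1%:R) in
  let A y := avg (fun ys : n.-tuple 'I_m'.+1 =>
    (y < (grid_descents t d ys)%:R - mu)%R%:R) in
  let Q y := fine (P [set w | y < V w]) in
  [/\ 1 <= grid_sd R t n d m',
     `|Num.sqrt (fine 'V_P[V]) - grid_sd R t n d m'| <= 15,
     `|fine 'E_P[V]%E - mu| <= 3 & 0 <= dlt] /\
  gaussian_tails (grid_sd R t n d m') A /\
  (forall y, A (y - mu) - dlt <= Q y /\ Q y <= A (y - 1 - mu) + dlt).
Proof.
move=> s1 dlt A Q; split; [split=> //|split].
- exact: sd_Xdes.
- by rewrite fine_expectation; exact: mean_Xdes.
- by rewrite mulr_ge0// divr_ge0// exprn_ge0.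
- move=> u b theta M omega b2 u0 ub M1.
  have sE : (forest_steps (weyl_paths t n d))%:R * residue_var m' =
      grid_sd R t n d m' ^+ 2.
    by rewrite sqr_sqrtr// mulr_ge0// residue_var_ge0.
  have tE : b ^+ 2 + (forest_steps (weyl_paths t n d))%:R * residue_var m' = theta.
    by rewrite sE.
  have := @martingale_end_tail _ _ _ _ _ b u M (residue_var_ge0 m')
    (martingale_end_grid t n d0 m') b2 u0.
  by rewrite tE sE; apply.
- by move=> y; exact: Xdes_tail.
Qed.

End regime.

Unset Implicit Arguments.
Set Strict Implicit.
Theorem theorem4p1 (R : realType) (W : nat -> weyl_type) (d k : nat -> nat)
  (dZ : nat -> measure_display) (TZ : forall n, measurableType (dZ n))
  (PZ : forall n, probability (TZ n) R)
  (Z : forall n, nat -> {RV (PZ n) >-> R})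
  (dX : nat -> measure_display) (TX : forall n, measurableType (dX n))
  (PX : forall n, probability (TX n) R)
  (X : forall n, nat -> {RV (PX n) >-> R})
  (hd : forall n, (2 <= n)%N -> (1 <= d n <= (dmax (W n) n).-1)%N)
  (hN : Nroots (W n) n (d n) @[n --> \oo] --> \oo)
  (hZ : forall n, iid_with_law n (Z n) (uniform_prob (Zinf_lt1 R (W n)))) :
  let V n : TZ n -> R := fun w => Xdes (W n) n (d n) (fun i => Z n i w) in
  let M n : TX n -> R :=
    fun w => \big[Num.max/X n 1%N w]_(1 <= j < (k n).+1) X n j w in
  let sigma n : R := Num.sqrt (fine 'V_(PZ n)[V n]) in
  let a n : R := sigma n * alpha R (k n) in
  let b n : R := sigma n * beta R (k n) + fine ('E_(PZ n)[V n])%E in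
  forall
  (hX : forall n, iid_with_law (k n) (X n) (fun A => PZ n (V n @^-1` A)))
  (hk : k n @[n --> \oo] --> \oo)
  (hko : exists2 u : nat -> R,
     u =o_\oo (fun n => (Nroots (W n) n (d n))%:R `^ (7^-1) : R) &
     forall n, (k n)%:R = expR (u n)),
  forall x : R,
    PX n [set w | M n w <= a n * x + b n] @[n --> \oo]
      --> (expR (- expR (- x)))%:E.
Proof.
move=> V M sigma a b hX hk hko x.
have [u uo kE] := hko.
pose N n := Nroots (W n) n (d n).
(* The fourth power serves the moments; the factor k + 1 makes k times the discretization error at
   most 2 / (n + 1). *)
pose m' n := (n.+1 ^ 4 * (k n).+1)%N.
pose s' n : R := grid_sd R (W n) n (d n) (m' n).
pose L n : R := Num.sqrt (2 * ln (k n)%:R).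
pose mu n : R := (path_edges (W n) n (d n))%:R * residue_mean (m' n).
pose dlt n : R := 2 * (n%:R ^+ 2 / (m' n).+1%:R).
pose A n (y : R) : R := avg (fun ys : n.-tuple 'I_(m' n).+1 =>
  (y < (grid_descents (W n) (d n) ys)%:R - mu n)%R%:R).
pose Q n (y : R) : R := fine (PZ n [set w | y < V n w]).
pose e n : R := fine ('E_(PZ n)[V n])%E.
have d0 n : (2 <= n)%N -> (0 < d n)%N by move=> /hd/andP[].
have m1 n : (n.+1 ^ 4 <= (m' n).+1)%N by rewrite leqW// leq_pmulr.
have m2 n : (2 <= (m' n).+1)%N by rewrite ltnS muln_gt0 expn_gt0.
have k_gt c : \forall n \near \oo, (c < k n)%N by move/cvgnyPgt : hk; exact.
have N_gt c : \forall n \near \oo, (c < N n)%N by move/cvgnyPgt : hN; exact.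
have Ns : \forall n \near \oo, (N n)%:R <= 32 * s' n ^+ 2.
  near=> n; apply: Nroots_grid_sd; [|exact: m2|near: n; exact: (N_gt 1%N)].
  by apply: d0; near: n; exact: nbhs_infty_ge.
have s1 : \forall n \near \oo, 1 <= s' n.
  near=> n; have h : (N n)%:R <= 32 * s' n ^+ 2 by near: n.
  have N32 : 32 <= (N n)%:R :> R.
    by rewrite (ler_nat R 32) ltnW//; near: n; exact: N_gt.
  rewrite -(@ler_pXn2r _ 2) ?nnegrE ?sqrtr_ge0//; lra.
have Ly : L n @[n --> \oo] --> +oo by exact: sqrt_ln_cvgy.
have L7 : L n ^+ 7 / s' n @[n --> \oo] --> (0 : R).
  apply: (rare_levels uo kE); near=> n; split; last by near: n.
  by apply: (lt_le_trans ltr01); near: n.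
have K0 : \forall n \near \oo, expR (L n ^+ 2 / 2) = (k n)%:R.
  by near=> n; apply: expR_half_sqr; near: n; exact: k_gt.
have Kdlt : expR (L n ^+ 2 / 2) * dlt n @[n --> \oo] --> (0 : R).
  apply: (@squeeze_cvgr _ _ _ _ (fun=> 0) (fun n => 2 * n.+1%:R^-1)).
  - near=> n; have -> : expR (L n ^+ 2 / 2) = (k n)%:R by near: n.
    rewrite /dlt; apply/andP; split.
      by rewrite !mulr_ge0// ?invr_ge0// exprn_ge0.
    rewrite mulrCA ler_pM2l// mulrA ler_pdivrMr// [leRHS]mulrC ler_pdivlMr//.
    rewrite -natrX -!natrM ler_nat /m'; nia.
  - exact: cvg_cst.
  - rewrite -[X in _ --> X](mulr0 (2 : R)); apply: cvgMr.
    exact: cvg_harmonic.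
have regime : \forall n \near \oo,
  [/\ 1 <= s' n, `|sigma n - s' n| <= 15, `|e n - mu n| <= 3 & 0 <= dlt n] /\
  gaussian_tails (s' n) (A n) /\
  (forall y, A n (y - mu n) - dlt n <= Q n y /\ Q n y <= A n (y - 1 - mu n) + dlt n).
  near=> n; apply: (Xdes_regime _ (hZ n) (m1 n) (m2 n)); last by near: n.
  by apply: d0; near: n; exact: nbhs_infty_ge.
have KQ := @tail_threshold_cvg R L s' sigma e mu dlt A Q Ly L7 Kdlt regime x.
pose q n := Q n (sigma n * threshold x (L n) + e n).
have kq : (k n)%:R * q n @[n --> \oo] --> expR (- x).
  apply: cvg_trans KQ; apply: near_eq_cvg; near=> n; congr (_ * _).
  by near: n.
have lim := expr_onemX_cvg hk kq.
have limE : ((1 - q n) ^+ k n)%:E @[n --> \oo] --> (expR (- expR (- x)))%:E.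
  by apply/fine_cvgP; split => //; exact: nearW.
apply: cvg_trans limE; apply: near_eq_cvg; near=> n.
have thr : a n * x + b n = sigma n * threshold x (L n) + e n.
  rewrite /a /b -alpha_beta_threshold; last by near: n; exact: k_gt.
  by rewrite /e; ring.
have mV : measurable_fun setT (V n).
  have dn : (0 < d n)%N by apply: d0; near: n; exact: nbhs_infty_ge.
  by have [] := bounded_rv_Xdes (Z n) (W n) n dn.
rewrite thr; symmetry; apply: prob_max_le (hX n) _.
  by near: n; exact: k_gt.
exact: prob_le_compl.
Unshelve. all: by end_near. Qed.
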